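(* Let $E$ be a finite-dimensional Banach space with $\dim E\ge2$ and let $Z$ be an infinite-dimensional Banach space, over the same field $\mathbb K\in\{\mathbb R,\mathbb C\}$. Then $$C_{\mathrm{NJ}}(\mathcal L(E,Z))\ge\max\{C_{\mathrm{NJ}}(Z),\,C_{\mathrm{NJ}}(E^* ),\,2\,\omega_\perp(E)^2\}.$$ In addition, the following three conditions on $E$ are equivalent: (i) $E$ has the orthogonal-contact property (OCP), i.e. $\omega_\perp(E)=1$; (ii) $C_{\mathrm{NJ}}(\mathcal L(E,H))=2$ for an (i.e. some) infinite-dimensional Hilbert space $H$; (iii) $C_{\mathrm{NJ}}(\mathcal L(E,Z))=2$ for every infinite-dimensional Banach space $Z$. Consequently, for every Banach space $Y$ with $2\le\dim Y<\infty$, $$C_{\mathrm{NJ}}(X\widehat\otimes_{\varepsilon}Y)=2\ \text{for every infinite-dimensional Banach space }X\iff\omega_\perp(Y^* )=1,$$ $$C_{\mathrm{NJ}}(X\widehat\otimes_{\pi}Y)=2\ \text{for every infinite-dimensional Banach space }X\iff\omega_\perp(Y)=1.$$ In particular, for every infinite-dimensional Hilbert space $H$ and every such $Y$, $$C_{\mathrm{NJ}}(H\widehat\otimes_{\varepsilon}Y)=2\iff\omega_\perp(Y^* )=1,\qquad C_{\mathrm{NJ}}(H\widehat\otimes_{\pi}Y)=2\iff\omega_\perp(Y)=1.$$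
   Context: For a Banach space $X$, the von Neumann--Jordan constant is $$C_{\mathrm{NJ}}(X)=\sup\left\{\frac{\|x+y\|^{2}+\|x-y\|^{2}}{2(\|x\|^{2}+\|y\|^{2})}: x,y\in X,\ (x,y)\neq(0,0)\right\}.$$ For Banach spaces $X,Y$ over $\mathbb K$, and $w=\sum_{j=1}^r x_j\otimes y_j$ in the algebraic tensor product $X\otimes Y$, the injective norm is $\|w\|_\varepsilon=\sup\{|\sum_{j} x^*(x_j)y^*(y_j)|: x^*\in B_{X^*},\,y^*\in B_{Y^*}\}$ and the projective norm is $\|w\|_\pi=\inf\{\sum_{j}\|x_j\|\|y_j\|: w=\sum_{j} x_j\otimes y_j\}$. The completions of $X\otimes Y$ for these norms are denoted $X\widehat\otimes_\varepsilon Y$ and $X\widehat\otimes_\pi Y$. $\mathcal L(E,Z)$ is the space of bounded linear operators $E\to Z$ with the operator norm. $S_E$ is the unit sphere of $E$ and $\ell_2^d$ is $\mathbb K^d$ with the Euclidean norm and inner product. For a finite-dimensional space $E$ with $d=\dim E\ge2$, $$\omega_\perp(E)=\max\bigl\{\min\{\|Qu\|_2,\|Qv\|_2\}:\ Q:E\to\ell_2^d\text{ linear},\ \|Q\|\le1,\ u,v\in S_E,\ \langle Qu,Qv\rangle=0\bigr\}.$$ $E$ has the orthogonal-contact property (OCP) if $\omega_\perp(E)=1$. *)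

(* Defs.v *)
From HB Require Import structures.
From mathcomp Require Import all_boot all_order all_algebra.
From mathcomp Require Import generic_quotient ring_quotient complex sesquilinear.
From mathcomp Require Import all_classical all_reals.
From mathcomp Require Import ring lra.
From mathcomp Require Import interval_inference topology normedtype sequences.

Set Implicit Arguments.
Unset Strict Implicit.
Unset Printing Implicit Defensive.

Import Order.TTheory GRing.Theory Num.Theory.
Import numFieldNormedType.Exports.

Local Open Scope classical_set_scope.
Local Open Scope ring_scope.

(* The scalar field: the reals or the complex numbers over R. *)
Variant scalar_kind := RealScalars | ComplexScalars.

Definition scalars (R : realType) (k : scalar_kind) : numFieldType :=
  match k with RealScalars => R | ComplexScalars => R[i] end.

Section Scalars.
Variables (R : realType) (k : scalar_kind).

Definition real_part : scalars R k -> R :=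
  match k with RealScalars => id | ComplexScalars => @complex.Re R end.

Definition of_real : R -> scalars R k :=
  match k with RealScalars => id | ComplexScalars => real_complex R end.

Definition scalar_conj : scalars R k -> scalars R k :=
  match k with RealScalars => id | ComplexScalars => @conjc R end.

Lemma of_realK : cancel of_real real_part.
Proof. by rewrite /of_real /real_part; case: k. Qed.

Lemma of_real_inj : injective of_real.
Proof. exact: can_inj of_realK. Qed.

Lemma of_realD x y : of_real (x + y) = of_real x + of_real y.
Proof. by rewrite /of_real; case: k => //; exact: rmorphD. Qed.

Lemma of_realM x y : of_real (x * y) = of_real x * of_real y.
Proof. by rewrite /of_real; case: k => //; exact: rmorphM. Qed.

Lemma of_real0 : of_real 0 = 0.
Proof. by rewrite /of_real; case: k. Qed.

Lemma of_real1 : of_real 1 = 1.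
Proof. by rewrite /of_real; case: k. Qed.

Lemma of_realN x : of_real (- x) = - of_real x.
Proof. by rewrite /of_real; case: k => //; exact: rmorphN. Qed.

Lemma ler_of_real x y : (of_real x <= of_real y) = (x <= y).
Proof. by rewrite /of_real; case: k => //; exact: lecR. Qed.

Lemma ltr_of_real x y : (of_real x < of_real y) = (x < y).
Proof. by rewrite /of_real; case: k => //; exact: ltcR. Qed.

Lemma ge0_of_realE (z : scalars R k) : 0 <= z -> of_real (real_part z) = z.
Proof.
rewrite /of_real /real_part; case: k z => //= -[a b].
by rewrite lecE /= => /andP[/eqP -> _].
Qed.

End Scalars.

Section RealNorm.
Variables (R : realType) (k : scalar_kind).
Local Notation K := (scalars R k).

(* The norm of a normedModType K takes its values in K; this is the same
   number in R. *)
Definition rnorm (V : normedModType K) (x : V) : R := real_part `|x|.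

Lemma of_real_rnorm (V : normedModType K) (x : V) : of_real k (rnorm x) = `|x|.
Proof. exact: ge0_of_realE. Qed.

Variable V : normedModType K.
Implicit Types x y : V.

Lemma rnorm_ge0 x : 0 <= rnorm x.
Proof. by rewrite -(@ler_of_real R k) of_real_rnorm of_real0. Qed.

Lemma ler_rnormD x y : rnorm (x + y) <= rnorm x + rnorm y.
Proof. by rewrite -(@ler_of_real R k) of_realD !of_real_rnorm ler_normD. Qed.

Lemma rnormZ (a : K) x : rnorm (a *: x) = rnorm (a : K^o) * rnorm x.
Proof.
by apply: (@of_real_inj R k); rewrite of_realM !of_real_rnorm normrZ.
Qed.

Lemma rnorm0 : rnorm (0 : V) = 0.
Proof. by rewrite /rnorm normr0 -(@of_real0 R k) of_realK. Qed.

Lemma rnorm0_eq0 x : rnorm x = 0 -> x = 0.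
Proof.
by move=> x0; apply/eqP; rewrite -normr_eq0 -of_real_rnorm x0 of_real0.
Qed.

Lemma rnorm_gt0 x : x != 0 -> 0 < rnorm x.
Proof.
by move=> x0; rewrite lt_def rnorm_ge0 andbT; apply: contra_neq x0 => /rnorm0_eq0.
Qed.

Lemma rnorm_of_real (r : R) : rnorm (of_real k r : K^o) = `|r|.
Proof.
apply: (@of_real_inj R k); rewrite of_real_rnorm.
have [r0|/ltW r0] := leP 0 r.
  by rewrite (ger0_norm r0); apply: ger0_norm; rewrite -(@of_real0 R k) ler_of_real.
rewrite (ler0_norm r0) of_realN; apply: ler0_norm.
by rewrite -(@of_real0 R k) ler_of_real.
Qed.

End RealNorm.

Section BoundedOperators.
Variables (R : realType) (k : scalar_kind).
Local Notation K := (scalars R k).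
Variables E Z : normedModType K.

Definition bounded_linear : {pred E -> Z} := fun f =>
  `[< linear f /\ exists M : R, forall x, rnorm (f x) <= M * rnorm x >].

Lemma bounded_linearP f : reflect
  (linear f /\ exists M : R, forall x, rnorm (f x) <= M * rnorm x)
  (f \in bounded_linear).
Proof. exact: asboolP. Qed.

Lemma bounded_linear_submod : submod_closed bounded_linear.
Proof.
split; first apply/bounded_linearP; first split.
- by move=> a x y; rewrite /= /GRing.zero/= scaler0 addr0.
- by exists 0 => x; rewrite rnorm0 mul0r.
move=> a f g /bounded_linearP[fl [M fM]] /bounded_linearP[gl [N gN]].
apply/bounded_linearP; split.
  move=> b x y; rewrite /= !fctE fl gl !scalerDr !scalerA mulrC -!addrA.
  by congr (_ + _); rewrite addrCA.
exists (rnorm (a : K^o) * M + N) => x.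
rewrite (le_trans (ler_rnormD _ _))// mulrDl lerD//.
by rewrite rnormZ -mulrA ler_wpM2l// rnorm_ge0.
Qed.

HB.instance Definition _ :=
  GRing.isSubmodClosed.Build K (E -> Z) bounded_linear bounded_linear_submod.

Record bounded_op := BoundedOp {
  bounded_op_fun :> E -> Z;
  _ : bounded_op_fun \in bounded_linear }.

HB.instance Definition _ := [isSub for bounded_op_fun].
HB.instance Definition _ := [Choice of bounded_op by <:].
HB.instance Definition _ := [SubChoice_isSubLmodule of bounded_op by <:].

Implicit Types f g : bounded_op.

Lemma bounded_op_linear f : linear f.
Proof. by case: f => f /= /bounded_linearP[]. Qed.

HB.instance Definition _ f :=
  GRing.isLinear.Build K E Z _ (bounded_op_fun f) (bounded_op_linear f).

Lemma bounded_op_bounded f :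
  exists M : R, forall x, rnorm (f x) <= M * rnorm x.
Proof. by case: f => f /= /bounded_linearP[]. Qed.

Definition opnorm f : R := sup [set rnorm (f x) | x in [set x | rnorm x <= 1]].

Lemma opnorm_has_sup f :
  has_sup [set rnorm (f x) | x in [set x | rnorm x <= 1]].
Proof.
split; first by exists (rnorm (f 0)), 0 => //=; rewrite rnorm0.
have [M fM] := bounded_op_bounded f; exists `|M| => _ [x /= x1 <-].
rewrite (le_trans (fM x))// (le_trans (ler_wpM2r (rnorm_ge0 _) (ler_norm _)))//.
by rewrite ler_piMr.
Qed.

Lemma le_opnorm1 f x : rnorm x <= 1 -> rnorm (f x) <= opnorm f.
Proof. by move=> x1; apply: sup_upper_bound (opnorm_has_sup f) _ _; exists x. Qed.

Lemma opnorm_ge0 f : 0 <= opnorm f.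
Proof. by rewrite (le_trans (rnorm_ge0 (f 0)))// le_opnorm1// rnorm0. Qed.

Lemma opnorm_le f (M : R) :
  (forall x, rnorm x <= 1 -> rnorm (f x) <= M) -> opnorm f <= M.
Proof.
by move=> fM; apply: ge_sup; [case: (opnorm_has_sup f)|move=> _ [x x1 <-]; exact: fM].
Qed.

Lemma le_opnorm f x : rnorm (f x) <= opnorm f * rnorm x.
Proof.
have [->|x0] := eqVneq x 0; first by rewrite linear0 !rnorm0 mulr0.
have nx0 := rnorm_gt0 x0.
have := @le_opnorm1 f (of_real k (rnorm x)^-1 *: x).
rewrite linearZ/= !rnormZ rnorm_of_real ger0_norm; last by rewrite invr_ge0 ltW.
rewrite mulVf ?gt_eqF//.
by move/(_ (lexx 1)); rewrite ler_pdivrMl// mulrC.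
Qed.

Lemma ler_opnormD f g : opnorm (f + g) <= opnorm f + opnorm g.
Proof.
apply: opnorm_le => x x1; rewrite (le_trans (ler_rnormD _ _))//.
by rewrite lerD// le_opnorm1.
Qed.

Lemma opnormZ_le a f : opnorm (a *: f) <= rnorm (a : K^o) * opnorm f.
Proof.
apply: opnorm_le => x x1; rewrite rnormZ.
by rewrite ler_wpM2l ?rnorm_ge0 ?le_opnorm1.
Qed.

Lemma opnormZ a f : opnorm (a *: f) = rnorm (a : K^o) * opnorm f.
Proof.
apply/eqP; rewrite eq_le opnormZ_le/=.
have [->|a0] := eqVneq a 0; first by rewrite rnorm0 mul0r opnorm_ge0.
have na0 : 0 < rnorm (a : K^o) by exact: rnorm_gt0.
have := opnormZ_le a^-1 (a *: f); rewrite scalerA mulVf// scale1r.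
rewrite -(ler_pM2l na0) => /le_trans; apply.
by rewrite mulrA -rnormZ /= /GRing.scale/= mulfV// /rnorm normr1 -(@of_real1 R k) of_realK mul1r.
Qed.

Lemma opnorm0_eq0 f : opnorm f = 0 -> f = 0.
Proof.
move=> f0; apply/val_inj/funext => x /=; apply: rnorm0_eq0; apply/eqP.
by rewrite eq_le rnorm_ge0 andbT (le_trans (le_opnorm f x))// f0 mul0r.
Qed.

Let norm f : K := of_real k (opnorm f).

Let ler_normD f g : norm (f + g) <= norm f + norm g.
Proof. by rewrite -of_realD ler_of_real ler_opnormD. Qed.

Let normrZ a f : norm (a *: f) = `|a| * norm f.
Proof. by rewrite /norm opnormZ of_realM of_real_rnorm. Qed.

Let normr0_eq0 f : norm f = 0 -> f = 0.
Proof. by rewrite -(@of_real0 R k) => /of_real_inj/opnorm0_eq0. Qed.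

HB.instance Definition _ := Lmodule_isNormed.Build K bounded_op
  ler_normD normrZ normr0_eq0.

Lemma rnorm_bounded_op f : rnorm f = opnorm f.
Proof. exact: of_realK. Qed.

End BoundedOperators.

Section EuclideanSpace.
Variables (R : realType) (k : scalar_kind) (d : nat).
Local Notation K := (scalars R k).

(* K^d with the Euclidean norm; a copy of 'rV_d, which carries the sup norm. *)
Definition ell2 := 'rV[K]_d.

HB.instance Definition _ := GRing.Lmodule.on ell2.

Implicit Types x y : ell2.

Definition ell2_norm x : R := Num.sqrt (\sum_i rnorm (x ord0 i : K^o) ^+ 2).

(* Linear in the first argument. *)
Definition ell2_dot x y : K := \sum_i x ord0 i * scalar_conj (y ord0 i).

Lemma cauchy_schwarz_sum (a b : 'I_d -> R) :
  (\sum_i a i * b i) ^+ 2 <= (\sum_i a i ^+ 2) * (\sum_i b i ^+ 2).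
Proof.
have : 0 <= \sum_i \sum_j (a i * b j - a j * b i) ^+ 2.
  by apply: sumr_ge0 => i _; apply: sumr_ge0 => j _; exact: sqr_ge0.
suff -> : \sum_i \sum_j (a i * b j - a j * b i) ^+ 2 =
    ((\sum_i a i ^+ 2) * (\sum_i b i ^+ 2) - (\sum_i a i * b i) ^+ 2) *+ 2.
  by rewrite pmulrn_lge0// subr_ge0.
transitivity (\sum_i \sum_j (a i ^+ 2 * b j ^+ 2 + b i ^+ 2 * a j ^+ 2
    - (a i * b i) * (a j * b j) *+ 2)).
  apply: eq_bigr => i _; apply: eq_bigr => j _.
  by ring.
rewrite expr2 !big_distrlr/= mulrnBl mulr2n.
rewrite [X in _ = _ + X - _]exchange_big/=.
rewrite -big_split/= -sumrMnl -sumrB; apply: eq_bigr => i _.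
rewrite -big_split/= -sumrMnl -sumrB; apply: eq_bigr => j _.
by ring.
Qed.

Lemma ler_ell2_normD x y : ell2_norm (x + y) <= ell2_norm x + ell2_norm y.
Proof.
pose a i := rnorm (x ord0 i : K^o); pose b i := rnorm (y ord0 i : K^o).
have sq0 (f : 'I_d -> R) : 0 <= \sum_i f i ^+ 2.
  by apply: sumr_ge0 => i _; exact: sqr_ge0.
rewrite -ler_sqr ?nnegrE ?addr_ge0 ?sqrtr_ge0// sqrrD !sqr_sqrtr//.
rewrite (@le_trans _ _ (\sum_i (a i + b i) ^+ 2))//.
  apply: ler_sum => i _; rewrite ler_sqr ?nnegrE ?addr_ge0 ?rnorm_ge0// mxE.
  exact: ler_rnormD.
under eq_bigr do rewrite sqrrD.
rewrite !big_split/= -mulr2n lerD2r lerD2l lerMn2r/=.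
rewrite (le_trans (ler_norm _))// -sqrtr_sqr -sqrtrM//.
by apply: ler_wsqrtr; exact: cauchy_schwarz_sum.
Qed.

Lemma ell2_normZ (c : K) x : ell2_norm (c *: x) = rnorm (c : K^o) * ell2_norm x.
Proof.
rewrite /ell2_norm; under eq_bigr => i _.
  rewrite mxE (rnormZ c (x ord0 i : K^o)) exprMn; over.
by rewrite -mulr_sumr sqrtrM ?sqr_ge0// sqrtr_sqr ger0_norm ?rnorm_ge0.
Qed.

Lemma ell2_norm0_eq0 x : ell2_norm x = 0 -> x = 0.
Proof.
move=> /eqP; rewrite sqrtr_eq0 => x0.
have /eqP : \sum_i rnorm (x ord0 i : K^o) ^+ 2 = 0.
  by apply/eqP; rewrite eq_le x0 sumr_ge0// => i _; exact: sqr_ge0.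
rewrite psumr_eq0 => [/allP x0'|i _]; last exact: sqr_ge0.
apply/rowP => i; rewrite mxE; apply: (@rnorm0_eq0 R k K^o); apply/eqP.
by rewrite -sqrf_eq0; apply: (implyP (x0' i (mem_index_enum i))).
Qed.

Let norm x : K := of_real k (ell2_norm x).

Let ler_normD x y : norm (x + y) <= norm x + norm y.
Proof. by rewrite -of_realD ler_of_real ler_ell2_normD. Qed.

Let normrZ c x : norm (c *: x) = `|c| * norm x.
Proof. by rewrite /norm ell2_normZ of_realM of_real_rnorm. Qed.

Let normr0_eq0 x : norm x = 0 -> x = 0.
Proof. by rewrite -(@of_real0 R k) => /of_real_inj/ell2_norm0_eq0. Qed.

HB.instance Definition _ := Lmodule_isNormed.Build K ell2
  ler_normD normrZ normr0_eq0.

Lemma rnorm_ell2 x : rnorm x = ell2_norm x.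
Proof. exact: of_realK. Qed.

End EuclideanSpace.

Section GeometricConstants.
Variables (R : realType) (k : scalar_kind).
Local Notation K := (scalars R k).

Definition has_dim (V : lmodType K) (n : nat) :=
  exists f : {linear V -> 'rV[K]_n}, bijective f.

Definition finite_dim (V : lmodType K) := exists n, has_dim V n.

(* dimension V = 0 when V is infinite-dimensional. *)
Definition dimension (V : lmodType K) : nat := xget 0%N [set n | has_dim V n].

(* Together with the completeness of H: H is a Hilbert space. *)
Definition is_hilbert (H : normedModType K) :=
  exists ip : H -> H -> K,
    [/\ forall y, scalar (ip ^~ y),
        forall x y, ip y x = scalar_conj (ip x y) &
        forall x, ip x x = `|x| ^+ 2].

(* The set is bounded by 2, and nonempty as soon as X is nonzero. *)
Definition CNJ (X : normedModType K) : R :=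
  sup [set r | exists x y : X, (x, y) <> (0, 0) /\
    r = (rnorm (x + y) ^+ 2 + rnorm (x - y) ^+ 2) /
        (2%:R * (rnorm x ^+ 2 + rnorm y ^+ 2))].

Definition dual_space (X : normedModType K) := bounded_op X K^o.

(* The greatest element of A, 0 if there is none. In omega_perp below it exists
   when E is finite-dimensional of dimension at least 1, by compactness. *)
Definition maximum (A : set R) : R := xget 0 [set m | A m /\ ubound A m].

(* A linear map from a finite-dimensional E is bounded, so Q ranges over all
   the linear contractions from E to ell2. *)
Definition omega_perp (E : normedModType K) : R :=
  maximum [set r | exists (Q : bounded_op E (ell2 R k (dimension E))) (u v : E),
    [/\ rnorm Q <= 1, rnorm u = 1, rnorm v = 1,
        ell2_dot (Q u) (Q v) = 0 &
        r = Num.min (rnorm (Q u)) (rnorm (Q v))]].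

Definition OCP (E : normedModType K) := omega_perp E = 1.

End GeometricConstants.

Section Seminorms.
Variables (R : realType) (k : scalar_kind).
Local Notation K := (scalars R k).

Record seminorm (V : lmodType K) := Seminorm {
  seminorm_fun :> V -> R;
  ler_seminormD : forall x y,
    seminorm_fun (x + y) <= seminorm_fun x + seminorm_fun y;
  seminormZ : forall (a : K) x,
    seminorm_fun (a *: x) = rnorm (a : K^o) * seminorm_fun x }.

Variables (V : lmodType K) (p : seminorm V).

Lemma seminorm0 : p 0 = 0.
Proof. by rewrite -(scale0r (0 : V)) seminormZ rnorm0 mul0r. Qed.

Lemma seminormN x : p (- x) = p x.
Proof.
rewrite -scaleN1r seminormZ; suff -> : rnorm (-1 : K^o) = 1 by rewrite mul1r.
by apply: (@of_real_inj R k); rewrite of_real_rnorm normrN1 of_real1.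
Qed.

Lemma seminorm_ge0 x : 0 <= p x.
Proof.
have := ler_seminormD p x (- x); rewrite subrr seminorm0 seminormN -mulr2n.
by rewrite pmulrn_lge0.
Qed.

Lemma seminormB x y : p (x - y) = p (y - x).
Proof. by rewrite -seminormN opprB. Qed.

Lemma ler_dist_seminorm x y : `|p x - p y| <= p (x - y).
Proof.
rewrite ler_distlC lerBlDr; apply/andP; split.
  by rewrite -{1}(subrK y x) addrC (le_trans (ler_seminormD _ _ _)).
by rewrite seminormB -{1}(subrK x y) addrC (le_trans (ler_seminormD _ _ _)).
Qed.

End Seminorms.

Section Completion.
Local Open Scope quotient_scope.
Variables (R : realType) (k : scalar_kind).
Local Notation K := (scalars R k).
Variables (V : lmodType K) (p : seminorm V).

Definition cauchy_seq : {pred nat -> V} := fun u =>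
  `[< forall e : R, 0 < e -> exists N, forall m n,
      (N <= m)%N -> (N <= n)%N -> p (u m - u n) < e >].

Lemma cauchy_seqP u : reflect
  (forall e : R, 0 < e -> exists N, forall m n,
      (N <= m)%N -> (N <= n)%N -> p (u m - u n) < e)
  (u \in cauchy_seq).
Proof. exact: asboolP. Qed.

Lemma cauchy_seq_submod : submod_closed cauchy_seq.
Proof.
split.
  by apply/cauchy_seqP => e e0; exists 0%N => m n _ _; rewrite subrr seminorm0.
move=> a u v /cauchy_seqP uC /cauchy_seqP vC; apply/cauchy_seqP => e e0.
have a0 : 0 < rnorm (a : K^o) + 1 by rewrite ltr_wpDl ?rnorm_ge0.
have e20 : 0 < e / 2 by rewrite divr_gt0.
have [N uN] := uC (e / 2 / (rnorm (a : K^o) + 1)) (divr_gt0 e20 a0).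
have [M vM] := vC (e / 2) e20.
exists (maxn N M) => m n; rewrite !geq_max => /andP[Nm Mm] /andP[Nn Mn].
rewrite !fctE opprD addrACA -scalerBr (le_lt_trans (ler_seminormD _ _ _))//.
rewrite [ltRHS]splitr ler_ltD ?vM// seminormZ.
rewrite (@le_trans _ _ ((rnorm (a : K^o) + 1) * p (u m - u n)))//.
  by rewrite ler_wpM2r ?seminorm_ge0// lerDl.
by rewrite mulrC -ler_pdivlMr// ltW// uN.
Qed.

HB.instance Definition _ :=
  GRing.isSubmodClosed.Build K (nat -> V) cauchy_seq cauchy_seq_submod.

Record cauchy_sequence := CauchySequence {
  cauchy_sequence_fun :> nat -> V;
  _ : cauchy_sequence_fun \in cauchy_seq }.

HB.instance Definition _ := [isSub for cauchy_sequence_fun].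
HB.instance Definition _ := [Choice of cauchy_sequence by <:].
HB.instance Definition _ := [SubChoice_isSubLmodule of cauchy_sequence by <:].

Implicit Types u v : cauchy_sequence.

Definition lim_seminorm u : R := limn (fun n => p (u n)).

Lemma cauchy_sequence_cauchy u (e : R) : 0 < e -> exists N, forall m n,
  (N <= m)%N -> (N <= n)%N -> p (u m - u n) < e.
Proof. by case: u => u /= /cauchy_seqP; exact. Qed.

Lemma lim_seminorm_cvg u : p (u n) @[n --> \oo] --> lim_seminorm u.
Proof.
suff : cvg (p (u n) @[n --> \oo]) by [].
apply: R_complete; apply: cauchy_exP => e e0.
have [N uN] := cauchy_sequence_cauchy u e0.
exists (p (u N)); exists N => // n /= Nn; rewrite -ball_normE /ball_/=.
by apply: (le_lt_trans (ler_dist_seminorm p (u N) (u n))); exact: uN.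
Qed.

Arguments lim_seminorm_cvg u : clear implicits.

Lemma lim_seminorm_ge0 u : 0 <= lim_seminorm u.
Proof.
apply: (cvgr_to_ge (lim_seminorm_cvg u)).
by apply: nearW => n; exact: seminorm_ge0.
Qed.

Lemma lim_seminorm_le u (M : R) N :
  (forall n, (N <= n)%N -> p (u n) <= M) -> lim_seminorm u <= M.
Proof.
by move=> uM; apply: (cvgr_to_le (lim_seminorm_cvg u)); exists N => // n /uM.
Qed.

Lemma ler_lim_seminormD u v :
  lim_seminorm (u + v) <= lim_seminorm u + lim_seminorm v.
Proof.
apply: (ler_cvg_to (lim_seminorm_cvg (u + v))
  (cvgD (lim_seminorm_cvg u) (lim_seminorm_cvg v))).
by apply: nearW => n; exact: ler_seminormD.
Qed.

Lemma lim_seminormZ a u :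
  lim_seminorm (a *: u) = rnorm (a : K^o) * lim_seminorm u.
Proof.
apply: (cvg_unique _ (lim_seminorm_cvg (a *: u))) => //.
rewrite (_ : (fun n => _) = (fun n => rnorm (a : K^o) * p (u n))).
  exact: cvgMl_tmp (lim_seminorm_cvg u).
by apply/funext => n; rewrite -seminormZ.
Qed.

Definition null_sequence : {pred cauchy_sequence} := fun u => lim_seminorm u == 0.

Lemma null_sequence_submod : submod_closed null_sequence.
Proof.
have n0 : 0 \in null_sequence.
  by rewrite /in_mem/= /null_sequence -(scale0r (0 : cauchy_sequence)) lim_seminormZ rnorm0 mul0r.
split=> // a u v /eqP u0 /eqP v0; rewrite /in_mem/= /null_sequence.
rewrite eq_le lim_seminorm_ge0 andbT (le_trans (ler_lim_seminormD _ _))//.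
by rewrite lim_seminormZ u0 v0 mulr0 addr0.
Qed.

HB.instance Definition _ := GRing.isSubmodClosed.Build K cauchy_sequence
  null_sequence null_sequence_submod.

(* Cauchy sequences of (V, p) modulo those of limit seminorm 0: this is the
   completion of (V, p) when p is a norm; see rnorm_to_completion,
   to_completion_dense and completion_cauchy_cvg. *)
Definition completion := Quotient.quot null_sequence.

HB.instance Definition _ := GRing.Zmodule.on completion.
HB.instance Definition _ := EqQuotient.on completion.

Implicit Types x y : completion.

Lemma eq_piP u v :
  reflect (\pi_completion u = \pi_completion v) (lim_seminorm (u - v) == 0).
Proof.
have -> : (lim_seminorm (u - v) == 0) = (u == v %[mod completion]).
  by rewrite -Quotient.idealrBE.
exact: eqP.
Qed.

Lemma pi_completionD u v :
  \pi_completion (u + v) = \pi_completion u + \pi_completion v.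
Proof. exact: Quotient.pi_add. Qed.

Lemma pi_completion_surj x : exists u, x = \pi_completion u.
Proof. by exists (repr x); rewrite reprK. Qed.

Let scale (a : K) x : completion := \pi_completion (a *: repr x).

Let scale_pi a u : scale a (\pi_completion u) = \pi_completion (a *: u).
Proof.
apply/eq_piP; rewrite -scalerBr lim_seminormZ.
have /eq_piP/eqP -> : \pi_completion (repr (\pi_completion u)) = \pi_completion u.
  by rewrite reprK.
by rewrite mulr0.
Qed.

Let scaleA a b x : scale a (scale b x) = scale (a * b) x.
Proof. by have [u ->] := pi_completion_surj x; rewrite !scale_pi scalerA. Qed.

Let scale1 : left_id 1 scale.
Proof. by move=> x; have [u ->] := pi_completion_surj x; rewrite scale_pi scale1r. Qed.

Let scaleDr : right_distributive scale +%R.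
Proof.
move=> a x y; have [u ->] := pi_completion_surj x.
have [v ->] := pi_completion_surj y; rewrite -pi_completionD !scale_pi.
by rewrite scalerDr pi_completionD.
Qed.

Let scaleDl x : {morph scale^~ x : a b / a + b}.
Proof.
by move=> a b; have [u ->] := pi_completion_surj x; rewrite !scale_pi scalerDl pi_completionD.
Qed.

HB.instance Definition _ := GRing.Zmodule_isLmodule.Build K completion
  scaleA scale1 scaleDr scaleDl.

Lemma pi_completionZ a u :
  \pi_completion (a *: u) = a *: \pi_completion u.
Proof. by rewrite -scale_pi. Qed.

Definition completion_norm x : R := lim_seminorm (repr x).

Lemma completion_norm_pi u : completion_norm (\pi_completion u) = lim_seminorm u.
Proof.
have le_lim v w : \pi_completion v = \pi_completion w ->
    lim_seminorm v <= lim_seminorm w.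
  move=> /eq_piP/eqP vw; rewrite -{1}(subrK w v).
  by rewrite (le_trans (ler_lim_seminormD _ _))// vw add0r.
by apply/eqP; rewrite eq_le !le_lim ?reprK.
Qed.

Let norm x : K := of_real k (completion_norm x).

Let ler_normD x y : norm (x + y) <= norm x + norm y.
Proof.
have [u ->] := pi_completion_surj x; have [v ->] := pi_completion_surj y.
rewrite -pi_completionD -of_realD ler_of_real.
by rewrite !completion_norm_pi ler_lim_seminormD.
Qed.

Let normrZ a x : norm (a *: x) = `|a| * norm x.
Proof.
have [u ->] := pi_completion_surj x; rewrite -pi_completionZ /norm !completion_norm_pi lim_seminormZ.
by rewrite of_realM of_real_rnorm.
Qed.

Let normr0_eq0 x : norm x = 0 -> x = 0.
Proof.
rewrite -(@of_real0 R k) => /of_real_inj x0.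
have <- : \pi_completion 0 = 0 :> completion.
  by rewrite -[X in \pi_ _ X](scale0r (0 : cauchy_sequence)) pi_completionZ scale0r.
rewrite -[x]reprK; apply/eq_piP; rewrite subr0; exact/eqP.
Qed.

HB.instance Definition _ := Lmodule_isNormed.Build K completion
  ler_normD normrZ normr0_eq0.

Lemma rnorm_completion u : rnorm (\pi_completion u : completion) = lim_seminorm u.
Proof. by rewrite -completion_norm_pi; exact: of_realK. Qed.

Lemma const_cauchy_seq (v : V) : (fun=> v) \in cauchy_seq.
Proof.
by apply/cauchy_seqP => e e0; exists 0%N => *; rewrite subrr seminorm0.
Qed.

Definition to_completion (v : V) : completion :=
  \pi_completion (CauchySequence (const_cauchy_seq v)).

Lemma to_completion_linear : linear to_completion.
Proof.
move=> a v w; rewrite /to_completion -pi_completionZ -pi_completionD.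
by congr (\pi_completion _); apply/val_inj/funext.
Qed.

HB.instance Definition _ :=
  GRing.isLinear.Build K V completion _ to_completion to_completion_linear.

Lemma rnorm_to_completion (v : V) : rnorm (to_completion v) = p v.
Proof.
rewrite rnorm_completion.
apply: (cvg_unique _ (@lim_seminorm_cvg _)) => //=. exact: (@cvg_cst R).
Qed.

Lemma rnorm_sub_to_completion u (e : R) : 0 < e -> exists N, forall n,
  (N <= n)%N -> rnorm (\pi_completion u - to_completion (u n)) <= e.
Proof.
move=> e0; have [N uN] := cauchy_sequence_cauchy u e0; exists N => n Nn.
have -> : \pi_completion u - to_completion (u n) =
    \pi_completion (u - CauchySequence (const_cauchy_seq (u n))).
  by rewrite -scaleN1r -pi_completionZ -pi_completionD scaleN1r.
rewrite rnorm_completion; apply: (@lim_seminorm_le _ _ N) => m Nm.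
exact/ltW/uN.
Qed.

Lemma to_completion_dense x (e : R) : 0 < e ->
  exists v : V, rnorm (x - to_completion v) < e.
Proof.
move=> e0; have e20 : 0 < e / 2 by rewrite divr_gt0.
have [N /(_ N (leqnn N)) uN] := rnorm_sub_to_completion (repr x) e20.
exists (repr x N); rewrite -{1}[x]reprK (le_lt_trans uN)//.
by rewrite ltr_pdivrMr// ltr_pMr// ltr1n.
Qed.

Lemma completion_cauchy_cvg (F : set_system completion) :
  ProperFilter F -> cauchy F -> cvg F.
Proof.
move=> FF /cauchyP Fc.
pose eps n : R := n.+1%:R^-1.
have eps0 n : 0 < eps n by rewrite invr_gt0 ltr0Sn.
have ball_rnorm (x y : completion) (e : R) :
    ball x (of_real k e) y <-> rnorm (x - y) < e.
  by rewrite -ball_normE /ball_/= -of_real_rnorm ltr_of_real.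
have of_real_gt0 (e : R) : 0 < e -> 0 < of_real k e.
  by move=> e0; rewrite -(@of_real0 R k) ltr_of_real.
have /choice[c Fc'] n : exists x, F [set y | rnorm (x - y) < eps n].
  have [x Fx] := Fc _ (of_real_gt0 _ (eps0 n)); exists x.
  by apply: filterS Fx => y /ball_rnorm.
have /choice[v cv] n : exists v : V, rnorm (c n - to_completion v) < eps n.
  exact: to_completion_dense.
have dist (x y z : completion) : rnorm (x - z) <= rnorm (x - y) + rnorm (y - z).
  by rewrite -{1}(subrK y x) -addrA ler_rnormD.
have rnormBC (x y : completion) : rnorm (x - y) = rnorm (y - x).
  by rewrite /rnorm distrC.
have eps_lt (e : R) : 0 < e -> exists N, forall n, (N <= n)%N -> eps n < e.
  move: e => _/posnumP[e]; have [N _ NP] := near_infty_natSinv_lt e.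
  by exists N => n /NP.
have vC : v \in cauchy_seq.
  apply/cauchy_seqP => e e0; have e40 : 0 < e / 4%:R by rewrite divr_gt0.
  have [N eN] := eps_lt _ e40; exists N => m n Nm Nn.
  rewrite -rnorm_to_completion linearB/=.
  have [y [ym yn]] := filter_ex (filterI (Fc' m) (Fc' n)).
  have {}ym := lt_trans ym (eN m Nm); have {}yn := lt_trans yn (eN n Nn).
  have := lt_trans (cv m) (eN m Nm); have := lt_trans (cv n) (eN n Nn).
  have := dist (to_completion (v m)) (c m) (to_completion (v n)).
  have := dist (c m) y (to_completion (v n)).
  have := dist y (c n) (to_completion (v n)).
  move: ym yn; rewrite /= (rnormBC (to_completion (v m)) (c m)).
  rewrite (rnormBC y (c n)); lra.
pose L := \pi_completion (CauchySequence vC); apply/cvg_ex; exists L.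
apply/cvg_ballP => e e0.
have eE : of_real k (real_part e) = e by apply: ge0_of_realE; exact: ltW.
rewrite -eE; have {}e0 : 0 < real_part e.
  by rewrite -(@ltr_of_real R k) of_real0 eE.
have e40 : 0 < real_part e / 4%:R by rewrite divr_gt0.
have [N eN] := eps_lt _ e40.
have [M LM] := rnorm_sub_to_completion (CauchySequence vC) e40.
pose n := maxn N M; have Nn := leq_maxl N M; have Mn := leq_maxr N M.
apply: filterS (Fc' n) => y /= yn; apply/ball_rnorm.
have := LM n Mn; have := eN n Nn; have := cv n.
have := dist L (to_completion (v n)) y; have := dist (to_completion (v n)) (c n) y.
by rewrite /= (rnormBC (to_completion (v n)) (c n)) -/L; lra.
Qed.

HB.instance Definition _ :=
  Uniform_isComplete.Build completion completion_cauchy_cvg.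

End Completion.

Section AlgebraicTensor.
Variables (K : numFieldType) (X Y : lmodType K).

(* The algebraic tensor product X (x) Y, realised as the space of functionals
   on the bilinear forms on X * Y spanned by the evaluations
   x (x) y : B |-> B x y. *)
Definition sum_eval (s : seq (X * Y)) : {bilinear X -> Y -> K^o} -> K^o :=
  fun B => \sum_(xy <- s) B xy.1 xy.2.

Definition tensor_span : {pred {bilinear X -> Y -> K^o} -> K^o} := fun w =>
  `[< exists s, w = sum_eval s >].

Lemma tensor_spanP w : reflect (exists s, w = sum_eval s) (w \in tensor_span).
Proof. exact: asboolP. Qed.

Definition scale_seq (a : K) (s : seq (X * Y)) := [seq (a *: xy.1, xy.2) | xy <- s].

Lemma sum_eval_scale a s : sum_eval (scale_seq a s) = a *: sum_eval s.
Proof.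
apply/funext => B; rewrite /sum_eval /scale_seq big_map fctE scaler_sumr.
by apply: eq_bigr => -[x y] _ /=; rewrite linearZl_LR.
Qed.

Lemma sum_eval_cat s t : sum_eval (s ++ t) = sum_eval s + sum_eval t.
Proof. by apply/funext => B; rewrite /sum_eval big_cat. Qed.

Lemma tensor_span_submod : submod_closed tensor_span.
Proof.
split.
  by apply/tensor_spanP; exists [::]; apply/funext => B; rewrite /sum_eval big_nil.
move=> a _ _ /tensor_spanP[s ->] /tensor_spanP[t ->]; apply/tensor_spanP.
by exists (scale_seq a s ++ t); rewrite sum_eval_cat sum_eval_scale.
Qed.

HB.instance Definition _ := GRing.isSubmodClosed.Build K
  ({bilinear X -> Y -> K^o} -> K^o) tensor_span tensor_span_submod.

Record tensor := Tensor {
  tensor_fun :> {bilinear X -> Y -> K^o} -> K^o;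
  _ : tensor_fun \in tensor_span }.

HB.instance Definition _ := [isSub for tensor_fun].
HB.instance Definition _ := [Choice of tensor by <:].
HB.instance Definition _ := [SubChoice_isSubLmodule of tensor by <:].

Lemma sum_eval_span s : sum_eval s \in tensor_span.
Proof. by apply/tensor_spanP; exists s. Qed.

(* sum_j x_j (x) y_j, for the list s of the pairs (x_j, y_j) *)
Definition sum_tensor (s : seq (X * Y)) : tensor := Tensor (sum_eval_span s).

Lemma sum_tensor_surj (w : tensor) : exists s, w = sum_tensor s.
Proof.
by case: w => w wP; have /tensor_spanP[s ws] := wP; exists s; apply/val_inj.
Qed.

Lemma sum_tensor_scale a s : sum_tensor (scale_seq a s) = a *: sum_tensor s.
Proof. by apply/val_inj; exact: sum_eval_scale. Qed.

Lemma sum_tensor_cat s t : sum_tensor (s ++ t) = sum_tensor s + sum_tensor t.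
Proof. by apply/val_inj; exact: sum_eval_cat. Qed.

End AlgebraicTensor.

Section TensorNorms.
Variables (R : realType) (k : scalar_kind).
Local Notation K := (scalars R k).
Variables X Y : normedModType K.
Implicit Types (s t : seq (X * Y)) (w : tensor X Y) (f : dual_space X) (g : dual_space Y).

Definition pair_sum f g s : K^o := \sum_(xy <- s) f xy.1 * g xy.2.

Definition injective_set w : set R :=
  [set r | exists f g s, [/\ rnorm f <= 1, rnorm g <= 1,
     w = sum_tensor s & r = rnorm (pair_sum f g s)]].

Definition injective_fun w : R := sup (injective_set w).

Definition projective_set w : set R :=
  [set \sum_(xy <- s) rnorm xy.1 * rnorm xy.2 | s in [set s | w = sum_tensor s]].

Definition projective_fun w : R := inf (projective_set w).

Section WellDefined.
Variables (f : dual_space X) (g : dual_space Y).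

Definition tensor_form (x : X) (y : Y) : K^o := f x * g y.

Lemma tensor_form_bilinear : bilinear_for *:%R *:%R tensor_form.
Proof.
split=> [y a x x'|x a y y']; rewrite /tensor_form linearP.
  by rewrite mulrDl -scalerAl.
by rewrite mulrDr -scalerAr.
Qed.

HB.instance Definition _ := bilinear_isBilinear.Build K X Y K^o *:%R *:%R
  tensor_form tensor_form_bilinear.

Lemma pair_sumE s : pair_sum f g s = sum_tensor s tensor_form.
Proof. by []. Qed.

End WellDefined.

Lemma pair_sum_eq f g s t : sum_tensor s = sum_tensor t ->
  pair_sum f g s = pair_sum f g t.
Proof. by rewrite !pair_sumE => ->. Qed.

Lemma pair_sumZ f g a s : pair_sum f g (scale_seq a s) = a *: pair_sum f g s.
Proof. by rewrite !pair_sumE sum_tensor_scale. Qed.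

Lemma pair_sum_cat f g s t :
  pair_sum f g (s ++ t) = pair_sum f g s + pair_sum f g t.
Proof. by rewrite /pair_sum big_cat. Qed.

Lemma ler_pair_sum f g s : rnorm f <= 1 -> rnorm g <= 1 ->
  rnorm (pair_sum f g s) <= \sum_(xy <- s) rnorm xy.1 * rnorm xy.2.
Proof.
rewrite !rnorm_bounded_op => f1 g1; elim: s => [|[x y] s IH].
  by rewrite /pair_sum !big_nil rnorm0.
rewrite /pair_sum !big_cons (le_trans (ler_rnormD _ _))// lerD//=.
have := rnormZ (f x) (g y); rewrite /GRing.scale/= => ->.
rewrite ler_pM ?rnorm_ge0//.
  by rewrite (le_trans (le_opnorm f x))// ler_piMl// rnorm_ge0.
by rewrite (le_trans (le_opnorm g y))// ler_piMl// rnorm_ge0.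
Qed.

Lemma injective_has_sup w : has_sup (injective_set w).
Proof.
have [s0 ws0] := sum_tensor_surj w; split.
  exists (rnorm (pair_sum 0 0 s0)), 0, 0, s0.
  by split=> //; rewrite rnorm0.
exists (\sum_(xy <- s0) rnorm xy.1 * rnorm xy.2) => _ [f [g [s [f1 g1 ws ->]]]].
by rewrite (@pair_sum_eq f g s s0) -?ws// ler_pair_sum.
Qed.

Lemma le_injective f g s : rnorm f <= 1 -> rnorm g <= 1 ->
  rnorm (pair_sum f g s) <= injective_fun (sum_tensor s).
Proof.
move=> f1 g1; apply: (sup_upper_bound (injective_has_sup _)).
by exists f, g, s.
Qed.

Lemma injective_le s (M : R) :
  (forall f g, rnorm f <= 1 -> rnorm g <= 1 -> rnorm (pair_sum f g s) <= M) ->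
  injective_fun (sum_tensor s) <= M.
Proof.
move=> sM; apply: ge_sup; first by case: (injective_has_sup (sum_tensor s)).
by move=> _ [f [g [t [f1 g1 st ->]]]]; rewrite -(pair_sum_eq f g st) sM.
Qed.

Lemma ler_injectiveD w w' :
  injective_fun (w + w') <= injective_fun w + injective_fun w'.
Proof.
have [s ->] := sum_tensor_surj w; have [t ->] := sum_tensor_surj w'.
rewrite -sum_tensor_cat; apply: injective_le => f g f1 g1.
rewrite pair_sum_cat (le_trans (ler_rnormD _ _))//.
by rewrite lerD ?le_injective.
Qed.

Lemma injective_ge0 w : 0 <= injective_fun w.
Proof.
have [s ->] := sum_tensor_surj w.
by rewrite (le_trans (rnorm_ge0 (pair_sum 0 0 s)))// le_injective ?rnorm0.
Qed.

Lemma injectiveZ_le a w : injective_fun (a *: w) <= rnorm (a : K^o) * injective_fun w.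
Proof.
have [s ->] := sum_tensor_surj w.
rewrite -sum_tensor_scale; apply: injective_le => f g f1 g1.
by rewrite pair_sumZ rnormZ ler_wpM2l ?rnorm_ge0 ?le_injective.
Qed.

Lemma projective_has_inf w : has_inf (projective_set w).
Proof.
split.
  by have [s ->] := sum_tensor_surj w; exists (\sum_(xy <- s) rnorm xy.1 * rnorm xy.2), s.
exists 0 => _ [s _ <-].
by apply: sumr_ge0 => xy _; rewrite mulr_ge0 ?rnorm_ge0.
Qed.

Lemma projective_ge0 w : 0 <= projective_fun w.
Proof.
apply: lb_le_inf; first by case: (projective_has_inf w).
by move=> _ [s _ <-]; apply: sumr_ge0 => xy _; rewrite mulr_ge0 ?rnorm_ge0.
Qed.

Lemma projective_le s :
  projective_fun (sum_tensor s) <= \sum_(xy <- s) rnorm xy.1 * rnorm xy.2.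
Proof.
by apply: ge_inf; [case: (projective_has_inf (sum_tensor s))|exists s].
Qed.

Lemma ler_projectiveD w w' :
  projective_fun (w + w') <= projective_fun w + projective_fun w'.
Proof.
rewrite -lerBlDr; apply: lb_le_inf; first by case: (projective_has_inf w).
move=> _ [s ws <-]; rewrite lerBlDr -lerBlDl.
apply: lb_le_inf; first by case: (projective_has_inf w').
move=> _ [t wt <-]; rewrite lerBlDl ws wt -sum_tensor_cat.
by rewrite (le_trans (projective_le _))// big_cat.
Qed.

Lemma projectiveZ_le a w :
  projective_fun (a *: w) <= rnorm (a : K^o) * projective_fun w.
Proof.
have [->|a0] := eqVneq a 0.
  rewrite scale0r rnorm0 mul0r -[0]/(0 : tensor X Y).
  have <- : sum_tensor [::] = 0 :> tensor X Y.
    by apply/val_inj/funext => B; rewrite /= /sum_eval big_nil.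
  by rewrite (le_trans (projective_le _))// big_nil.
have na0 : 0 < rnorm (a : K^o) by exact: rnorm_gt0.
rewrite mulrC -ler_pdivrMr//.
apply: lb_le_inf; first by case: (projective_has_inf w).
move=> _ [s ws <-]; rewrite ler_pdivrMr// ws -sum_tensor_scale.
rewrite (le_trans (projective_le _))// big_map mulrC mulr_sumr.
by apply: ler_sum => xy _; rewrite rnormZ mulrA.
Qed.

Lemma homogeneous_of_le (N : tensor X Y -> R) :
  (forall w, 0 <= N w) ->
  (forall a w, N (a *: w) <= rnorm (a : K^o) * N w) ->
  forall a w, N (a *: w) = rnorm (a : K^o) * N w.
Proof.
move=> N0 NZ a w; apply/eqP; rewrite eq_le NZ/=.
have [->|a0] := eqVneq a 0; first by rewrite rnorm0 mul0r N0.
have na0 : 0 < rnorm (a : K^o) by exact: rnorm_gt0.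
have := NZ a^-1 (a *: w); rewrite scalerA mulVf// scale1r.
rewrite -(ler_pM2l na0) => /le_trans; apply.
by rewrite mulrA -rnormZ /= /GRing.scale/= mulfV// /rnorm normr1 -(@of_real1 R k) of_realK mul1r.
Qed.

Definition injective_norm : seminorm (tensor X Y) :=
  Seminorm ler_injectiveD (homogeneous_of_le injective_ge0 injectiveZ_le).

Definition projective_norm : seminorm (tensor X Y) :=
  Seminorm ler_projectiveD (homogeneous_of_le projective_ge0 projectiveZ_le).

Definition injective_tensor : completeNormedModType K := completion injective_norm.

Definition projective_tensor : completeNormedModType K := completion projective_norm.

End TensorNorms.

(* Main.v *)
Require Import Defs.
From HB Require Import structures.
From mathcomp Require Import all_boot all_order all_fingroup all_algebra.
From mathcomp Require Import complex.
From mathcomp Require Import all_classical all_reals.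
From mathcomp Require Import ring lra.
From mathcomp Require Import topology normedtype derive.

(** The constant of a space [X] is 2 exactly when [X] is almost square: its unit
    ball contains [x] and [y] with both [|x + y|] and [|x - y|] arbitrarily close
    to 2 ([CNJ_almost_square], [almost_square_CNJ]). On the other side,
    [omega_perp E = 1] means that there are functionals [f] and [g] on [E] with
    [|f x| ^ 2 + |g x| ^ 2 <= |x| ^ 2] for all [x], and unit vectors [u] and [v],
    with [|f u| = |g v| = 1]: project to the plane of [Q u] and [Q v]
    ([OCP_contact], [contact_OCP]). The theorem relates these two properties.

    From contact to almost squares. An infinite-dimensional space [Z] contains
    [x] and [y] of norm at least 1 with
    [|a x + b y| ^ 2 <= (1 + epsilon) (|a| ^ 2 + |b| ^ 2)] for all scalars
    ([almost_euclidean_pair]); this is a weak form of Dvoretzky's theorem. Then [f x + g y] and [f x - g y] are almost contractions from [E]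
    to [Z], with sum [2 f x] and difference [2 g y], whose norms at [u] and [v]
    are at least 2. The same operators for a general contraction to a Euclidean
    space give the bound by [2 omega_perp ^ 2] ([CNJ_operators_ge]); the other
    two lower bounds come from rank-one operators. The pair [x], [y] is found
    by contradiction. If every two vectors had a normalized combination that is
    longer by a factor [q > 1], then among [2 ^ m] vectors of norm at least 1/4
    a tournament would find a normalized combination of norm [q ^ m / 4]. By the
    Dvoretzky-Rogers lemma, which examines a contraction from a Euclidean space
    whose determinant is at least half of the supremum, there are [2 ^ m] such
    vectors all of whose normalized combinations have norm at most 1.

    From almost squares to contact. If [S] and [T] are contractions from [E] to a
    Hilbert space, with [|(S + T) u|] and [|(S - T) v|] almost 2, take functionals
    [F] and [G] of norm 1 that norm these two vectors. By the parallelogram law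
    the functionals [F (S + T) / 2] and [G (S - T) / 2] define a contraction to
    the plane, and [u] and [v] are almost contact points for it
    ([contact_of_operators]). Compactness removes the error ([contact_limit]).
    Any infinite-dimensional Hilbert space serves as a test space; one is obtained
    as the completion of the polynomials with the Euclidean norm of their
    coefficients.

    Tensor products. For finite-dimensional [Y] the injective norm on the tensor
    product of [X] and [Y] is the operator norm on the operators from the dual
    of [Y] to [X] ([injective_square]), and completion does not affect almost
    squares, so that the injective case reduces to operators. The projective case
    is dual: bilinear forms [alpha f + beta g] and [alpha f - beta g], where
    [alpha] and [beta] are an almost Euclidean pair of functionals on [X], show
    that suitable elementary tensors form an almost square
    ([projective_square]); conversely, functionals that norm the sum and the
    difference of two tensors over a Hilbert space give almost contact points,
    by the parallelogram law for functionals ([contact_of_projective]). *)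

Set Implicit Arguments.
Unset Strict Implicit.
Unset Printing Implicit Defensive.

Import Order.TTheory GRing.Theory Num.Theory.
Import numFieldNormedType.Exports.

Local Open Scope classical_set_scope.
Local Open Scope ring_scope.

Local Notation absK z := (rnorm (z : (scalars _ _)^o)).

(** * Scalars and norms *)

Section ScalarField.
Variables (R : realType) (k : scalar_kind).
Local Notation K := (scalars R k).
Local Notation of_real := (of_real k).

Lemma absKM (a b : K) : absK (a * b) = absK a * absK b.
Proof. exact: (rnormZ a (b : K^o)). Qed.

Lemma absK1 : absK (1 : K) = 1.
Proof. by rewrite -(@of_real1 R k) rnorm_of_real normr1. Qed.

Lemma absK_eq0 (z : K) : absK z = 0 -> z = 0.
Proof. exact: (@rnorm0_eq0 R k K^o). Qed.

Lemma rnormN (V : normedModType K) (x : V) : rnorm (- x) = rnorm x.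
Proof. by rewrite /rnorm normrN. Qed.

Lemma rnormB_sym (V : normedModType K) (x y : V) : rnorm (x - y) = rnorm (y - x).
Proof. by rewrite -rnormN opprB. Qed.

Lemma ler_rnorm_sub (V : normedModType K) (x y : V) : rnorm x - rnorm y <= rnorm (x - y).
Proof. by rewrite lerBlDr -{1}(subrK y x) ler_rnormD. Qed.

Lemma ler_rnorm_dist (V : normedModType K) (x y : V) :
  `|rnorm x - rnorm y| <= rnorm (x - y).
Proof.
by rewrite ler_norml ler_rnorm_sub andbT lerNl opprB rnormB_sym ler_rnorm_sub.
Qed.

Lemma ler_rnorm_sum (V : normedModType K) I (r : seq I) (P : pred I) (F : I -> V) :
  rnorm (\sum_(i <- r | P i) F i) <= \sum_(i <- r | P i) rnorm (F i).
Proof.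
elim/big_rec2 : _ => [|i x y _ xy]; first by rewrite rnorm0.
by rewrite (le_trans (ler_rnormD _ _))// lerD2l.
Qed.

Lemma scalar_conjD (a b : K) : scalar_conj (a + b) = scalar_conj a + scalar_conj b.
Proof. by rewrite /scalar_conj; case: k a b => // a b; rewrite rmorphD. Qed.

Lemma scalar_conjM (a b : K) : scalar_conj (a * b) = scalar_conj a * scalar_conj b.
Proof. by rewrite /scalar_conj; case: k a b => // a b; rewrite rmorphM. Qed.

Lemma scalar_conjK (a : K) : scalar_conj (scalar_conj a) = a.
Proof. by rewrite /scalar_conj; case: k a => // a; rewrite conjcK. Qed.

Lemma scalar_conj_real (r : R) : scalar_conj (of_real r) = of_real r.
Proof. by rewrite /scalar_conj /Defs.of_real; case: k => //; exact: conjc_real. Qed.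

Lemma scalar_conj0 : scalar_conj (0 : K) = 0.
Proof. by rewrite -(of_real0 R k) scalar_conj_real. Qed.

Lemma scalar_conj1 : scalar_conj (1 : K) = 1.
Proof. by rewrite -(of_real1 R k) scalar_conj_real. Qed.

Lemma scalar_conjN (a : K) : scalar_conj (- a) = - scalar_conj a.
Proof. by rewrite -mulN1r scalar_conjM -(of_real1 R k) -of_realN scalar_conj_real of_realN of_real1 mulN1r. Qed.

Lemma scalar_conj_sum I (r : seq I) (P : pred I) (F : I -> K) :
  scalar_conj (\sum_(i <- r | P i) F i) = \sum_(i <- r | P i) scalar_conj (F i).
Proof. by apply: (big_morph _ scalar_conjD scalar_conj0). Qed.

Lemma mul_scalar_conj (z : K) : z * scalar_conj z = of_real (absK z ^+ 2).
Proof.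
rewrite expr2 of_realM !of_real_rnorm /scalar_conj; case: k z => [z|z] /=.
  by rewrite -!expr2 real_normK// num_real.
by rewrite -expr2 sqr_normc.
Qed.

Lemma absK_conj (z : K) : absK (scalar_conj z) = absK z.
Proof.
apply/eqP; rewrite -(@eqrXn2 _ 2)// ?rnorm_ge0//.
apply/eqP/(@of_real_inj R k).
by rewrite -!mul_scalar_conj scalar_conjK mulrC.
Qed.

Lemma real_part_le (z : K) : real_part z <= absK z.
Proof.
rewrite /real_part /rnorm; case: k z => [z|[a b]] /=; first exact: ler_norm.
rewrite (le_trans (ler_norm _))// -sqrtr_sqr ler_wsqrtr// lerDl.
exact: sqr_ge0.
Qed.

Lemma real_partD (a b : K) : real_part (a + b) = real_part a + real_part b.
Proof. by rewrite /real_part; case: k a b => // -[? ?] [? ?]. Qed.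

Lemma real_partZ (r : R) (z : K) : real_part (of_real r * z) = r * real_part z.
Proof.
rewrite /real_part /Defs.of_real; case: k z => // -[a b] /=.
by rewrite mul0r subr0.
Qed.

Lemma real_partN (a : K) : real_part (- a) = - real_part a.
Proof. by rewrite -mulN1r -(of_real1 R k) -of_realN real_partZ mulN1r. Qed.

Lemma phase (z : K) : exists t : K, absK t = 1 /\ t * z = of_real (absK z).
Proof.
have [->|z0] := eqVneq z 0.
  by exists 1; rewrite absK1 mulr0 rnorm0 of_real0.
have az : absK z != 0 by apply: contra_neq z0; exact: absK_eq0.
exists (scalar_conj z * of_real (absK z)^-1); split.
  by rewrite absKM absK_conj rnorm_of_real ger0_norm ?invr_ge0 ?rnorm_ge0// mulfV.
rewrite mulrC mulrA mul_scalar_conj -of_realM.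
by congr of_real; rewrite expr2 mulfK.
Qed.

Lemma of_real_neq0 (r : R) : r != 0 -> of_real r != 0.
Proof. by apply: contra_neq => r0; apply: (@of_real_inj R k); rewrite r0 of_real0. Qed.

Lemma of_realV (r : R) : of_real r^-1 = (of_real r)^-1.
Proof.
have [->|r0] := eqVneq r 0; first by rewrite invr0 of_real0 invr0.
by apply: (mulfI (of_real_neq0 r0)); rewrite -of_realM !mulfV ?of_real_neq0// of_real1.
Qed.

Lemma rnormZ_real (V : normedModType K) (r : R) (x : V) :
  0 <= r -> rnorm (of_real r *: x) = r * rnorm x.
Proof. by move=> r0; rewrite rnormZ rnorm_of_real ger0_norm. Qed.

Lemma ball_rnorm (V : normedModType K) (x y : V) (e : R) :
  ball x (of_real e) y <-> rnorm (x - y) < e.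
Proof. by rewrite -ball_normE /ball_/= -of_real_rnorm ltr_of_real. Qed.

Lemma of_real_gt0 (e : R) : (0 < of_real e) = (0 < e).
Proof. by rewrite -(of_real0 R k) ltr_of_real. Qed.

Lemma nbhs_rnorm (V : normedModType K) (x : V) (A : set V) :
  (exists2 e : R, 0 < e & forall y, rnorm (x - y) < e -> A y) -> nbhs x A.
Proof.
move=> [e e0 eA]; apply/nbhs_ballP; exists (of_real e) => /=.
  by rewrite of_real_gt0.
by move=> y /ball_rnorm; exact: eA.
Qed.

Lemma rnorm_continuous (V : normedModType K) : continuous (fun x : V => rnorm x).
Proof.
move=> x; apply/cvgrPdist_lt => e e0; apply: nbhs_rnorm; exists e => // y xy.
exact: le_lt_trans (ler_rnorm_dist x y) xy.
Qed.

Lemma bounded_op_continuous (V W : normedModType K) (f : bounded_op V W) :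
  continuous f.
Proof.
move=> x; apply/cvgrPdist_lt => e e0.
have eE : of_real (real_part e) = e by apply: ge0_of_realE; exact: ltW.
have {}e0 : 0 < real_part e by rewrite -of_real_gt0 eE.
have f1 : 0 < opnorm f + 1 by rewrite ltr_wpDl ?opnorm_ge0.
apply: nbhs_rnorm; exists (real_part e / (opnorm f + 1)); first exact: divr_gt0.
move=> y; rewrite ltr_pdivlMr// => xy.
rewrite -eE -of_real_rnorm ltr_of_real -linearB.
apply: le_lt_trans xy; rewrite (le_trans (le_opnorm f _))// mulrC ler_wpM2l ?rnorm_ge0//.
by rewrite lerDl.
Qed.

End ScalarField.

(** * Compactness and finite dimension *)

Section Compactness.
Variables (R : realType) (k : scalar_kind).
Local Notation K := (scalars R k).
Local Notation of_real := (of_real k).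

(** It is 0 for real scalars, so that [a + imaginary_unit * b] with real [a] and
    [b] runs through the scalars in both cases. *)
Definition imaginary_unit : K :=
  match k with RealScalars => 0 | ComplexScalars => 'i%C end.

Lemma scalar_rect (z : K) : exists a b : R,
  [/\ z = of_real a + imaginary_unit * of_real b, `|a| <= absK z & `|b| <= absK z].
Proof.
rewrite /rnorm /Defs.of_real /imaginary_unit /real_part.
case: k z => [z|[a b]] /=.
  by exists z, 0; rewrite mul0r addr0 normr0 lexx normr_ge0.
exists a, b; split; first exact: complexE.
  by rewrite -sqrtr_sqr ler_wsqrtr// lerDl sqr_ge0.
by rewrite -sqrtr_sqr ler_wsqrtr// lerDr sqr_ge0.
Qed.

Lemma of_real_continuous : continuous (of_real : R -> K^o).
Proof.
move=> x; apply/cvgrPdist_lt => e e0.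
have eE : of_real (real_part e) = e by apply: ge0_of_realE; exact: ltW.
have {}e0 : 0 < real_part e by rewrite -(of_real_gt0 k) eE.
apply/nbhs_normP; exists (real_part e) => // y /= xy.
by rewrite -eE -of_realN -of_realD -(@of_real_rnorm R k K^o) ltr_of_real rnorm_of_real.
Qed.

Lemma scalar_ball_compact (M : R) : compact [set z : K^o | rnorm z <= M].
Proof.
pose g (ab : R * R) : K^o := of_real ab.1 + imaginary_unit * of_real ab.2.
have gc : continuous g.
  move=> ab; apply: (@cvgD _ (K^o)).
    apply: (@continuous_comp _ _ _ fst (of_real : R -> K^o)); first exact: cvg_fst.
    exact: of_real_continuous.
  apply: (@cvgMl_tmp K).
  apply: (@continuous_comp _ _ _ snd (of_real : R -> K^o)); first exact: cvg_snd.
  exact: of_real_continuous.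
have gC : compact (g @` (`[- M, M] `*` `[- M, M])).
  apply: continuous_compact.
    by apply: continuous_subspaceT; exact: gc.
  by apply: compact_setX; exact: segment_compact.
apply: subclosed_compact gC _.
  rewrite -[X in closed X]/((fun z : K^o => rnorm z) @^-1` [set y | y <= M]).
  by apply: preimage_closed; [move=> ? _; exact: rnorm_continuous|exact: closed_le].
move=> z /= zM; have [a [b [zE az bz]]] := scalar_rect z.
exists (a, b) => //=; split; rewrite /= in_itv /=.
  by rewrite -ler_norml (le_trans az).
by rewrite -ler_norml (le_trans bz).
Qed.

End Compactness.

Section FiniteDimension.
Variables (R : realType) (k : scalar_kind).
Local Notation K := (scalars R k).
Local Notation of_real := (of_real k).
Local Notation ell2 := (ell2 R k).

Lemma linear_bundle (U V : lmodType K) (f : U -> V) : linear f ->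
  exists L : {linear U -> V}, L = f :> (U -> V).
Proof.
move=> lf; pose mf := GRing.isLinear.Build _ _ _ _ f lf.
by exists (HB.pack_for {linear U -> V} f mf).
Qed.

Definition make_bounded_op (V W : normedModType K) (f : V -> W) (lf : linear f)
    (bf : exists M : R, forall x, rnorm (f x) <= M * rnorm x) : bounded_op V W :=
  BoundedOp (introT (bounded_linearP f) (conj lf bf)).

Lemma normalize (V : normedModType K) (x : V) : x != 0 ->
  rnorm (of_real (rnorm x)^-1 *: x) = 1.
Proof.
move=> x0; rewrite rnormZ_real ?invr_ge0 ?rnorm_ge0// mulVf//.
by rewrite gt_eqF// rnorm_gt0.
Qed.

Section Ell2.
Variable n : nat.
Implicit Types x : ell2 n.

Lemma ler_coord_ell2 x i : absK (x ord0 i) <= rnorm x.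
Proof.
rewrite rnorm_ell2 -[leLHS]ger0_norm ?rnorm_ge0// -sqrtr_sqr ler_wsqrtr//.
by rewrite (bigD1 i)//= lerDl sumr_ge0// => j _; exact: sqr_ge0.
Qed.

Lemma sqr_rnorm_ell2 x : rnorm x ^+ 2 = \sum_i absK (x ord0 i) ^+ 2.
Proof. by rewrite rnorm_ell2 sqr_sqrtr// sumr_ge0// => i _; exact: sqr_ge0. Qed.

Lemma rnorm_delta (i : 'I_n) : rnorm (delta_mx ord0 i : ell2 n) = 1.
Proof.
rewrite rnorm_ell2 /ell2_norm (bigD1 i)//= big1 ?addr0.
  by rewrite mxE !eqxx absK1 expr1n sqrtr1.
by move=> j /negbTE ji; rewrite mxE eqxx ji rnorm0 expr0n.
Qed.

Lemma ell2_sum_delta x : x = \sum_i x ord0 i *: (delta_mx ord0 i : ell2 n).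
Proof. exact: row_sum_delta. Qed.

Lemma ell2_linear_bounded (V : normedModType K) (L : {linear ell2 n -> V}) :
  exists2 M : R, 0 < M & forall x, rnorm (L x) <= M * rnorm x.
Proof.
exists (\sum_i rnorm (L (delta_mx ord0 i)) + 1).
  by rewrite ltr_wpDl// sumr_ge0// => i _; exact: rnorm_ge0.
move=> x; rewrite {1}(ell2_sum_delta x) linear_sum (le_trans (ler_rnorm_sum _ _ _))//.
rewrite mulrDl mul1r; apply: ler_wpDr; first exact: rnorm_ge0.
rewrite mulr_suml; apply: ler_sum => i _; rewrite linearZ rnormZ mulrC.
by rewrite ler_wpM2l ?rnorm_ge0 ?ler_coord_ell2.
Qed.

(** The ball is closed in a product of compact discs. *)
Lemma ell2_ball_compact (M : R) : compact [set x : ell2 n | rnorm x <= M].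
Proof.
pose B := [set v : 'rV[K^o]_n | forall i, [set z : K^o | rnorm z <= M] (v ord0 i)].
have cB : compact B.
  apply: (@rV_compact K^o n (fun=> [set z : K^o | rnorm z <= M])) => _.
  exact: scalar_ball_compact.
pose g (v : 'rV[K^o]_n) : ell2 n := v.
have gc : continuous g.
  move=> v; apply/(@cvgrPdist_lt _ _ _ (nbhs v) (nbhs_filter v)) => e e0.
  have eE : of_real (real_part e) = e by apply: ge0_of_realE; exact: ltW.
  have {}e0 : 0 < real_part e by rewrite -(of_real_gt0 k) eE.
  pose d := real_part e / n.+1%:R; have d0 : 0 < d by rewrite divr_gt0// ltr0n.
  apply/nbhs_ballP; exists (of_real d); first by rewrite /= of_real_gt0.
  move=> w [_ vw]; rewrite -eE -of_real_rnorm ltr_of_real.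
  apply: (@le_lt_trans _ _ (\sum_(i < n) d)); last first.
    by rewrite sumr_const card_ord -[ltLHS]mulr_natr /d mulrAC ltr_pdivrMr ?ltr0n// ltr_pM2l// ltr_nat.
  rewrite (ell2_sum_delta (g v - g w)) (le_trans (ler_rnorm_sum _ _ _))//.
  apply: ler_sum => i _; rewrite rnormZ rnorm_delta mulr1 !mxE.
  by have /ball_rnorm/ltW := vw ord0 i.
have gC : compact (g @` B).
  by apply: continuous_compact cB; apply: continuous_subspaceT; exact: gc.
apply: subclosed_compact gC _.
  rewrite -[X in closed X]/((fun z : ell2 n => rnorm z) @^-1` [set y | y <= M]).
  by apply: preimage_closed; [move=> ? _; exact: rnorm_continuous|exact: closed_le].
by move=> z /= zM; exists z => // i /=; rewrite (le_trans (ler_coord_ell2 z i)).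
Qed.

(** A linear injection of a Euclidean space attains the minimum of its norm on
    the unit sphere, which is compact. *)
Lemma ell2_bounded_below (V : normedModType K) (L : {linear ell2 n -> V}) :
  injective L -> exists2 c : R, 0 < c & forall x, c * rnorm x <= rnorm (L x).
Proof.
move=> injL; have [M M0 LM] := ell2_linear_bounded L.
pose F : bounded_op (ell2 n) V := make_bounded_op (linearP L) (ex_intro _ M LM).
pose S := [set x : ell2 n | rnorm x = 1].
have [[s0 s0S]|S0] := pselect (S !=set0); last first.
  exists 1 => // x; have [->|x0] := eqVneq x 0.
    by rewrite rnorm0 mulr0 rnorm_ge0.
  by case: S0; eexists; exact: (normalize x0).
have Sc : compact S.
  apply: (subclosed_compact _ (ell2_ball_compact (M := 1))); last by move=> x /= ->.
  rewrite -[X in closed X]/((fun z : ell2 n => rnorm z) @^-1` [set y | y = 1]).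
  by apply: preimage_closed; [move=> ? _; exact: rnorm_continuous|exact: closed_eq].
have [|c /set_mem cS cmin] := @compact_EVT_min _ R (fun x => rnorm (F x)) S (ex_intro _ s0 s0S) Sc.
  apply: continuous_subspaceT => x.
  apply: (@continuous_comp _ _ _ F (fun y : V => rnorm y)).
    exact: bounded_op_continuous.
  exact: rnorm_continuous.
have c0 : 0 < rnorm (F c).
  apply: rnorm_gt0; apply/eqP => Fc0.
  have c0 : c = 0 by apply: injL; rewrite linear0.
  by move: cS; rewrite /S /= c0 rnorm0 => /eqP; rewrite eq_sym oner_eq0.
exists (rnorm (F c)) => // x.
have [->|x0] := eqVneq x 0; first by rewrite rnorm0 mulr0 rnorm_ge0.
have := cmin _ (mem_set (normalize x0)); rewrite linearZ/= rnormZ_real ?invr_ge0 ?rnorm_ge0//.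
by rewrite ler_pdivlMl ?rnorm_gt0// mulrC.
Qed.

End Ell2.

Lemma has_dim_ell2 (V : lmodType K) n :
  has_dim V n -> exists2 L : {linear ell2 n -> V}, injective L & forall v, exists x, v = L x.
Proof.
move=> [f [g fK gK]].
have lg : linear (g : ell2 n -> V) by apply: can2_linear fK gK.
have [L LE] := linear_bundle lg; exists L; rewrite LE; first exact: can_inj gK.
by move=> v; exists (f v); rewrite fK.
Qed.

Lemma finite_dim_linear_bounded (V W : normedModType K) (f : V -> W) :
  finite_dim V -> linear f -> exists M : R, forall x, rnorm (f x) <= M * rnorm x.
Proof.
move=> [n /has_dim_ell2[L injL surjL]] lf.
have [F FE] := linear_bundle lf.
have [c c0 cL] := ell2_bounded_below injL.
have [G GE] : exists G : {linear ell2 n -> W}, G = (F \o L) :> (_ -> _).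
  by apply: linear_bundle => a x y; rewrite /= !linearP.
have [M M0 GM] := ell2_linear_bounded G.
exists (M / c) => v; have [x ->] := surjL v.
have := GM x; rewrite GE /= FE => /le_trans; apply.
by rewrite -mulrA ler_wpM2l ?(ltW M0)// ler_pdivlMl.
Qed.

Lemma finite_dim_ball_compact (V : normedModType K) (M : R) :
  finite_dim V -> compact [set x : V | rnorm x <= M].
Proof.
move=> [n /has_dim_ell2[L injL surjL]].
have [c c0 cL] := ell2_bounded_below injL.
have [N N0 LN] := ell2_linear_bounded L.
pose F : bounded_op (ell2 n) V := make_bounded_op (linearP L) (ex_intro _ N LN).
have FC : compact (F @` [set x : ell2 n | rnorm x <= M / c]).
  apply: continuous_compact; last exact: ell2_ball_compact.
  by apply: continuous_subspaceT; exact: bounded_op_continuous.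
apply: subclosed_compact FC _.
  rewrite -[X in closed X]/((fun z : V => rnorm z) @^-1` [set y | y <= M]).
  by apply: preimage_closed; [move=> ? _; exact: rnorm_continuous|exact: closed_le].
move=> v /= vM; have [x vx] := surjL v; exists x => //=.
by rewrite ler_pdivlMr// mulrC (le_trans (cL x))// -vx.
Qed.

End FiniteDimension.

(** * The Hahn-Banach theorem *)

Section HahnBanach.
Variables (R : realType) (k : scalar_kind).
Local Notation K := (scalars R k).
Local Notation of_real := (of_real k).
Local Notation iK := (imaginary_unit R k).
Variable V : lmodType K.
Implicit Types (q f : V -> R) (x y : V).

Definition sublinear q :=
  (forall x y, q (x + y) <= q x + q y) /\
  (forall (s : R) x, 0 < s -> q (of_real s *: x) <= s * q x).

Lemma sublinear0 q : sublinear q -> q 0 = 0.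
Proof.
move=> [_ qZ].
have := qZ 2%:R 0 (ltr0Sn _ _); have := qZ 2%:R^-1 0.
rewrite !scaler0 invr_gt0 => /(_ (ltr0Sn _ _)); lra.
Qed.

Lemma sublinear_opp_ge q x : sublinear q -> - q (- x) <= q x.
Proof.
by move=> qs; rewrite lerNl -subr_ge0 opprK -(sublinear0 qs) -{1}(addNr x); case: qs.
Qed.

Section Tilt.
Variables (q : V -> R) (y : V).
Hypothesis qs : sublinear q.

Let values x := [set q (x + of_real t *: y) - t * q y | t in [set t | 0 <= t]].

(** The largest sublinear minorant of [q] whose value at [- y] is at most
    [- q y]. *)
Definition tilt x : R := inf (values x).

Let values_lb x : lbound (values x) (- q (- x)).
Proof.
move=> _ [t /= t0 <-]; rewrite lerBrDr addrC lerBlDr.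
have [-> | tn0] := eqVneq t 0.
  by rewrite mul0r of_real0 scale0r addr0 -(sublinear0 qs) -{1}(addrN x); case: qs.
have tp : 0 < t by rewrite lt_def tn0.
apply: (@le_trans _ _ (q (of_real t *: y))).
  have tV0 : 0 < t^-1 by rewrite invr_gt0.
  have [_ /(_ t^-1 (of_real t *: y) tV0)] := qs.
  by rewrite scalerA -of_realM mulVf// of_real1 scale1r mulrC ler_pdivlMr// mulrC.
by have := qs.1 (x + of_real t *: y) (- x); rewrite addrAC subrr add0r.
Qed.

Let values_has_inf x : has_inf (values x).
Proof.
split; last by exists (- q (- x)); exact: values_lb.
by exists (q (x + of_real 0 *: y) - 0 * q y); exists 0 => //=.
Qed.

Let tilt_le t x : 0 <= t -> tilt x <= q (x + of_real t *: y) - t * q y.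
Proof.
by move=> t0; apply: ge_inf; [case: (values_has_inf x)|exists t].
Qed.

Lemma tilt_le_self x : tilt x <= q x.
Proof. by have := tilt_le x (lexx 0); rewrite of_real0 scale0r addr0 mul0r subr0. Qed.

Lemma tilt_opp : tilt (- y) <= - q y.
Proof.
have := tilt_le (- y) ler01.
by rewrite of_real1 scale1r addNr sublinear0// sub0r mul1r.
Qed.

Lemma tilt_sublinear : sublinear tilt.
Proof.
split=> [x x'|s x s0].
  rewrite -lerBlDr; apply: lb_le_inf; first by case: (values_has_inf x).
  move=> _ [t /= t0 <-]; rewrite lerBlDr -lerBlDl.
  apply: lb_le_inf; first by case: (values_has_inf x').
  move=> _ [t' /= t'0 <-]; rewrite lerBlDl.
  have := tilt_le (x + x') (addr_ge0 t0 t'0); rewrite of_realD scalerDl addrACA.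
  have := qs.1 (x + of_real t *: y) (x' + of_real t' *: y); lra.
rewrite -ler_pdivrMl//; apply: lb_le_inf; first by case: (values_has_inf x).
move=> _ [t /= t0 <-]; rewrite ler_pdivrMl//.
apply: le_trans (tilt_le _ (mulr_ge0 (ltW s0) t0)) _.
by rewrite of_realM -scalerA -scalerDr mulrBr mulrA lerD2r; exact: qs.2.
Qed.

End Tilt.

(** Zorn's lemma applies because a chain of sublinear minorants of [q] has a
    sublinear infimum, finite since the values at [x] are at least
    [- q (- x)]. *)
Lemma minimal_sublinear q : sublinear q -> exists f,
  [/\ sublinear f, forall x, f x <= q x &
      forall g, sublinear g -> (forall x, g x <= f x) -> g = f].
Proof.
move=> qs; pose T := {g | sublinear g /\ forall x, g x <= q x}.
pose t0 : T := exist _ q (conj qs (fun x => lexx _)).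
pose D (s t : T) := `[< forall x, sval t x <= sval s x >].
have [| | |A tA|t tmax] := @Zorn T D.
- by move=> t; apply/asboolP => x.
- move=> r s t /asboolP rs /asboolP st; apply/asboolP => x.
  exact: le_trans (st x) (rs x).
- move=> [s Ps] [t Pt] /asboolP st /asboolP ts; apply/eq_exist/funext => x.
  by apply/eqP; rewrite eq_le st ts.
- have [A0|/nonemptyPn A0] := pselect (A !=set0); last first.
    by exists t0 => s; rewrite A0.
  pose vals x := [set sval s x | s in A].
  have hi x : has_inf (vals x).
    case: A0 => s As; split; first by exists (sval s x), s.
    exists (- q (- x)) => _ [t At <-].
    apply: le_trans (sublinear_opp_ge x (svalP t).1).
    by rewrite lerN2; exact: (svalP t).2.
  have infle s x : A s -> inf (vals x) <= sval s x.
    by move=> As; apply: ge_inf; [case: (hi x)|exists s].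
  have gs : sublinear (fun x => inf (vals x)).
    split=> [x y|s x s0].
      rewrite -lerBlDr; apply: lb_le_inf; first by case: (hi x).
      move=> _ [s As <-]; rewrite lerBlDr -lerBlDl.
      apply: lb_le_inf; first by case: (hi y).
      move=> _ [t At <-]; rewrite lerBlDl.
      have [/asboolP st|/asboolP ts] := tA _ _ As At.
        have := infle _ (x + y) At; have := (svalP t).1.1 x y.
        have := st x; rewrite /=; lra.
      have := infle _ (x + y) As; have := (svalP s).1.1 x y.
      have := ts y; rewrite /=; lra.
    rewrite -ler_pdivrMl//; apply: lb_le_inf; first by case: (hi x).
    move=> _ [t At <-]; rewrite ler_pdivrMl//.
    apply: le_trans (infle _ _ At) _; exact: (svalP t).1.2.
  have gq x : inf (vals x) <= q x.
    case: A0 => s As; apply: le_trans (infle s x As) _; exact: (svalP s).2.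
  pose t : T := exist _ (fun x => inf (vals x)) (conj gs gq).
  by exists t => s As; apply/asboolP => x; exact: infle.
exists (sval t); split; [exact: (svalP t).1|exact: (svalP t).2|].
move=> g gs gt.
have gq x : g x <= q x by apply: le_trans (gt x) ((svalP t).2 x).
pose s : T := exist _ g (conj gs gq).
by rewrite -(tmax s); last exact/asboolP.
Qed.

(** A minimal sublinear functional is odd, because tilting it along any vector
    cannot lower it; an odd sublinear functional is linear. *)
Lemma real_hahn_banach q y : sublinear q -> exists f,
  [/\ {morph f : x z / x + z}, forall (s : R) x, f (of_real s *: x) = s * f x,
      forall x, f x <= q x & f y = q y].
Proof.
move=> qs.
have [f [fs fq fmin]] := minimal_sublinear (tilt_sublinear y qs).
have fN z : f (- z) = - f z.
  apply/eqP; rewrite eq_le; apply/andP; split.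
    rewrite -{1}(fmin _ (tilt_sublinear z fs)) ?tilt_opp//.
    by move=> x; exact: tilt_le_self.
  by rewrite lerNl; have := sublinear_opp_ge z fs.
have fZp s x : 0 < s -> f (of_real s *: x) = s * f x.
  move=> s0; apply/eqP; rewrite eq_le fs.2//=.
  have sV0 : 0 < s^-1 by rewrite invr_gt0.
  have := fs.2 s^-1 (of_real s *: x) sV0.
  by rewrite scalerA -of_realM mulVf ?gt_eqF// of_real1 scale1r ler_pdivlMl.
exists f; split.
- move=> x z; apply/eqP; rewrite eq_le fs.1 /=.
  by rewrite -[f (x + z)]opprK -fN opprD lerNr opprD -!fN fs.1.
- move=> s x; have [s0|s0|->] := ltrgt0P s; first exact: fZp.
    by rewrite -[s]opprK of_realN scaleNr fN fZp ?oppr_gt0// !mulNr.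
  by rewrite of_real0 scale0r mul0r sublinear0.
- move=> x; exact: le_trans (fq x) (tilt_le_self _ qs x).
apply/eqP; rewrite eq_le (le_trans (fq y) (tilt_le_self _ qs y))/=.
by rewrite -lerN2 -fN (le_trans (fq _))// tilt_opp.
Qed.

Lemma imaginary_unit_sqr : iK = 0 \/ iK * iK = -1.
Proof.
rewrite /imaginary_unit; case: (k); first by left.
by right; rewrite -expr2 sqr_i.
Qed.

Lemma real_part_imaginary (r : R) : real_part (iK * of_real r) = 0.
Proof.
rewrite /imaginary_unit /real_part /Defs.of_real; case: (k) => /=.
  by rewrite mul0r.
by rewrite mul0r mul1r subrr.
Qed.

Lemma real_part_of_real (r : R) : real_part (of_real r) = r.
Proof. exact: of_realK. Qed.

(** Real and complex scalars are treated together, after Bohnenblust and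
    Sobczyk: a real functional [f] is the real part of
    [x |-> f x - i f (i x)], and the modulus of a linear functional at [x] is its
    real part at a rotation of [x]. *)
Theorem hahn_banach (p : seminorm V) y : exists F : V -> K^o,
  [/\ linear F, forall x, absK (F x) <= p x & F y = of_real (p y)].
Proof.
have ps : sublinear p.
  split=> [x z|s x s0]; first exact: ler_seminormD.
  by rewrite seminormZ rnorm_of_real gtr0_norm.
have [f [fD fZ fp fy]] := real_hahn_banach y ps.
pose F x : K^o := of_real (f x) - iK * of_real (f (iK *: x)).
have FD x z : F (x + z) = F x + F z.
  by rewrite /F scalerDr !fD !of_realD mulrDr opprD addrACA.
have FZr s x : F (of_real s *: x) = of_real s * F x.
  by rewrite /F scalerA (mulrC _ (of_real s)) -scalerA !fZ !of_realM mulrBr mulrCA.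
have FZi x : F (iK *: x) = iK * F x.
  rewrite /F; have [->|ii] := imaginary_unit_sqr.
    by rewrite !scale0r !mul0r -(scale0r x) -(of_real0 R k) fZ mul0r of_real0 subr0.
  rewrite scalerA ii -(of_real1 R k) -of_realN fZ mulN1r mulrBr mulrA ii.
  by rewrite of_realN mulrN opprK mulN1r opprK addrC.
have FZ a x : F (a *: x) = a * F x.
  have [r [s [-> _ _]]] := scalar_rect a.
  by rewrite scalerDl FD FZr -scalerA FZi FZr mulrDl mulrA.
have reF x : real_part (F x) = f x.
  by rewrite /F real_partD real_partN real_part_imaginary subr0 real_part_of_real.
have Fp x : absK (F x) <= p x.
  have [t [t1 tF]] := phase (F x).
  rewrite -[leLHS]real_part_of_real -tF -FZ reF (le_trans (fp _))//.
  by rewrite seminormZ t1 mul1r.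
have [t [t1 tF]] := phase (F y).
exists (fun x => t * F x); split.
- by move=> a x z; rewrite FD FZ mulrDr mulrCA.
- by move=> x; rewrite absKM t1 mul1r.
rewrite tF; congr of_real; apply/eqP; rewrite eq_le Fp/= -fy -reF.
exact: real_part_le.
Qed.

End HahnBanach.

Definition norm_seminorm (R : realType) (k : scalar_kind)
    (V : normedModType (scalars R k)) : seminorm V :=
  Seminorm (@ler_rnormD R k V) (@rnormZ R k V).

Lemma norming_functional (R : realType) (k : scalar_kind)
    (V : normedModType (scalars R k)) (y : V) :
  exists f : dual_space V,
    (forall x, absK (f x) <= rnorm x) /\ f y = of_real k (rnorm y).
Proof.
have [F [Fl Fp Fy]] := hahn_banach (norm_seminorm V) y.
have bF : exists M : R, forall x, rnorm (F x) <= M * rnorm x.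
  by exists 1 => x; rewrite mul1r; exact: Fp.
by exists (make_bounded_op Fl bF).
Qed.

(** * Almost Euclidean pairs of vectors *)

Section Euclidean.
Variables (R : realType) (k : scalar_kind).
Local Notation K := (scalars R k).
Local Notation of_real := (of_real k).
Variable n : nat.
Local Notation ell2 := (ell2 R k n).
Implicit Types x y z w c : ell2.

Lemma ell2_dotDl x y z : ell2_dot (x + y) z = ell2_dot x z + ell2_dot y z.
Proof. by rewrite -big_split; apply: eq_bigr => i _; rewrite mxE mulrDl. Qed.

Lemma ell2_dotZl (a : K) x y : ell2_dot (a *: x) y = a * ell2_dot x y.
Proof. by rewrite mulr_sumr; apply: eq_bigr => i _; rewrite mxE mulrA. Qed.

Lemma ell2_dotC x y : ell2_dot x y = scalar_conj (ell2_dot y x).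
Proof.
rewrite scalar_conj_sum; apply: eq_bigr => i _.
by rewrite scalar_conjM scalar_conjK mulrC.
Qed.

Lemma ell2_dotDr x y z : ell2_dot x (y + z) = ell2_dot x y + ell2_dot x z.
Proof. by rewrite ell2_dotC ell2_dotDl scalar_conjD -!ell2_dotC. Qed.

Lemma ell2_dotZr (a : K) x y : ell2_dot x (a *: y) = scalar_conj a * ell2_dot x y.
Proof. by rewrite ell2_dotC ell2_dotZl scalar_conjM -ell2_dotC. Qed.

Lemma ell2_dotxx x : ell2_dot x x = of_real (rnorm x ^+ 2).
Proof.
rewrite sqr_rnorm_ell2 (big_morph _ (@of_realD R k) (of_real0 R k)).
by apply: eq_bigr => i _; rewrite mul_scalar_conj.
Qed.

Lemma ell2_dot_delta x i : ell2_dot x (delta_mx ord0 i : ell2) = x ord0 i.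
Proof.
rewrite /ell2_dot (bigD1 i)//= big1 ?addr0.
  by rewrite mxE !eqxx scalar_conj1 mulr1.
by move=> j /negbTE ji; rewrite mxE eqxx ji scalar_conj0 mulr0.
Qed.

(** The Householder reflection that carries the basis vector of index [j] to a
    unimodular multiple of [w]; the phase is chosen so that the two vectors are
    not close, which keeps the denominator [1 + |w_j|] away from zero. *)
Lemma reflection (w : ell2) (j : 'I_n) : rnorm w = 1 ->
  exists (H : 'M[K]_n) (t : K),
    [/\ absK t = 1, forall c, rnorm (c *m H : ell2) = rnorm c, H *m H = 1%:M,
        (delta_mx ord0 j : ell2) *m H = t *: w &
        forall i, i != j -> w ord0 i = 0 ->
          (delta_mx ord0 i : ell2) *m H = delta_mx ord0 i].
Proof.
move=> w1; have [t0 [t01 t0w]] := phase (w ord0 j).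
pose t := - t0; have t1 : absK t = 1 by rewrite rnormN.
pose g : R := 1 + absK (w ord0 j).
have g0 : g != 0 by rewrite gt_eqF// ltr_pwDl// rnorm_ge0.
pose v : ell2 := t *: w + (-1) *: (delta_mx ord0 j : ell2).
have vj : v ord0 j = of_real (- g).
  by rewrite !mxE !eqxx /t mulNr mulr1 t0w of_realN of_realD of_real1 opprD addrC.
have dot_tw : ell2_dot (t *: w) v = of_real g.
  rewrite /v ell2_dotDr (ell2_dotZr (-1)) ell2_dot_delta mxE /t mulNr t0w.
  rewrite scalar_conjN scalar_conj1 mulN1r opprK ell2_dotxx rnormZ rnormN t01.
  by rewrite w1 mul1r expr1n of_real1 of_realD of_real1.
have dot_dv : ell2_dot (delta_mx ord0 j : ell2) v = of_real (- g).
  by rewrite ell2_dotC ell2_dot_delta vj scalar_conj_real.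
have dot_vv : ell2_dot v v = of_real (g + g).
  rewrite {1}/v ell2_dotDl (ell2_dotZl (-1)) dot_tw dot_dv.
  by rewrite of_realN mulN1r opprK of_realD.
pose H : 'M[K]_n := 1%:M - of_real g^-1 *: ((\col_i scalar_conj (v ord0 i)) *m v).
have cH c : c *m H = c - (ell2_dot c v * of_real g^-1) *: v.
  rewrite mulmxBr mulmx1 -scalemxAr mulmxA; congr (_ - _).
  rewrite mulrC -scalerA; congr (_ *: _); apply/rowP => i.
  rewrite !mxE big_ord1 !mxE; congr (_ * _).
  by apply: eq_bigr => l _; rewrite mxE.
have dot_cH c : ell2_dot (c *m H : ell2) v = - ell2_dot c v.
  rewrite cH -scaleNr ell2_dotDl ell2_dotZl dot_vv -mulNr -mulrA -of_realM.
  rewrite mulrDr mulVf// of_realD of_real1 mulNr mulrDr mulr1 opprD addrA subrr.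
  by rewrite add0r.
exists H, t; split => //.
- move=> c; apply/eqP; rewrite -(@eqrXn2 _ 2)// ?rnorm_ge0//.
  apply/eqP/(@of_real_inj R k); rewrite -!ell2_dotxx.
  rewrite {2}cH ell2_dotDr -scaleNr ell2_dotZr dot_cH.
  rewrite scalar_conjN scalar_conjM scalar_conj_real mulrNN.
  rewrite cH -scaleNr ell2_dotDl ell2_dotZl (ell2_dotC v c) -addrA.
  rewrite -[RHS]addr0; congr (_ + _).
  by ring.
- apply/row_matrixP => i; rewrite !rowE mulmx1 mulmxA [in LHS]cH dot_cH cH.
  by rewrite mulNr scaleNr opprK subrK.
- rewrite cH dot_dv -of_realM mulNr mulfV// of_realN of_real1 scaleN1r opprK.
  by rewrite /v scaleN1r addrC subrK.
- move=> i ij wi; rewrite cH ell2_dotC ell2_dot_delta.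
  by rewrite !mxE wi mulr0 eqxx (negbTE ij) mulr0 addr0 scalar_conj0 mul0r scale0r subr0.
Qed.

End Euclidean.

Section DvoretzkyRogers.
Variables (R : realType) (k : scalar_kind).
Local Notation K := (scalars R k).
Local Notation of_real := (of_real k).

Lemma absK_prod I (r : seq I) (P : pred I) (F : I -> K) :
  absK (\prod_(i <- r | P i) F i) = \prod_(i <- r | P i) absK (F i).
Proof. by apply: (big_morph (fun z : K => absK z) (@absKM R k) (absK1 R k)). Qed.

Lemma row_delta m n (A : 'M[K]_(m, n)) i : row i A = delta_mx ord0 i *m A.
Proof. exact: rowE. Qed.

Variables (Z : normedModType K) (n : nat).
Local Notation ell2 := (ell2 R k n).
Variable L : {linear ell2 -> Z}.
Hypothesis injL : injective L.

(** The operators [ell2 -> Z] of norm at most 1 with range in the image of [L],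
    through their coordinates. *)
Definition contraction (A : 'M[K]_n) :=
  forall c : ell2, rnorm (L (c *m A)) <= rnorm c.

Let dets := [set absK (\det A) | A in contraction].

Lemma absK_det_le (A : 'M[K]_n) (b : R) : (forall i j, absK (A i j) <= b) ->
  absK (\det A) <= \sum_(s : 'S_n) \prod_(i < n) b.
Proof.
move=> Ab; apply: le_trans (@ler_rnorm_sum R k K^o _ _ _ _) _.
apply: ler_sum => s _; rewrite absKM.
have -> : absK ((-1) ^+ s : K) = 1.
  by case: (odd_perm s); rewrite ?expr1 ?expr0 ?rnormN absK1.
rewrite mul1r absK_prod; apply: ler_prod => i _.
by rewrite rnorm_ge0 Ab.
Qed.

Lemma dets_has_sup : has_sup dets.
Proof.
split.
  exists (absK (\det (0 : 'M[K]_n))); exists 0 => // c.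
  by rewrite mulmx0 linear0 rnorm0 rnorm_ge0.
have [b b0 bL] := ell2_bounded_below injL.
exists (\sum_(s : 'S_n) \prod_(i < n) b^-1) => _ [A Ac <-].
apply: absK_det_le => i j.
have -> : A i j = row i A ord0 j by rewrite mxE.
apply: le_trans (ler_coord_ell2 (row i A) j) _; rewrite row_delta.
rewrite -[b^-1]mulr1 ler_pdivlMl// (le_trans (bL _))// (le_trans (Ac _))//.
by rewrite rnorm_delta.
Qed.

Lemma sup_dets_gt0 : 0 < sup dets.
Proof.
have [M M0 LM] := ell2_linear_bounded L.
have MV0 : 0 < M^-1 by rewrite invr_gt0.
apply: (@lt_le_trans _ _ (absK (\det ((of_real M^-1)%:M : 'M[K]_n)))).
  rewrite det_scalar; apply: (@rnorm_gt0 R k K^o); rewrite expf_neq0//.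
  by rewrite of_real_neq0// gt_eqF.
apply: sup_upper_bound dets_has_sup _ _; eexists; last reflexivity.
move=> c; rewrite mul_mx_scalar linearZ/= rnormZ_real ?(ltW MV0)//.
by rewrite ler_pdivrMl.
Qed.

(** A contraction whose determinant is at least half of the supremum is large
    somewhere on the span of the last [n - j] basis vectors, when these are more
    than half of the basis: otherwise stretching it by 2 on this span and
    shrinking it by 2 on the others keeps it a contraction and at least doubles
    its determinant. *)
Lemma large_on_tail (A : 'M[K]_n) j : (j.*2 < n)%N -> contraction A ->
  sup dets < 2%:R * absK (\det A) ->
  exists w : ell2, [/\ forall i : 'I_n, (i < j)%N -> w ord0 i = 0, rnorm w = 1 &
    4%:R^-1 < rnorm (L (w *m A))].
Proof.
move=> jn Ac Adet; apply: contrapT => noW.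
have small (w : ell2) : (forall i : 'I_n, (i < j)%N -> w ord0 i = 0) ->
    rnorm (L (w *m A)) <= 4%:R^-1 * rnorm w.
  move=> wj; have [->|w0] := eqVneq w 0.
    by rewrite mul0mx linear0 !rnorm0 mulr0.
  rewrite leNgt; apply/negP => wL; apply: noW.
  exists (of_real (rnorm w)^-1 *: w); split; last 2 first.
  - exact: normalize.
  - rewrite -scalemxAl linearZ/= rnormZ_real ?invr_ge0 ?rnorm_ge0//.
    by rewrite ltr_pdivlMl ?rnorm_gt0// mulrC.
  - by move=> i ij; rewrite mxE wj// mulr0.
pose d i : R := if (i < j)%N then 2%:R^-1 else 2%:R.
pose D : 'M[K]_n := diag_mx (\row_(i < n) of_real (d i)).
have DAc : contraction (D *m A).
  move=> c.
  pose c1 : ell2 := \row_(i < n) (if (i < j)%N then c ord0 i else 0).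
  pose c2 : ell2 := \row_(i < n) (if (i < j)%N then 0 else c ord0 i).
  have le_c (e : ell2) : (forall i, absK (e ord0 i) <= absK (c ord0 i)) ->
      rnorm e <= rnorm c.
    move=> ec; rewrite !rnorm_ell2 ler_wsqrtr//; apply: ler_sum => i _.
    by rewrite lerXn2r ?nnegrE ?rnorm_ge0.
  have c1c : rnorm c1 <= rnorm c.
    by apply: le_c => i; rewrite mxE; case: ifP; rewrite ?rnorm0 ?rnorm_ge0.
  have c2c : rnorm c2 <= rnorm c.
    by apply: le_c => i; rewrite mxE; case: ifP; rewrite ?rnorm0 ?rnorm_ge0.
  have -> : c *m (D *m A) = of_real 2%:R^-1 *: (c1 *m A) + of_real 2%:R *: (c2 *m A).
    rewrite mulmxA !scalemxAl -mulmxDl; congr (_ *m _); apply/rowP => i.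
    rewrite mul_mx_diag !mxE /d; case: ifP => _; rewrite mulr0.
      by rewrite addr0 mulrC.
    by rewrite add0r mulrC.
  rewrite linearD !linearZ/= (le_trans (ler_rnormD _ _))//.
  rewrite !rnormZ_real ?invr_ge0// ?ler0n//.
  have c20 (i : 'I_n) : (i < j)%N -> c2 ord0 i = 0 by move=> ij; rewrite mxE ij.
  have := Ac c1; have := small c2 c20; lra.
have : absK (\det (D *m A)) <= sup dets.
  by apply: sup_upper_bound dets_has_sup _ _; exists (D *m A).
suff : 2%:R * absK (\det A) <= absK (\det (D *m A)) by move: Adet; lra.
rewrite det_mulmx absKM ler_wpM2r ?rnorm_ge0//.
rewrite det_diag absK_prod (eq_bigr (fun i : 'I_n => d i)); last first.
  by move=> i _; rewrite mxE rnorm_of_real ger0_norm// /d; case: ifP; rewrite ?invr_ge0.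
rewrite -(big_mkord xpredT d).
have jn' : (j <= n)%N by rewrite (leq_trans _ (ltnW jn))// -addnn leq_addr.
rewrite (big_cat_nat (n := j))//= (eq_big_nat _ _ (F2 := fun=> 2%:R^-1)); last first.
  by move=> i /andP[_ ij]; rewrite /d ij.
rewrite [X in _ <= _ * X](eq_big_nat _ _ (F2 := fun=> 2%:R)); last first.
  by move=> i /andP[ij _]; rewrite /d ltnNge ij.
rewrite !prodr_const_nat subn0 exprVn ler_pdivlMl ?exprn_gt0// -exprSr.
by rewrite ler_eXn2l ?ltr1n// ltn_subRL addnn.
Qed.

(** Repeatedly reflect the next basis vector to a vector given by
    [large_on_tail]; a reflection does not change the absolute value of the
    determinant. *)
Lemma many_large_rows j : (j.*2 <= n)%N -> exists A : 'M[K]_n,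
  [/\ contraction A, sup dets < 2%:R * absK (\det A) &
      forall i : 'I_n, (i < j)%N -> 4%:R^-1 < rnorm (L (row i A))].
Proof.
elim: j => [_|j IH jn].
  have [|_ [A Ac <-] Adet] := @sup_adherent _ dets (sup dets / 2%:R) _ dets_has_sup.
    by rewrite divr_gt0// sup_dets_gt0.
  by exists A; split=> //; move: Adet; lra.
have jn2 : (j.*2 < n)%N by rewrite (leq_trans _ jn)// doubleS ltnW.
have [A [Ac Adet Arow]] := IH (ltnW jn2).
have [w [wj w1 wL]] := large_on_tail jn2 Ac Adet.
have jn1 : (j < n)%N by rewrite (leq_ltn_trans _ jn2)// -addnn leq_addr.
have [H [t [t1 Hiso HH Hj Hi]]] := reflection (Ordinal jn1) w1.
exists (H *m A); split.
- by move=> c; rewrite mulmxA (le_trans (Ac _))// Hiso.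
- rewrite det_mulmx absKM.
  suff -> : absK (\det H) = 1 by rewrite mul1r.
  apply/eqP; rewrite -(@eqrXn2 _ 2)// ?rnorm_ge0// expr1n expr2 -absKM.
  by rewrite -det_mulmx HH det1 absK1.
- move=> i; rewrite ltnS leq_eqVlt => /orP[/eqP ij|ij].
    have -> : i = Ordinal jn1 by apply/val_inj.
    by rewrite row_delta mulmxA Hj -scalemxAl linearZ/= rnormZ t1 mul1r.
  rewrite row_delta mulmxA Hi -?row_delta ?Arow ?wj//.
  by apply: contraTneq ij => ->; rewrite ltnn.
Qed.

End DvoretzkyRogers.

Section InfiniteDimension.
Variables (R : realType) (k : scalar_kind).
Local Notation K := (scalars R k).
Local Notation of_real := (of_real k).
Local Notation ell2 := (ell2 R k).

Lemma linear_inj_leq m n (f : {linear 'rV[K]_m -> 'rV[K]_n}) : injective f -> (m <= n)%N.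
Proof.
move=> injf; suff /eqP <- : row_free (lin1_mx f) by exact: rank_leq_col.
apply: inj_row_free => v; rewrite mul_rV_lin1 => fv0.
by apply: injf; rewrite linear0.
Qed.

Lemma has_dim_linear_inj (V : lmodType K) m n (L : {linear ell2 m -> V}) :
  injective L -> has_dim V n -> (m <= n)%N.
Proof.
move=> injL [f fbij].
have [F FE] : exists F : {linear 'rV[K]_m -> 'rV[K]_n}, F = f \o L :> (_ -> _).
  by apply: linear_bundle => a x y; rewrite /= !linearP.
by apply: (@linear_inj_leq _ _ F); rewrite FE; apply: inj_comp (bij_inj fbij) injL.
Qed.

Lemma linear_inj_surj_has_dim (V : lmodType K) n (L : {linear ell2 n -> V}) :
  injective L -> (forall v, exists x, v = L x) -> has_dim V n.
Proof.
move=> injL /choice[g gL].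
have gl : linear (g : V -> 'rV[K]_n).
  by move=> a x y; apply: injL; rewrite -gL linearP -!gL.
have [G GE] := linear_bundle gl; exists G; rewrite GE.
by exists L => x; [rewrite -gL|apply: injL; rewrite -gL].
Qed.

Lemma has_dim_unique (V : lmodType K) m n : has_dim V m -> has_dim V n -> m = n.
Proof.
move=> Vm Vn; apply/eqP; rewrite eqn_leq.
have [L injL _] := has_dim_ell2 Vm; rewrite (has_dim_linear_inj injL Vn).
by have [M injM _] := has_dim_ell2 Vn; rewrite (has_dim_linear_inj injM Vm).
Qed.

Lemma dimensionE (V : lmodType K) n : has_dim V n -> dimension V = n.
Proof. by move=> Vn; rewrite /dimension; case: xgetP => [m _ /has_dim_unique/(_ Vn)|/(_ n)]. Qed.

Lemma extend_linear_inj (V : lmodType K) n (L : {linear ell2 n -> V}) z :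
  injective L -> (forall x, z <> L x) ->
  exists M : {linear ell2 n.+1 -> V}, injective M.
Proof.
move=> injL zL.
pose f (c : ell2 n.+1) := L (rsubmx (c : 'M_(1, 1 + n))) + c ord0 ord0 *: z.
have fl : linear f.
  move=> a c d; rewrite /f !linearP /= !mxE scalerDr scalerDl -!addrA; congr (_ + _).
  by rewrite addrCA scalerA.
have [M ME] := linear_bundle fl; exists M.
apply: raddf_inj => c Mc; have : f c = 0 by rewrite -ME; exact: Mc.
move=> /eqP; rewrite addr_eq0 => /eqP fc.
have c0 : c ord0 ord0 = 0.
  apply/eqP/negP => /negP c0; apply: (zL (- (c ord0 ord0)^-1 *: rsubmx (c : 'M_(1, 1 + n)))).
  by rewrite linearZ/= fc scalerN scaleNr opprK scalerA mulVf// scale1r.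
rewrite c0 scale0r oppr0 in fc.
have {fc} c1 : rsubmx (c : 'M_(1, 1 + n)) = 0 by apply: injL; rewrite fc linear0.
rewrite -[c](@hsubmxK _ 1 1 n) c1 (_ : lsubmx _ = 0) ?row_mx0//.
apply/rowP => i; rewrite !mxE (_ : lshift n i = ord0) ?c0//.
by apply/val_inj; rewrite /= (ord1 i).
Qed.

Lemma infinite_dim_linear_inj (V : lmodType K) : ~ finite_dim V ->
  forall n, exists L : {linear ell2 n -> V}, injective L.
Proof.
move=> infV; elim=> [|n [L injL]].
  have [L _] : exists L : {linear ell2 0 -> V}, L = (fun=> 0) :> (_ -> _).
    by apply: linear_bundle => a x y; rewrite scaler0 addr0.
  by exists L => x y _; apply/rowP => -[].
apply: contrapT => noM; apply: infV; exists n.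
apply: (linear_inj_surj_has_dim injL) => z; apply: contrapT => zL.
by apply: noM; apply: (extend_linear_inj injL (z := z)) => x zx; apply: zL; exists x.
Qed.

Lemma linear_inj_infinite_dim (V : lmodType K) :
  (forall n, exists L : {linear ell2 n -> V}, injective L) -> ~ finite_dim V.
Proof.
move=> inj [n Vn]; have [L injL] := inj n.+1.
by have := has_dim_linear_inj injL Vn; rewrite ltnn.
Qed.

End InfiniteDimension.

Section AlmostEuclideanPairs.
Variables (R : realType) (k : scalar_kind).
Local Notation K := (scalars R k).
Local Notation of_real := (of_real k).
Local Notation ell2 := (ell2 R k).
Variable Z : normedModType K.

(** The Dvoretzky-Rogers lemma. The vectors form a sequence, with dummy terms
    from [N] on, because the tournament below splits it by shifting the index. *)
Lemma dvoretzky_rogers N (L : {linear ell2 (N + N) -> Z}) : injective L ->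
  exists x : nat -> Z, (forall i, (i < N)%N -> 4%:R^-1 <= rnorm (x i)) /\
    forall c : nat -> K,
      rnorm (\sum_(i < N) c i *: x i) ^+ 2 <= \sum_(i < N) absK (c i) ^+ 2.
Proof.
move=> injL; have NN : (N.*2 <= N + N)%N by rewrite addnn.
have [A [Ac _ Arow]] := many_large_rows injL NN.
pose x i := if insub i is Some j then L (row j A) else 0.
have xE (j : 'I_(N + N)) : x j = L (row j A) by rewrite /x valK.
exists x; split.
  move=> i iN; have iNN : (i < N + N)%N by rewrite (leq_trans iN)// leq_addr.
  by have := xE (Ordinal iNN); rewrite /= => ->; rewrite ltW// Arow.
move=> c; pose d : ell2 (N + N) := \row_(i < N + N) (if (i < N)%N then c i else 0).
have lN (i : 'I_N) : (lshift N i < N)%N by rewrite /= ltn_ord.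
have rN (i : 'I_N) : (rshift N i < N)%N = false by rewrite /= ltnNge leq_addr.
have dE : \sum_i absK (d ord0 i) ^+ 2 = \sum_(i < N) absK (c i) ^+ 2.
  rewrite big_split_ord /= [X in _ + X]big1 ?addr0.
    by apply: eq_bigr => i _; rewrite mxE lN.
  by move=> i _; rewrite mxE rN rnorm0 expr0n.
have LdE : L (d *m A) = \sum_(i < N) c i *: x i.
  rewrite mulmx_sum_row linear_sum big_split_ord /= [X in _ + X]big1 ?addr0.
    by apply: eq_bigr => i _; rewrite mxE lN linearZ -xE.
  by move=> i _; rewrite mxE rN scale0r linear0.
by rewrite -LdE -dE -sqr_rnorm_ell2 lerXn2r ?nnegrE ?rnorm_ge0.
Qed.

Section Tournament.
Variable q : R.
Hypothesis q_gt0 : 0 < q.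
Hypothesis expand : forall x y : Z, 1 <= rnorm x -> 1 <= rnorm y ->
  exists a b : K, absK a ^+ 2 + absK b ^+ 2 <= 1 /\ q <= rnorm (a *: x + b *: y).

Let expand_scaled (r : R) (x y : Z) : 0 < r -> r <= rnorm x -> r <= rnorm y ->
  exists a b : K, absK a ^+ 2 + absK b ^+ 2 <= 1 /\ q * r <= rnorm (a *: x + b *: y).
Proof.
move=> r0 rx ry; have rV0 : 0 <= r^-1 by rewrite invr_ge0 ltW.
have [||a [b [ab qab]]] := @expand (of_real r^-1 *: x) (of_real r^-1 *: y).
- by rewrite rnormZ_real// ler_pdivlMl// mulr1.
- by rewrite rnormZ_real// ler_pdivlMl// mulr1.
exists a, b; split=> //; move: qab.
rewrite !scalerA !(mulrC _ (of_real _)) -!scalerA -scalerDr rnormZ_real//.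
by rewrite ler_pdivlMl// mulrC.
Qed.

(** Each round combines the winners of the two halves. *)
Lemma tournament m (r : R) (x : nat -> Z) : 0 < r ->
  (forall i, (i < 2 ^ m)%N -> r <= rnorm (x i)) ->
  exists c : nat -> K, \sum_(i < 2 ^ m) absK (c i) ^+ 2 <= 1 /\
    q ^+ m * r <= rnorm (\sum_(i < 2 ^ m) c i *: x i).
Proof.
elim: m x => [|m IH] x r0 xr.
  exists (fun=> 1); rewrite !big_ord1 absK1 expr1n mul1r scale1r.
  by split=> //; exact: xr.
have N2 : (2 ^ m.+1 = 2 ^ m + 2 ^ m)%N by rewrite expnS mul2n addnn.
have [|c [c1 cX]] := IH x r0.
  by move=> i im; apply: xr; rewrite N2 ltn_addr.
have [|d [d1 dX]] := IH (fun i => x (2 ^ m + i)%N) r0.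
  by move=> i im; apply: xr; rewrite N2 ltn_add2l.
have qm0 : 0 < q ^+ m * r by rewrite mulr_gt0 ?exprn_gt0.
have [a [b [ab qab]]] := expand_scaled qm0 cX dX.
pose e i : K := if (i < 2 ^ m)%N then a * c i else b * d (i - 2 ^ m)%N.
exists e; rewrite N2 !big_split_ord /=.
have el (i : 'I_(2 ^ m)) : e i = a * c i by rewrite /e ltn_ord.
have er (i : 'I_(2 ^ m)) : e (2 ^ m + i)%N = b * d i.
  by rewrite /e ltnNge leq_addr/= addKn.
split.
  under eq_bigr do rewrite el absKM exprMn.
  under [X in _ + X]eq_bigr do rewrite er absKM exprMn.
  rewrite -!mulr_sumr; apply: le_trans ab; apply: lerD.
    by rewrite ler_piMr// sqr_ge0.
  by rewrite ler_piMr// sqr_ge0.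
under eq_bigr do rewrite el -scalerA.
under [X in _ + X]eq_bigr do rewrite er -scalerA.
by rewrite -!scaler_sumr exprS -mulrA.
Qed.

End Tournament.

(** If every two vectors of norm at least 1 had a normalized combination of norm
    at least [q], then a tournament among the [2 ^ m] vectors of
    [dvoretzky_rogers] would produce a normalized combination of norm at
    least [q ^ m / 4], although it has norm at most 1. *)
Lemma almost_euclidean_pair (q : R) : ~ finite_dim Z -> 1 < q ->
  exists x y : Z, [/\ 1 <= rnorm x, 1 <= rnorm y & forall a b : K,
    rnorm (a *: x + b *: y) ^+ 2 <= q ^+ 2 * (absK a ^+ 2 + absK b ^+ 2)].
Proof.
move=> infZ q1; apply: contrapT => noxy; have q0 : 0 < q by exact: lt_trans q1.
have expand (x y : Z) : 1 <= rnorm x -> 1 <= rnorm y ->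
    exists a b : K, absK a ^+ 2 + absK b ^+ 2 <= 1 /\ q <= rnorm (a *: x + b *: y).
  move=> x1 y1; apply: contrapT => noab; apply: noxy; exists x, y; split => // a b.
  set s := absK a ^+ 2 + absK b ^+ 2.
  have s0 : 0 <= s by rewrite addr_ge0 ?sqr_ge0.
  have [s00|sn0] := eqVneq s 0.
    have a0 : a = 0.
      apply: absK_eq0; apply/eqP; rewrite -sqrf_eq0 eq_le sqr_ge0 andbT -s00.
      by rewrite lerDl sqr_ge0.
    have b0 : b = 0.
      apply: absK_eq0; apply/eqP; rewrite -sqrf_eq0 eq_le sqr_ge0 andbT -s00.
      by rewrite lerDr sqr_ge0.
    by rewrite a0 b0 !scale0r addr0 rnorm0 expr0n mulr_ge0 ?sqr_ge0.
  pose r := Num.sqrt s; have r0 : 0 < r by rewrite sqrtr_gt0 lt_def sn0.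
  have rV0 : 0 <= r^-1 by rewrite invr_ge0 ltW.
  have rs : r ^+ 2 = s by rewrite sqr_sqrtr.
  rewrite -rs -exprMn lerXn2r ?nnegrE ?rnorm_ge0 ?mulr_ge0 ?(ltW q0) ?(ltW r0)//.
  rewrite leNgt; apply/negP => big; apply: noab.
  exists (of_real r^-1 * a), (of_real r^-1 * b); split.
    rewrite !absKM !rnorm_of_real !exprMn -mulrDr -/s -rs real_normK ?num_real//.
    by rewrite -exprMn mulVf ?expr1n// gt_eqF.
  rewrite -!scalerA -scalerDr rnormZ_real// ler_pdivlMl// mulrC.
  exact: ltW.
have [m qm] : exists m, 4%:R < q ^+ m.
  pose B := 4%:R / (q - 1).
  have q10 : 0 < q - 1 by rewrite subr_gt0.
  exists (Num.trunc B).+1.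
  have bern l : l%:R * (q - 1) <= q ^+ l.
    elim: l => [|l IHl]; first by rewrite mul0r expr0.
    rewrite exprS; have := exprn_ege1 l (ltW q1); rewrite -natr1; nra.
  apply: lt_le_trans (bern _); rewrite -ltr_pdivrMr//.
  exact: truncnS_gt.
have [L injL] := infinite_dim_linear_inj infZ (2 ^ m + 2 ^ m).
have [x [xr xc]] := dvoretzky_rogers injL.
have r0 : 0 < 4%:R^-1 :> R by rewrite invr_gt0 ltr0n.
have [c [c1 cq]] := tournament q0 expand r0 xr.
have := le_trans (xc c) c1; apply/negP; rewrite -ltNge.
have q4 : 1 < q ^+ m * 4%:R^-1 by rewrite ltr_pdivlMr// mul1r.
by rewrite exprn_egt1// (lt_le_trans q4).
Qed.

End AlmostEuclideanPairs.

(** * The von Neumann-Jordan constant *)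

Section Estimates.
Variable R : realType.
Implicit Types A B P M e s : R.

Lemma ler_sqrD A B P : 0 <= P -> P <= A + B -> P ^+ 2 <= (A + B) ^+ 2.
Proof. by move=> P0 PAB; rewrite lerXn2r ?nnegrE// (le_trans P0). Qed.

(** If [P ^+ 2 + M ^+ 2] almost attains its upper bound [4 * (A ^+ 2 + B ^+ 2)],
    then [A] and [B] almost agree, since the triangle inequality leaves a gap of
    [2 * (A - B) ^+ 2], and [P] is almost [A + B]. *)
Lemma almost_extremal A B P M e : 0 <= B -> B <= A -> 0 <= P -> 0 <= M ->
  0 < e -> e <= 1 -> P <= A + B -> M <= A + B ->
  (2%:R - (e / 4%:R) ^+ 2 / 2%:R) * (2%:R * (A ^+ 2 + B ^+ 2)) <= P ^+ 2 + M ^+ 2 ->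
  (2%:R - e) * A <= P.
Proof.
move=> B0 BA P0 M0 e0 e1 PAB MAB; set s := e / 4%:R => big.
have es : e = 4%:R * s by rewrite /s [RHS]mulrC divfK// pnatr_eq0.
have s0 : 0 < s by rewrite divr_gt0.
clearbody s; subst e.
have P2 := ler_sqrD P0 PAB; have M2 := ler_sqrD M0 MAB.
have A0 : 0 <= A by exact: le_trans BA.
have B2A : B ^+ 2 <= A ^+ 2 by rewrite lerXn2r ?nnegrE.
have s2 : 0 <= s ^+ 2 by exact: sqr_ge0.
have sB : s ^+ 2 * B ^+ 2 <= s ^+ 2 * A ^+ 2 by rewrite ler_wpM2l.
have AB : A - B <= s * A.
  rewrite -ler_sqr ?nnegrE ?subr_ge0 ?mulr_ge0 ?(ltW s0)//.
  rewrite exprMn; move: big P2 M2 sB; rewrite !sqrrD sqrrN; lra.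
have AsA : A * (A - B) <= A * (s * A) by rewrite ler_wpM2l.
have AB2 := sqr_ge0 (A - B).
have c0 : 0 <= (2%:R - 4%:R * s) * A by rewrite mulr_ge0//; move: e1; lra.
rewrite -ler_sqr ?nnegrE//.
have sA : s ^+ 2 * A ^+ 2 <= s * A ^+ 2.
  by rewrite ler_wpM2r ?sqr_ge0// expr2 ler_piMr ?(ltW s0)//; lra.
have sA0 : 0 <= s * A ^+ 2 by rewrite mulr_ge0 ?sqr_ge0// ltW.
have sAA : 0 <= s ^+ 2 * A ^+ 2 by rewrite mulr_ge0 ?sqr_ge0.
have s14 : s * (s * A ^+ 2) <= 4%:R^-1 * (s * A ^+ 2) by rewrite ler_wpM2r//; lra.
move: big M2 AsA AB2 sB sA sA0 sAA s14; rewrite exprMn !expr2.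
nra.
Qed.

End Estimates.

Section NeumannJordan.
Variables (R : realType) (k : scalar_kind).
Local Notation K := (scalars R k).
Local Notation of_real := (of_real k).

(** The failure of uniform non-squareness in the sense of James. *)
Definition almost_square (V : lmodType K) (p : V -> R) :=
  forall e : R, 0 < e -> exists x y, [/\ p x <= 1, p y <= 1,
    2%:R - e <= p (x + y) & 2%:R - e <= p (x - y)].

Section Constant.
Variable X : normedModType K.
Implicit Types x y : X.

Let ratios := [set r | exists x y : X, (x, y) <> (0, 0) /\
    r = (rnorm (x + y) ^+ 2 + rnorm (x - y) ^+ 2) /
        (2%:R * (rnorm x ^+ 2 + rnorm y ^+ 2))].

Let sumsq_gt0 x y : (x, y) <> (0, 0) -> 0 < rnorm x ^+ 2 + rnorm y ^+ 2.
Proof.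
move=> xy0; rewrite lt_def addr_ge0 ?sqr_ge0// andbT paddr_eq0 ?sqr_ge0//.
apply/negP => /andP[]; rewrite !sqrf_eq0 => /eqP/rnorm0_eq0 x0 /eqP/rnorm0_eq0 y0.
by apply: xy0; rewrite x0 y0.
Qed.

Lemma ler_rnormB x y : rnorm (x - y) <= rnorm x + rnorm y.
Proof. by rewrite (le_trans (ler_rnormD _ _))// rnormN. Qed.

Let ratios_ub : ubound ratios 2%:R.
Proof.
move=> _ [x [y [xy0 ->]]]; have s0 := sumsq_gt0 xy0.
rewrite ler_pdivrMr ?mulr_gt0//.
have := ler_sqrD (rnorm_ge0 _) (ler_rnormD x y).
have := ler_sqrD (rnorm_ge0 _) (ler_rnormB x y).
have := sqr_ge0 (rnorm x - rnorm y); rewrite !sqrrD sqrrN; lra.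
Qed.

Lemma CNJ_le2 : CNJ X <= 2%:R.
Proof.
have [r0|/nonemptyPn r0] := pselect (ratios !=set0); first exact: ge_sup.
by rewrite /CNJ -/ratios r0 sup0.
Qed.

Lemma le_CNJ x y (r : R) : 0 < rnorm x ^+ 2 + rnorm y ^+ 2 ->
  r * (2%:R * (rnorm x ^+ 2 + rnorm y ^+ 2)) <=
    rnorm (x + y) ^+ 2 + rnorm (x - y) ^+ 2 ->
  r <= CNJ X.
Proof.
move=> s0 rxy; have xy0 : (x, y) <> (0, 0).
  by move=> [x0 y0]; move: s0; rewrite x0 y0 rnorm0 expr0n addr0 ltxx.
apply: (@le_trans _ _ ((rnorm (x + y) ^+ 2 + rnorm (x - y) ^+ 2) /
        (2%:R * (rnorm x ^+ 2 + rnorm y ^+ 2)))).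
  by rewrite ler_pdivlMr// mulr_gt0.
apply: sup_upper_bound; last by exists x, y.
by split; [eexists; exists x, y; split; [exact: xy0|reflexivity]|exists 2%:R].
Qed.

Lemma almost_square_CNJ : almost_square (@rnorm R k X) -> CNJ X = 2%:R.
Proof.
move=> sq; apply/eqP; rewrite eq_le CNJ_le2 /=; apply/ler_addgt0Pr => e e0.
have [d [d0 d1 de]] : exists d : R, [/\ 0 < d, d <= 1 & d * 4%:R <= e].
  exists (Num.min 1 (e / 4%:R)); split; last by rewrite -ler_pdivlMr// ge_min lexx orbT.
    by rewrite lt_min ltr01 divr_gt0.
  by rewrite ge_min lexx.
have [x [y [x1 y1 p m]]] := sq d d0; rewrite -lerBlDr.
have := rnorm_ge0 x; have := rnorm_ge0 y.
have := ler_rnormD x y => xy.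
move=> y0 x0; apply: (@le_CNJ x y).
  rewrite lt_def addr_ge0 ?sqr_ge0// andbT paddr_eq0 ?sqr_ge0//.
  apply/negP => /andP[]; rewrite !sqrf_eq0 => /eqP xx /eqP yy.
  by move: xy; rewrite xx yy; move: p d1; lra.
set s := rnorm x ^+ 2 + rnorm y ^+ 2.
have s2 : s <= 2%:R by rewrite /s; nra.
have s0 : 0 <= s by rewrite /s addr_ge0 ?sqr_ge0.
have p2 : 4%:R - 4%:R * d <= rnorm (x + y) ^+ 2 by nra.
have m2 : 4%:R - 4%:R * d <= rnorm (x - y) ^+ 2 by nra.
have [e2|e2] := lerP e 2%:R; last by nra.
have : (2%:R - e) * s <= (2%:R - e) * 2%:R by rewrite ler_wpM2l// subr_ge0.
lra.
Qed.

Lemma CNJ_almost_square : CNJ X = 2%:R -> almost_square (@rnorm R k X).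
Proof.
move=> X2 e0 e0_gt0.
have [e [e_gt0 e1 ee0]] : exists e : R, [/\ 0 < e, e <= 1 & e <= e0].
  by exists (Num.min 1 e0); rewrite lt_min ltr01 e0_gt0 !ge_min !lexx orbT.
suff [x [y [x1 y1 p m]]] : exists x y, [/\ rnorm x <= 1, rnorm y <= 1,
    2%:R - e <= rnorm (x + y) & 2%:R - e <= rnorm (x - y)].
  by exists x, y; split=> //; [move: p|move: m]; lra.
have d0 : 0 < (e / 4%:R) ^+ 2 / 2%:R by rewrite divr_gt0 ?exprn_gt0// divr_gt0.
have hs : has_sup ratios.
  split; last by exists 2%:R; exact: ratios_ub.
  apply: contrapT => /nonemptyPn r0; move: X2; rewrite /CNJ -/ratios r0 sup0.
  by move=> /eqP; rewrite eq_sym pnatr_eq0.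
have [_ [x [y [xy0 ->]]]] := sup_adherent d0 hs.
have -> : sup ratios = 2%:R by exact: X2.
have S0 := sumsq_gt0 xy0; rewrite ltr_pdivlMr ?mulr_gt0// => big.
(* Dividing by the larger norm moves both vectors to the unit ball. *)
pose r := Num.max (rnorm x) (rnorm y).
have rx : rnorm x <= r by rewrite le_max lexx.
have ry : rnorm y <= r by rewrite le_max lexx orbT.
have r0 : 0 < r.
  rewrite lt_def (le_trans (rnorm_ge0 x) rx) andbT; apply/negP => /eqP r0.
  move: rx ry; rewrite r0 => rx ry.
  by have := rnorm_ge0 x; have := rnorm_ge0 y; move: S0; nra.
have rV0 : 0 <= r^-1 by rewrite invr_ge0 ltW.
exists (of_real r^-1 *: x), (of_real r^-1 *: y).
rewrite -scalerDr -scalerBr !rnormZ_real//.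
have [Pr Mr] : (2%:R - e) * r <= rnorm (x + y) /\ (2%:R - e) * r <= rnorm (x - y).
  have big' := ltW big; rewrite [leRHS]addrC in big'.
  rewrite /r maxEle; case: ifPn => [xy|/negbTE]; last first.
    move=> /negbT; rewrite -ltNge => /ltW yx; split.
      apply: (almost_extremal _ yx _ _ e_gt0 e1 _ _ (ltW big)) => //;
        by rewrite ?rnorm_ge0 ?ler_rnormD ?ler_rnormB.
    apply: (almost_extremal _ yx _ _ e_gt0 e1 _ _ big') => //;
      by rewrite ?rnorm_ge0 ?ler_rnormD ?ler_rnormB.
  have big1 := ltW big; rewrite (addrC (rnorm x ^+ 2)) in big1.
  rewrite (addrC (rnorm x ^+ 2)) in big'; split.
    apply: (almost_extremal _ xy _ _ e_gt0 e1 _ _ big1) => //;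
      by rewrite ?rnorm_ge0// [leRHS]addrC ?ler_rnormD ?ler_rnormB.
  apply: (almost_extremal _ xy _ _ e_gt0 e1 _ _ big') => //;
    by rewrite ?rnorm_ge0// [leRHS]addrC ?ler_rnormD ?ler_rnormB.
by split; rewrite ?ler_pdivrMl ?ler_pdivlMl ?mulr1// mulrC.
Qed.

End Constant.
End NeumannJordan.

(** * Operators that factor through the plane *)

Section Operators.
Variables (R : realType) (k : scalar_kind).
Local Notation K := (scalars R k).
Local Notation of_real := (of_real k).
Local Notation ell2 := (ell2 R k).

Lemma CNJ_ge0 (X : normedModType K) : 0 <= CNJ X.
Proof.
rewrite /CNJ; set A := [set r | _].
have [[r Ar]|/nonemptyPn ->] := pselect (A !=set0); last by rewrite sup0.
case: (Ar) => x [y [xy0 rE]]; apply: (@le_trans _ _ r).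
  by rewrite rE divr_ge0 ?mulr_ge0 ?addr_ge0 ?sqr_ge0.
rewrite rE; have [xx|s0] := eqVneq (rnorm x ^+ 2 + rnorm y ^+ 2) 0.
  exfalso; move/eqP: xx; rewrite paddr_eq0 ?sqr_ge0// !sqrf_eq0.
  by case/andP => /eqP/rnorm0_eq0 x0 /eqP/rnorm0_eq0 y0; apply: xy0; rewrite x0 y0.
apply: (@le_CNJ _ _ X x y); first by rewrite lt_def s0 addr_ge0 ?sqr_ge0.
by rewrite divfK// mulf_neq0// pnatr_eq0.
Qed.

(** The factor [c] is harmless because the quotients in the definition of [CNJ]
    are homogeneous of degree 0. *)
Lemma CNJ_isometry (X W : normedModType K) (c : R) (J : X -> W) : 0 < c ->
  {morph J : x y / x + y} -> {morph J : x y / x - y} ->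
  (forall x, rnorm (J x) = c * rnorm x) -> CNJ X <= CNJ W.
Proof.
move=> c0 JD JB Jn; rewrite {1}/CNJ; set A := [set r | _].
have [A0|/nonemptyPn ->] := pselect (A !=set0); last by rewrite sup0 CNJ_ge0.
apply: ge_sup => // _ [x [y [xy0 ->]]].
have s0 : 0 < rnorm x ^+ 2 + rnorm y ^+ 2.
  rewrite lt_def addr_ge0 ?sqr_ge0// andbT paddr_eq0 ?sqr_ge0//.
  apply/negP => /andP[]; rewrite !sqrf_eq0 => /eqP/rnorm0_eq0 x0 /eqP/rnorm0_eq0 y0.
  by apply: xy0; rewrite x0 y0.
have c20 : 0 < c ^+ 2 by rewrite exprn_gt0.
have sJ : rnorm (J x) ^+ 2 + rnorm (J y) ^+ 2 = c ^+ 2 * (rnorm x ^+ 2 + rnorm y ^+ 2).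
  by rewrite !Jn !exprMn mulrDr.
apply: (@le_CNJ _ _ W (J x) (J y)); rewrite sJ ?mulr_gt0//.
rewrite -JD -JB !Jn !exprMn -mulrDr (mulrCA 2%:R (c ^+ 2)) (mulrCA _ (c ^+ 2)) ler_pM2l//.
by rewrite divfK// mulf_neq0 ?pnatr_eq0// gt_eqF.
Qed.

Lemma bounded_opD (E Z : normedModType K) (S T : bounded_op E Z) x :
  (S + T) x = S x + T x.
Proof. by []. Qed.

Lemma bounded_opB (E Z : normedModType K) (S T : bounded_op E Z) x :
  (S - T) x = S x - T x.
Proof. by []. Qed.

Lemma scale_real2 (V : lmodType K) (x : V) : x + x = of_real 2%:R *: x.
Proof. by rewrite -mulr2n -scaler_nat -[2%:R]/(1 + 1) of_realD of_real1. Qed.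

Lemma double_sqr (w N : R) : 0 <= w -> 2%:R * w <= N -> 4%:R * w ^+ 2 <= N ^+ 2.
Proof. by nra. Qed.

Section PairOperator.
Variables E Z : normedModType K.
Implicit Types (f g : dual_space E) (x y : Z).

Lemma pair_op_linear f g x y : linear (fun e : E => (f e : K) *: x + (g e : K) *: y).
Proof.
move=> a e e'; by rewrite (linearP f) (linearP g) /= !scalerDl scalerDr !scalerA addrACA.
Qed.

Lemma pair_op_bounded f g x y : exists M : R, forall e : E,
  rnorm ((f e : K) *: x + (g e : K) *: y) <= M * rnorm e.
Proof.
exists (opnorm f * rnorm x + opnorm g * rnorm y) => e.
rewrite (le_trans (ler_rnormD _ _))// mulrDl !rnormZ.
rewrite (mulrAC _ (rnorm x)) (mulrAC _ (rnorm y)).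
by rewrite lerD// ler_wpM2r ?rnorm_ge0 ?le_opnorm.
Qed.

(** The operator that factors as [(f, g) : E -> ell2] followed by the map that
    sends the two basis vectors to [x] and [y]. *)
Definition pair_op f g x y : bounded_op E Z :=
  make_bounded_op (pair_op_linear f g x y) (pair_op_bounded f g x y).

Definition plane_contraction f g :=
  forall e, absK (f e) ^+ 2 + absK (g e) ^+ 2 <= rnorm e ^+ 2.

Lemma pair_op_norm f g x y (q : R) : 0 <= q -> plane_contraction f g ->
  (forall a b : K, rnorm (a *: x + b *: y) ^+ 2 <= q ^+ 2 * (absK a ^+ 2 + absK b ^+ 2)) ->
  rnorm (pair_op f g x y) <= q.
Proof.
move=> q0 fg xy; rewrite rnorm_bounded_op; apply: opnorm_le => e e1.
rewrite -ler_sqr ?nnegrE ?rnorm_ge0// (le_trans (xy _ _))//.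
rewrite -[leRHS]mulr1 ler_wpM2l ?sqr_ge0// (le_trans (fg e))//.
by rewrite expr_le1 ?rnorm_ge0.
Qed.

(** With an almost Euclidean pair [x, y] in [Z], the operators
    [f x + g y] and [f x - g y] are almost contractions, whereas half of their
    sum, [f x], and half of their difference, [g y], have norms at least
    [|f u|] and [|g v|]. *)
Lemma CNJ_operators_ge f g (u v : E) (w : R) : ~ finite_dim Z ->
  plane_contraction f g -> rnorm u <= 1 -> rnorm v <= 1 ->
  0 <= w -> w <= absK (f u) -> w <= absK (g v) ->
  2%:R * w ^+ 2 <= CNJ (bounded_op E Z).
Proof.
move=> infZ fg u1 v1; rewrite le_eqVlt => /orP[/eqP <- _ _|w0 wu wv].
  by rewrite expr0n mulr0 CNJ_ge0.
(* The factor [q ^+ 2] costs at most [e], because the constant is at most 2. *)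
apply/ler_addgt0Pr => e e0; pose q := Num.sqrt (1 + e / 2%:R).
have e20 : 0 < e / 2%:R by rewrite divr_gt0.
have q2 : q ^+ 2 = 1 + e / 2%:R by rewrite sqr_sqrtr// ltW// addr_gt0.
have q1 : 1 < q by rewrite /q -[ltLHS]sqrtr1 ltr_sqrt ?ltrDl// addr_gt0.
have [x [y [x1 y1 xy]]] := almost_euclidean_pair infZ q1.
have q0 : 0 < q by exact: lt_trans q1.
have xy' (a b : K) : rnorm (a *: x + b *: - y) ^+ 2 <= q ^+ 2 * (absK a ^+ 2 + absK b ^+ 2).
  by rewrite scalerN -scaleNr (le_trans (xy _ _))// rnormN.
pose S := pair_op f g x y; pose T := pair_op f g x (- y).
have S1 : rnorm S <= q by exact: pair_op_norm (ltW q0) fg xy.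
have T1 : rnorm T <= q by exact: pair_op_norm (ltW q0) fg xy'.
have ST : 2%:R * w <= rnorm (S + T).
  rewrite rnorm_bounded_op (le_trans _ (le_opnorm1 (S + T) u1))//.
  rewrite bounded_opD /= addrACA scalerN subrr addr0 scale_real2.
  by rewrite rnormZ_real// ler_pM2l// rnormZ (le_trans wu)// ler_peMr ?rnorm_ge0.
have SmT : 2%:R * w <= rnorm (S - T).
  rewrite rnorm_bounded_op (le_trans _ (le_opnorm1 (S - T) v1))//.
  rewrite bounded_opB /= opprD addrACA scalerN subrr add0r opprK scale_real2.
  by rewrite rnormZ_real// ler_pM2l// rnormZ (le_trans wv)// ler_peMr ?rnorm_ge0.
have w20 : 0 < w ^+ 2 by rewrite exprn_gt0.
have ST2 : 4%:R * w ^+ 2 <= rnorm (S + T) ^+ 2 by exact: double_sqr (ltW w0) ST.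
have SmT2 : 4%:R * w ^+ 2 <= rnorm (S - T) ^+ 2 by exact: double_sqr (ltW w0) SmT.
have Sq : rnorm S ^+ 2 <= q ^+ 2 by rewrite lerXn2r ?nnegrE ?rnorm_ge0 ?(ltW q0).
have Tq : rnorm T ^+ 2 <= q ^+ 2 by rewrite lerXn2r ?nnegrE ?rnorm_ge0 ?(ltW q0).
have q20 : 0 < q ^+ 2 by rewrite exprn_gt0.
have : 2%:R * w ^+ 2 / q ^+ 2 <= CNJ (bounded_op E Z).
  apply: (@le_CNJ _ _ _ S T).
    rewrite lt_def addr_ge0 ?sqr_ge0// andbT paddr_eq0 ?sqr_ge0//.
    apply/negP => /andP[]; rewrite !sqrf_eq0 => /eqP S0 /eqP T0.
    by have := ler_rnormD S T; rewrite S0 T0; move: ST w0; lra.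
  rewrite mulrAC ler_pdivrMr// mulrDr.
  have -> : 2%:R * w ^+ 2 * (2%:R * rnorm S ^+ 2 + 2%:R * rnorm T ^+ 2) =
    4%:R * w ^+ 2 * (rnorm S ^+ 2 + rnorm T ^+ 2) by ring.
  have h : 4%:R * w ^+ 2 * (rnorm S ^+ 2 + rnorm T ^+ 2) <= 4%:R * w ^+ 2 * (2%:R * q ^+ 2).
    by rewrite ler_wpM2l ?mulr_ge0 ?(ltW w20)//; lra.
  rewrite (le_trans h)// mulrA ler_pM2r//; lra.
rewrite ler_pdivrMr// q2 mulrDr mulr1 => /le_trans; apply.
have := ler_wpM2r (ltW e20) (CNJ_le2 (bounded_op E Z)); lra.
Qed.

End PairOperator.
End Operators.

(** * Orthogonal contact points *)

Section Contact.
Variables (R : realType) (k : scalar_kind).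
Local Notation K := (scalars R k).
Local Notation of_real := (of_real k).
Local Notation ell2 := (ell2 R k).

Lemma bessel2 n (x a b : ell2 n) : rnorm a = 1 -> rnorm b = 1 -> ell2_dot a b = 0 ->
  absK (ell2_dot x a) ^+ 2 + absK (ell2_dot x b) ^+ 2 <= rnorm x ^+ 2.
Proof.
move=> a1 b1 ab; have ba : ell2_dot b a = 0 by rewrite ell2_dotC ab scalar_conj0.
set p := ell2_dot x a; set q := ell2_dot x b.
pose s : R := absK p ^+ 2 + absK q ^+ 2.
pose y : ell2 n := p *: a + q *: b.
have xy : ell2_dot x y = of_real s.
  by rewrite ell2_dotDr !ell2_dotZr /s of_realD -!mul_scalar_conj !(mulrC (scalar_conj _)).
have yy : ell2_dot y y = of_real s.
  rewrite {1}/y ell2_dotDl !ell2_dotZl !ell2_dotDr !ell2_dotZr ab ba !ell2_dotxx a1 b1.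
  by rewrite expr1n of_real1 !mulr0 !mulr1 addr0 add0r /s of_realD -!mul_scalar_conj.
have : of_real (rnorm (x + (-1) *: y) ^+ 2) = of_real (rnorm x ^+ 2 - s).
  rewrite -ell2_dotxx ell2_dotDl !ell2_dotDr !ell2_dotZl !ell2_dotZr.
  rewrite (ell2_dotC y x) xy yy ell2_dotxx scalar_conj_real scalar_conjN scalar_conj1.
  by rewrite (of_realD k (rnorm x ^+ 2)) (of_realN k s); ring.
move=> /of_real_inj xys; rewrite -subr_ge0 -/s -xys; exact: sqr_ge0.
Qed.

Variable E : normedModType K.

(** Contact points of a contraction [(f, g)] to the plane, up to an error [e].
    Orthogonality is automatic: the contraction property makes [g u] and
    [f v] small when [f u] and [g v] are almost unimodular. *)
Definition contact_up_to (e : R) := exists (f g : dual_space E) (u v : E),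
  [/\ plane_contraction f g, rnorm u <= 1, rnorm v <= 1,
      1 - e <= absK (f u) & 1 - e <= absK (g v)].

Definition contact := contact_up_to 0.

(** The orthogonal projection to the plane spanned by [Q u] and [Q v] does not
    increase the norm, which reduces Euclidean spaces of every dimension to the
    plane. *)
Lemma plane_of_orthogonal n (Q : bounded_op E (ell2 n)) (u v : E) : rnorm Q <= 1 ->
  ell2_dot (Q u) (Q v) = 0 -> Q u != 0 -> Q v != 0 ->
  exists f g : dual_space E, [/\ plane_contraction f g,
    absK (f u) = rnorm (Q u) & absK (g v) = rnorm (Q v)].
Proof.
move=> Q1 uv u0 v0.
pose a : ell2 n := of_real (rnorm (Q u))^-1 *: Q u.
pose b : ell2 n := of_real (rnorm (Q v))^-1 *: Q v.
have a1 : rnorm a = 1 by exact: normalize.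
have b1 : rnorm b = 1 by exact: normalize.
have ab : ell2_dot a b = 0 by rewrite ell2_dotZl ell2_dotZr uv !mulr0.
have Qle x : rnorm (Q x) <= rnorm x.
  by rewrite (le_trans (le_opnorm Q x))// ler_piMl ?rnorm_ge0// -rnorm_bounded_op.
have bes x := bessel2 (Q x) a1 b1 ab.
have lin c : linear (fun x => ell2_dot (Q x) c : K^o).
  by move=> t x y; rewrite linearP ell2_dotDl ell2_dotZl.
have fb : exists M : R, forall x, absK (ell2_dot (Q x) a) <= M * rnorm x.
  exists 1 => x; rewrite mul1r (le_trans _ (Qle x))//.
  by rewrite -ler_sqr ?nnegrE ?rnorm_ge0// (le_trans _ (bes x))// lerDl sqr_ge0.
have gb : exists M : R, forall x, absK (ell2_dot (Q x) b) <= M * rnorm x.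
  exists 1 => x; rewrite mul1r (le_trans _ (Qle x))//.
  by rewrite -ler_sqr ?nnegrE ?rnorm_ge0// (le_trans _ (bes x))// lerDr sqr_ge0.
exists (make_bounded_op (lin a) fb), (make_bounded_op (lin b) gb); split => /=.
- by move=> x; rewrite /= (le_trans (bes x))// lerXn2r ?nnegrE ?rnorm_ge0.
- rewrite ell2_dotZr ell2_dotxx scalar_conj_real -of_realM rnorm_of_real expr2 mulKf.
    by rewrite ger0_norm ?rnorm_ge0.
  by rewrite gt_eqF// rnorm_gt0.
- rewrite ell2_dotZr ell2_dotxx scalar_conj_real -of_realM rnorm_of_real expr2 mulKf.
    by rewrite ger0_norm ?rnorm_ge0.
  by rewrite gt_eqF// rnorm_gt0.
Qed.

(** The value 0 covers the degenerate cases [Q u = 0] and [Q v = 0] as well as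
    the default value of [maximum]. *)
Lemma omega_perpP : omega_perp E = 0 \/ exists (f g : dual_space E) (u v : E),
  [/\ plane_contraction f g, rnorm u <= 1, rnorm v <= 1, 0 <= omega_perp E &
      omega_perp E <= absK (f u) /\ omega_perp E <= absK (g v)].
Proof.
rewrite /omega_perp /maximum.
case: xgetP => [_ _ [[Q [u [v [Q1 u1 v1 uv ->]]]] _]|]; last by left.
have [u0|u0] := eqVneq (Q u) 0.
  by left; rewrite u0 rnorm0 minEle rnorm_ge0.
have [v0|v0] := eqVneq (Q v) 0.
  by left; rewrite v0 rnorm0 minC minEle rnorm_ge0.
right; have [f [g [fg fu gv]]] := plane_of_orthogonal Q1 uv u0 v0.
exists f, g, u, v; rewrite u1 v1 le_min !rnorm_ge0 fu gv; split=> //.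
by rewrite !ge_min !lexx orbT.
Qed.

Lemma OCP_contact : OCP E -> contact.
Proof.
rewrite /OCP => E1; case: omega_perpP; rewrite E1.
  by move=> /eqP; rewrite oner_eq0.
move=> [f [g [u [v [fg u1 v1 _ [fu gv]]]]]].
by exists f, g, u, v; rewrite subr0; split.
Qed.

(** At a contact point the contraction property leaves no room for the other
    coordinate. *)
Lemma contact_point (f g : dual_space E) (u : E) : plane_contraction f g ->
  rnorm u <= 1 -> 1 <= absK (f u) ->
  [/\ rnorm u = 1, absK (f u) = 1 & (g u : K) = 0].
Proof.
move=> fg u1 fu; have fle : absK (f u) <= rnorm u.
  by rewrite -ler_sqr ?nnegrE ?rnorm_ge0// (le_trans _ (fg u))// lerDl sqr_ge0.
have u1' : rnorm u = 1 by apply/eqP; rewrite eq_le u1 (le_trans fu).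
have fu1 : absK (f u) = 1 by apply/eqP; rewrite eq_le fu -u1' fle.
split=> //; apply: absK_eq0; apply/eqP; rewrite -sqrf_eq0 eq_le sqr_ge0 andbT.
by have := fg u; rewrite fu1 u1' expr1n gerDl.
Qed.

(** In dimension at least 2 the plane is spanned by two coordinates of the
    Euclidean space in the definition of [omega_perp]. *)
Lemma contact_OCP : (2 <= dimension E)%N -> contact -> OCP E.
Proof.
move=> d2 [f [g [u [v [fg u1 v1]]]]]; rewrite subr0 => fu gv.
have d0 : (0 < dimension E)%N by exact: ltn_trans d2.
pose i0 := Ordinal d0; pose i1 := Ordinal d2.
pose q (x : E) : ell2 (dimension E) := \row_i (if i == i0 then f x else if i == i1 then g x else 0).
have ql : linear q.
  move=> a x y; apply/rowP => i; rewrite !mxE !linearP /=.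
  by case: ifP => // _; case: ifP => // _; rewrite mulr0 addr0.
have qn x : rnorm (q x) ^+ 2 = absK (f x) ^+ 2 + absK (g x) ^+ 2.
  rewrite sqr_rnorm_ell2 (bigD1 i0)//= (bigD1 i1)//= big1 ?addr0.
    by rewrite !mxE eqxx.
  by move=> i /andP[/negbTE i0' /negbTE i1']; rewrite mxE i0' i1' rnorm0 expr0n.
have qle x : rnorm (q x) <= rnorm x.
  by rewrite -ler_sqr ?nnegrE ?rnorm_ge0// qn.
have qb : exists M : R, forall x, rnorm (q x) <= M * rnorm x.
  by exists 1 => x; rewrite mul1r.
pose Q := make_bounded_op ql qb.
have Q1 : rnorm Q <= 1.
  by rewrite rnorm_bounded_op; apply: opnorm_le => x x1; exact: le_trans (qle x) x1.
have [u1' fu1 gu] := contact_point fg u1 fu.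
have gf : plane_contraction g f by move=> x; rewrite addrC; exact: fg.
have [v1' gv1 fv] := contact_point gf v1 gv.
have Qu1 : rnorm (Q u) = 1.
  apply/eqP; rewrite -(@eqrXn2 _ 2) ?rnorm_ge0// (qn u) gu fu1 (@rnorm0 R k K^o).
  by rewrite expr0n addr0.
have Qv1 : rnorm (Q v) = 1.
  apply/eqP; rewrite -(@eqrXn2 _ 2) ?rnorm_ge0// (qn v) fv gv1 (@rnorm0 R k K^o).
  by rewrite expr0n add0r.
rewrite /OCP /omega_perp; set A := [set r | _].
have A1 : A 1.
  exists Q, u, v; split=> //; last by rewrite Qu1 Qv1 minxx.
  rewrite /ell2_dot big1// => i _; rewrite !mxE fv.
  by case: ifP => _; [rewrite scalar_conj0 mulr0|case: ifP; rewrite ?gu mul0r].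
have ub1 : ubound A 1.
  move=> _ [Q' [u' [v' [Q'1 u'1 v'1 _ ->]]]]; rewrite ge_min.
  by rewrite (le_trans (le_opnorm1 Q' (_ : rnorm u' <= 1)))// ?u'1 -?rnorm_bounded_op.
apply: xget_unique => // r [rA rub]; apply/eqP.
by rewrite eq_le (ub1 _ rA) (rub _ A1).
Qed.

End Contact.

Section ContactLimit.
Variables (R : realType) (k : scalar_kind).
Local Notation K := (scalars R k).
Local Notation of_real := (of_real k).
Local Notation ell2 := (ell2 R k).

Lemma bounded_op_sum (E Z : normedModType K) I (r : seq I) (P : pred I)
    (F : I -> bounded_op E Z) x :
  (\sum_(i <- r | P i) F i) x = \sum_(i <- r | P i) F i x.
Proof. by apply: (big_morph (fun S : bounded_op E Z => S x)). Qed.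

Lemma bounded_opZ (E Z : normedModType K) a (S : bounded_op E Z) x :
  (a *: S) x = a *: S x.
Proof. by []. Qed.

Lemma dual_basis (E : normedModType K) n : has_dim E n ->
  exists (b : 'I_n -> E) (b' : 'I_n -> dual_space E),
    (forall x, x = \sum_i (b' i x : K) *: b i) /\
    forall i j, (b' i (b j) : K) = (i == j)%:R.
Proof.
move=> En; have [f [g fK gK]] := En.
have lg : linear (g : ell2 n -> E) by apply: can2_linear fK gK.
have [L LE] := linear_bundle lg.
have fi_linear i : linear (fun x => f x ord0 i : K^o).
  by move=> a x y; rewrite linearP !mxE.
have fi_bounded i : exists M : R, forall x, absK (f x ord0 i) <= M * rnorm x.
  by apply: (@finite_dim_linear_bounded R k E K^o); [exists n|exact: fi_linear].
exists (fun i => g (delta_mx ord0 i)), (fun i => make_bounded_op (fi_linear i) (fi_bounded i)).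
split=> [x|i j] /=; last by rewrite gK mxE eqxx eq_sym.
transitivity (L (\sum_i f x ord0 i *: (delta_mx ord0 i : ell2 n))).
  by rewrite -ell2_sum_delta LE fK.
by rewrite linear_sum; apply: eq_bigr => i _; rewrite linearZ /= LE.
Qed.

Lemma dual_has_dim (E : normedModType K) n : has_dim E n -> has_dim (dual_space E) n.
Proof.
move=> /dual_basis[b [b' [bE bb]]].
have [L LE] : exists L : {linear ell2 n -> dual_space E},
    L = (fun c : ell2 n => \sum_i c ord0 i *: b' i) :> (_ -> _).
  apply: linear_bundle => a x y; rewrite scaler_sumr -big_split /=.
  by apply: eq_bigr => i _; rewrite !mxE scalerDl scalerA.
have LbE c j : (L c (b j) : K) = c ord0 j.
  rewrite LE bounded_op_sum (eq_bigr (fun i => c ord0 i * (i == j)%:R)); last first.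
    by move=> i _; rewrite bounded_opZ -bb.
  rewrite (bigD1 j)//= big1 ?addr0 ?eqxx ?mulr1//.
  by move=> i /negbTE ->; rewrite mulr0.
apply: (linear_inj_surj_has_dim (L := L)).
  by move=> c d cd; apply/rowP => j; rewrite -!LbE cd.
move=> f; exists (\row_i (f (b i) : K)); apply/val_inj/funext => x.
rewrite /= {1 2}(bE x) !linear_sum; apply: eq_bigr => i _.
by rewrite !linearZ; congr (_ *: _); rewrite [RHS]LbE mxE.
Qed.

Variable E : normedModType K.

Lemma sqr_continuous : continuous (fun x : R => x ^+ 2).
Proof.
rewrite (_ : (fun x : R => _) = (fun x => x * x)); first by move=> x; apply: cvgM; exact: cvg_id.
by apply/funext => x; rewrite expr2.
Qed.

Lemma norm_eval_continuous :
  continuous (fun p : dual_space E * E => absK (p.1 p.2)).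
Proof.
move=> [f0 u0]; apply/cvgrPdist_lt => e e0.
pose c := opnorm f0 + rnorm u0 + 1.
have c0 : 0 < c by rewrite ltr_wpDl// addr_ge0 ?opnorm_ge0 ?rnorm_ge0.
have [d [d0 d1 dc]] : exists d : R, [/\ 0 < d, d <= 1 & d * c <= e].
  exists (Num.min 1 (e / c)); split; last by rewrite -ler_pdivlMr// ge_min lexx orbT.
    by rewrite lt_min ltr01 divr_gt0.
  by rewrite ge_min lexx.
exists ([set f | rnorm (f0 - f) < d], [set u | rnorm (u0 - u) < d]).
  by split; apply: nbhs_rnorm; exists d.
move=> [f u] [/= fd ud].
apply: le_lt_trans (@ler_rnorm_dist R k K^o _ _) _.
have -> : f0 u0 - f u = f0 (u0 - u) + (f0 - f) u.
  by rewrite linearB bounded_opB addrA subrK.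
apply: le_lt_trans (ler_rnormD _ _) _.
have h1 := le_opnorm f0 (u0 - u); have h2 := le_opnorm (f0 - f) u.
rewrite rnorm_bounded_op in fd.
have h3 : rnorm u <= rnorm u0 + 1.
  rewrite -lerBlDl (le_trans (ler_rnorm_sub _ _))// rnormB_sym.
  exact: le_trans (ltW ud) d1.
have h4 : opnorm f0 * rnorm (u0 - u) <= opnorm f0 * d.
  by rewrite ler_wpM2l ?opnorm_ge0 ?ltW.
have h5 : opnorm (f0 - f) * rnorm u <= opnorm (f0 - f) * (rnorm u0 + 1).
  by rewrite ler_wpM2l ?opnorm_ge0.
have h6 : opnorm (f0 - f) * (rnorm u0 + 1) < d * (rnorm u0 + 1).
  by rewrite ltr_pM2r// ltr_wpDl ?rnorm_ge0.
move: dc; rewrite /c; nra.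
Qed.

Lemma dual_eval_continuous (e : E) : continuous (fun f : dual_space E => absK (f e)).
Proof.
move=> f; have -> : (fun f : dual_space E => absK (f e)) =
    (fun p : dual_space E * E => absK (p.1 p.2)) \o (fun f => (f, e)) by [].
apply: continuous_comp; last exact: norm_eval_continuous.
by apply: (@cvg_pair _ _ _ (nbhs f) (nbhs f) (nbhs e) _ _ _ id (fun=> e)); [exact: cvg_id|exact: cvg_cst].
Qed.

(** Orthogonal contact points up to every positive error accumulate, by
    compactness of the unit balls of [E] and of its dual, at exact ones. *)
Lemma contact_limit : finite_dim E -> (forall e, 0 < e -> contact_up_to E e) -> contact E.
Proof.
move=> Efin approx; have Dfin : finite_dim (dual_space E).
  by case: Efin => n En; exists n; exact: dual_has_dim.
pose BE := [set x : E | rnorm x <= 1].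
pose BD := [set f : dual_space E | rnorm f <= 1].
have cB : compact ((BD `*` BE) `*` (BD `*` BE)).
  have c1 : compact (BD `*` BE).
    by apply: compact_setX; exact: finite_dim_ball_compact.
  exact: compact_setX.
pose T : topologicalType := ((dual_space E * E) * (dual_space E * E))%type.
pose C := [set p : T | forall e, absK (p.1.1 e) ^+ 2 + absK (p.2.1 e) ^+ 2 <= rnorm e ^+ 2].
have fst1 : continuous (fun p : T => p.1.1).
  by move=> p; apply: (@continuous_comp _ _ _ fst fst); exact: cvg_fst.
have fst2 : continuous (fun p : T => p.2.1).
  by move=> p; apply: (@continuous_comp _ _ _ snd fst); [exact: cvg_snd|exact: cvg_fst].
have closedC : closed C.
  rewrite (_ : C = \bigcap_(e in [set: E])
      [set p : T | absK (p.1.1 e) ^+ 2 + absK (p.2.1 e) ^+ 2 <= rnorm e ^+ 2]); last first.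
    by apply/seteqP; split=> p; [move=> Cp e _; exact: Cp|move=> Cp e; exact: (Cp e)].
  apply: closed_bigI => e _.
  rewrite -[X in closed X]/((fun p : T => absK (p.1.1 e) ^+ 2 + absK (p.2.1 e) ^+ 2)
     @^-1` [set y | y <= rnorm e ^+ 2]).
  apply: preimage_closed; last exact: closed_le.
  move=> p _; apply: (@cvgD R R^o).
    apply: (@continuous_comp _ _ _ (fun p : T => absK (p.1.1 e)) (fun x : R => x ^+ 2)).
      by apply: (@continuous_comp _ _ _ (fun p : T => p.1.1) (fun f : dual_space E => absK (f e)));
        [exact: fst1|exact: dual_eval_continuous].
    exact: sqr_continuous.
  apply: (@continuous_comp _ _ _ (fun p : T => absK (p.2.1 e)) (fun x : R => x ^+ 2)).
    by apply: (@continuous_comp _ _ _ (fun p : T => p.2.1) (fun f : dual_space E => absK (f e)));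
      [exact: fst2|exact: dual_eval_continuous].
  exact: sqr_continuous.
pose A := ((BD `*` BE) `*` (BD `*` BE)) `&` C.
have cA : compact A.
  by apply: compact_closedI.
have contraction_le (f g : dual_space E) : plane_contraction f g -> BD f /\ BD g.
  move=> fg; rewrite /BD /= !rnorm_bounded_op; split; apply: opnorm_le => e e1.
    by rewrite (le_trans _ e1)// -ler_sqr ?nnegrE ?rnorm_ge0// (le_trans _ (fg e))// lerDl sqr_ge0.
  by rewrite (le_trans _ e1)// -ler_sqr ?nnegrE ?rnorm_ge0// (le_trans _ (fg e))// lerDr sqr_ge0.
have approxA e : 0 < e -> exists p : T, A p /\ 1 - e <= Num.min (absK (p.1.1 p.1.2)) (absK (p.2.1 p.2.2)).
  move=> /approx[f [g [u [v [fg u1 v1 fu gv]]]]].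
  have [f1 g1] := contraction_le _ _ fg.
  by exists ((f, u), (g, v)); split; [|rewrite le_min fu gv].
pose h (p : T) : R := Num.min (absK (p.1.1 p.1.2)) (absK (p.2.1 p.2.2)).
have hc : continuous h.
  move=> p; apply: (@continuous_min R T).
    apply: (@continuous_comp _ _ _ (fst : T -> _) (fun q : dual_space E * E => absK (q.1 q.2))).
      exact: cvg_fst.
    exact: norm_eval_continuous.
  apply: (@continuous_comp _ _ _ (snd : T -> _) (fun q : dual_space E * E => absK (q.1 q.2))).
    exact: cvg_snd.
  exact: norm_eval_continuous.
have A0 : A !=set0 by have [p [Ap _]] := approxA 1 ltr01; exists p.
have [p /set_mem Ap pmax] := compact_EVT_max A0 cA (continuous_subspaceT hc).
have p1 : 1 <= h p.
  apply/ler_addgt0Pr => e e0; have [p' [Ap' p'1]] := approxA e e0.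
  by rewrite -lerBlDr (le_trans p'1)// pmax// inE.
case: p Ap {pmax} p1 => -[f u] [g v] /= [[[/= f1 u1] [/= g1 v1]] fg].
rewrite /h /= le_min => /andP[fu gv].
by exists f, g, u, v; rewrite subr0.
Qed.

End ContactLimit.

(** * Operators into a Hilbert space, and completions *)

Section HilbertRange.
Variables (R : realType) (k : scalar_kind).
Local Notation K := (scalars R k).
Local Notation of_real := (of_real k).

Definition parallelogram (H : normedModType K) := forall x y : H,
  rnorm (x + y) ^+ 2 + rnorm (x - y) ^+ 2 = 2%:R * (rnorm x ^+ 2 + rnorm y ^+ 2).

Lemma hilbert_parallelogram (H : normedModType K) : is_hilbert H -> parallelogram H.
Proof.
move=> [ip [ipl ipC ipn]] x y.
have ipD u v w : ip (u + v) w = ip u w + ip v w.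
  by have := ipl w 1 u v; rewrite scale1r mul1r.
have ipNy u w : ip (- u) w = - ip u w.
  have ip0 : ip 0 w = 0 by apply: (addrI (ip 0 w)); rewrite -ipD !addr0.
  by apply/eqP; rewrite -addr_eq0 -ipD addNr ip0.
have ipDr u v w : ip w (u + v) = ip w u + ip w v.
  by rewrite (ipC (u + v)) ipD scalar_conjD -!ipC.
have ipNr u w : ip w (- u) = - ip w u by rewrite (ipC (- u)) ipNy scalar_conjN -ipC.
have ipxx u : of_real (rnorm u ^+ 2) = ip u u.
  by rewrite ipn expr2 of_realM of_real_rnorm -expr2.
apply: (@of_real_inj R k).
rewrite mulr_natl mulr2n !of_realD !ipxx !(ipD, ipDr, ipNy, ipNr); ring.
Qed.

Lemma bounded_op_ext (E Z : normedModType K) (S T : bounded_op E Z) :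
  (forall x, S x = T x) -> S = T.
Proof. by move=> ST; apply/val_inj/funext. Qed.

Lemma opnorm_approx (E Z : normedModType K) (T : bounded_op E Z) (r : R) :
  r < rnorm T -> exists2 u, rnorm u <= 1 & r < rnorm (T u).
Proof.
rewrite rnorm_bounded_op => rT.
have e0 : 0 < opnorm T - r by rewrite subr_gt0.
have [_ [u /= u1 <-]] := sup_adherent e0 (opnorm_has_sup T).
by rewrite subKr; exists u.
Qed.

Lemma plane_functionals (E : normedModType K) (a b : E -> K^o) : linear a -> linear b ->
  (forall x, absK (a x) ^+ 2 + absK (b x) ^+ 2 <= rnorm x ^+ 2) ->
  exists f g : dual_space E, [/\ plane_contraction f g, f = a :> (E -> K^o) & g = b :> (E -> K^o)].
Proof.
move=> la lb ab.
have fb : exists M : R, forall x, absK (a x) <= M * rnorm x.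
  by exists 1 => x; rewrite mul1r -ler_sqr ?nnegrE ?rnorm_ge0// (le_trans _ (ab x))// lerDl sqr_ge0.
have gb : exists M : R, forall x, absK (b x) <= M * rnorm x.
  by exists 1 => x; rewrite mul1r -ler_sqr ?nnegrE ?rnorm_ge0// (le_trans _ (ab x))// lerDr sqr_ge0.
by exists (make_bounded_op la fb), (make_bounded_op lb gb).
Qed.

Lemma half_sqr (r : R) (z : K) : r ^+ 2 * absK z ^+ 2 = absK (of_real r * z) ^+ 2.
Proof. by rewrite absKM rnorm_of_real exprMn real_normK ?num_real. Qed.

(** By the parallelogram law, [|(S + T) x| ^ 2 + |(S - T) x| ^ 2] is at most
    [4 |x| ^ 2]; hence functionals of norm 1 that norm [(S + T) u] and
    [(S - T) v] give a contraction to the plane. *)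
Lemma contact_of_operators (E H : normedModType K) : parallelogram H ->
  almost_square (@rnorm R k (bounded_op E H)) -> forall e, 0 < e -> contact_up_to E e.
Proof.
move=> par sq e e0; have [S [T [S1 T1 p m]]] := sq e e0.
have lt2 : 2%:R - 2%:R * e < 2%:R - e by lra.
have [u u1 up] := opnorm_approx (lt_le_trans lt2 p).
have [v v1 vm] := opnorm_approx (lt_le_trans lt2 m).
have [F [F1 Fu]] := norming_functional ((S + T) u).
have [G [G1 Gv]] := norming_functional ((S - T) v).
pose h : R := 2%:R^-1.
have [|||f [g [fg fE gE]]] := @plane_functionals E
  (fun x => of_real h * F ((S + T) x)) (fun x => of_real h * G ((S - T) x)).
- by move=> a x y; rewrite !linearP /= mulrDr mulrCA.
- by move=> a x y; rewrite !linearP /= mulrDr mulrCA.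
- move=> x; rewrite -!half_sqr -mulrDr.
  have nx (A : bounded_op E H) : rnorm A <= 1 -> rnorm (A x) ^+ 2 <= rnorm x ^+ 2.
    move=> A1; rewrite lerXn2r ?nnegrE ?rnorm_ge0// (le_trans (le_opnorm A x))//.
    by rewrite ler_piMl ?rnorm_ge0// -rnorm_bounded_op.
  have FS : absK (F ((S + T) x)) ^+ 2 <= rnorm ((S + T) x) ^+ 2.
    by rewrite lerXn2r ?nnegrE ?rnorm_ge0.
  have GS : absK (G ((S - T) x)) ^+ 2 <= rnorm ((S - T) x) ^+ 2.
    by rewrite lerXn2r ?nnegrE ?rnorm_ge0.
  have := par (S x) (T x); rewrite -bounded_opD -bounded_opB.
  have := nx _ S1; have := nx _ T1; rewrite /h; lra.
exists f, g, u, v; split => //.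
  rewrite fE Fu -of_realM rnorm_of_real ger0_norm ?mulr_ge0 ?rnorm_ge0 ?invr_ge0//.
  by rewrite /h; move: up; lra.
rewrite gE Gv -of_realM rnorm_of_real ger0_norm ?mulr_ge0 ?rnorm_ge0 ?invr_ge0//.
by rewrite /h; move: vm; lra.
Qed.

Lemma operators_contact (E Z : normedModType K) : ~ finite_dim Z -> contact E ->
  CNJ (bounded_op E Z) = 2%:R.
Proof.
move=> infZ [f [g [u [v [fg u1 v1]]]]]; rewrite subr0 => fu gv.
apply/eqP; rewrite eq_le CNJ_le2 /=.
by have := CNJ_operators_ge infZ fg u1 v1 ler01 fu gv; rewrite expr1n mulr1.
Qed.

Section RankOne.
Variables E Z : normedModType K.

(** The operator [pair_op phi 0 z 0] is the rank-one operator
    [e |-> phi e *: z]. *)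
Lemma rank_one_norm (phi : dual_space E) (z : Z) :
  rnorm (pair_op phi 0 z 0) = rnorm phi * rnorm z.
Proof.
have ev e : pair_op phi 0 z 0 e = (phi e : K) *: z by rewrite /= scaler0 addr0.
apply/eqP; rewrite eq_le !rnorm_bounded_op; apply/andP; split.
  apply: opnorm_le => e e1; rewrite ev rnormZ.
  by rewrite ler_wpM2r ?rnorm_ge0 ?le_opnorm1.
have [->|z0] := eqVneq z 0; first by rewrite rnorm0 mulr0 opnorm_ge0.
rewrite -ler_pdivlMr ?rnorm_gt0//; apply: opnorm_le => e e1.
by rewrite ler_pdivlMr ?rnorm_gt0// -rnormZ -ev le_opnorm1.
Qed.

Lemma CNJ_range_le (phi : dual_space E) : phi != 0 -> CNJ Z <= CNJ (bounded_op E Z).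
Proof.
move=> phi0; apply: (@CNJ_isometry _ _ _ _ (rnorm phi) (fun z => pair_op phi 0 z 0)).
- exact: rnorm_gt0.
- move=> x y; apply: bounded_op_ext => e.
  by rewrite bounded_opD /= !scaler0 !addr0 scalerDr.
- move=> x y; apply: bounded_op_ext => e.
  by rewrite bounded_opB /= !scaler0 !addr0 scalerBr.
- by move=> z; exact: rank_one_norm.
Qed.

Lemma CNJ_dual_le (z : Z) : z != 0 -> CNJ (dual_space E) <= CNJ (bounded_op E Z).
Proof.
move=> z0; apply: (@CNJ_isometry _ _ _ _ (rnorm z) (fun phi => pair_op phi 0 z 0)).
- exact: rnorm_gt0.
- move=> x y; apply: bounded_op_ext => e.
  by rewrite bounded_opD /= !scaler0 !addr0 scalerDl.
- move=> x y; apply: bounded_op_ext => e.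
  by rewrite bounded_opB /= !scaler0 !addr0 scalerBl.
- by move=> phi; rewrite rank_one_norm mulrC.
Qed.

End RankOne.

End HilbertRange.

Section CompletionSquare.
Variables (R : realType) (k : scalar_kind).
Local Notation K := (scalars R k).
Local Notation of_real := (of_real k).
Variables (V : lmodType K) (p : seminorm V).

(** Approximants from the dense subspace within [e / 8] have norms at most
    [1 + e / 8], and are divided by this number. *)
Lemma almost_square_completion :
  almost_square (@rnorm R k (completion p)) <-> almost_square p.
Proof.
split=> sq e e0; last first.
  have [x [y [x1 y1 xp xm]]] := sq e e0.
  exists (to_completion p x), (to_completion p y).
  by rewrite -linearD -linearB !rnorm_to_completion.
pose d := e / 8%:R; have d0 : 0 < d by rewrite divr_gt0.
have [x [y [x1 y1 xp xm]]] := sq d d0.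
have [v vx] := to_completion_dense x d0; have [w wy] := to_completion_dense y d0.
pose c : R := (1 + d)^-1.
have d1 : 0 < 1 + d by rewrite addr_gt0.
have c0 : 0 < c by rewrite invr_gt0.
have pc z : p (of_real c *: z) = c * p z by rewrite seminormZ rnorm_of_real gtr0_norm.
have cd : c * (1 + d) = 1 by rewrite mulVf// gt_eqF.
exists (of_real c *: v), (of_real c *: w).
rewrite -scalerDr -scalerBr !pc -!rnorm_to_completion.
set V' := to_completion p v in vx *; set W' := to_completion p w in wy *.
rewrite linearD linearB -/V' -/W'.
have vle : rnorm V' <= 1 + d.
  have := ler_rnorm_sub V' x; rewrite rnormB_sym; lra.
have wle : rnorm W' <= 1 + d.
  have := ler_rnorm_sub W' y; rewrite rnormB_sym; lra.
have ple : 2%:R - 3%:R * d <= rnorm (V' + W').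
  have := ler_rnorm_sub (x + y) (V' + W').
  rewrite opprD addrACA; have := ler_rnormD (x - V') (y - W'); lra.
have mle : 2%:R - 3%:R * d <= rnorm (V' - W').
  have := ler_rnorm_sub (x - y) (V' - W').
  have -> : x - y - (V' - W') = (x - V') - (y - W').
    rewrite !opprB [LHS]addrACA [RHS]addrACA; congr (_ + _); exact: addrC.
  have := ler_rnormD (x - V') (- (y - W')); rewrite rnormN; lra.
have ed : e = 8%:R * d by rewrite /d [RHS]mulrC divfK// pnatr_eq0.
have fin r : 2%:R - 3%:R * d <= r -> 2%:R - e <= c * r.
  move=> h; have -> : 2%:R - e = c * ((2%:R - e) * (1 + d)) by rewrite mulrCA cd mulr1.
  rewrite ler_pM2l//.
  apply: le_trans h; rewrite ed; have := sqr_ge0 d; nra.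
split; [| | exact: fin | exact: fin].
  by rewrite -cd ler_pM2l.
by rewrite -cd ler_pM2l.
Qed.

End CompletionSquare.

(** * Injective tensor products *)

Section InjectiveTensor.
Variables (R : realType) (k : scalar_kind).
Local Notation K := (scalars R k).
Local Notation of_real := (of_real k).
Variables X Y : normedModType K.
Implicit Types s t : seq (X * Y).

Lemma tensor_op_linear s :
  linear (fun g : dual_space Y => \sum_(xy <- s) (g xy.2 : K) *: xy.1 : X).
Proof.
move=> a g h; rewrite scaler_sumr -big_split; apply: eq_bigr => xy _.
by rewrite bounded_opD bounded_opZ scalerDl scalerA.
Qed.

Lemma tensor_op_bounded s : exists M : R, forall g : dual_space Y,
  rnorm (\sum_(xy <- s) (g xy.2 : K) *: xy.1 : X) <= M * rnorm g.
Proof.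
exists (\sum_(xy <- s) rnorm xy.2 * rnorm xy.1) => g.
rewrite (le_trans (ler_rnorm_sum _ _ _))// mulr_suml; apply: ler_sum => xy _.
rewrite rnormZ mulrAC ler_wpM2r ?rnorm_ge0// mulrC rnorm_bounded_op.
exact: le_opnorm.
Qed.

(** The operator from the dual of [Y] to [X] represented by a tensor. *)
Definition tensor_op s : bounded_op (dual_space Y) X :=
  make_bounded_op (@tensor_op_linear s) (tensor_op_bounded s).

Lemma tensor_op_cat s t : tensor_op (s ++ t) = tensor_op s + tensor_op t.
Proof. by apply: bounded_op_ext => g; rewrite bounded_opD /= big_cat. Qed.

Lemma tensor_op_scale a s : tensor_op (scale_seq a s) = a *: tensor_op s.
Proof.
apply: bounded_op_ext => g; rewrite bounded_opZ /= big_map scaler_sumr.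
by apply: eq_bigr => xy _; rewrite !scalerA mulrC.
Qed.

Lemma sum_tensorB s t :
  sum_tensor s - sum_tensor t = sum_tensor (s ++ scale_seq (-1) t).
Proof. by rewrite sum_tensor_cat sum_tensor_scale scaleN1r. Qed.

Lemma tensor_opB s t : tensor_op s - tensor_op t = tensor_op (s ++ scale_seq (-1) t).
Proof. by rewrite tensor_op_cat tensor_op_scale scaleN1r. Qed.

Lemma pair_sum_op (f : dual_space X) (g : dual_space Y) s :
  pair_sum f g s = f (tensor_op s g).
Proof.
rewrite /= linear_sum; apply: eq_bigr => xy _.
by rewrite linearZ /= mulrC.
Qed.

(** By the Hahn-Banach theorem, the supremum over the functionals on [X] in the
    definition of the injective norm is the norm of a vector of [X]. *)
Lemma injective_opnorm s : injective_fun (sum_tensor s) = rnorm (tensor_op s).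
Proof.
rewrite rnorm_bounded_op; apply/eqP; rewrite eq_le; apply/andP; split.
  apply: injective_le => f g f1 g1; rewrite pair_sum_op.
  rewrite (le_trans (le_opnorm f _))// (le_trans _ (le_opnorm1 _ g1))//.
  by rewrite ler_piMl ?rnorm_ge0// -rnorm_bounded_op.
apply: opnorm_le => g g1.
have [f [f1 fg]] := norming_functional (tensor_op s g).
have f1' : rnorm f <= 1.
  by rewrite rnorm_bounded_op; apply: opnorm_le => x x1; exact: le_trans (f1 x) x1.
have := le_injective s f1' g1; rewrite pair_sum_op fg rnorm_of_real.
by rewrite ger0_norm ?rnorm_ge0.
Qed.

Lemma tensor_op_surj : finite_dim Y ->
  forall T : bounded_op (dual_space Y) X, exists s, T = tensor_op s.
Proof.
move=> [n /dual_basis[b [b' [bE _]]]] T.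
exists [seq (T (b' i), b i) | i <- index_enum 'I_n].
apply: bounded_op_ext => g; rewrite /= big_map /=.
have gE : g = \sum_i (g (b i) : K) *: b' i.
  apply: bounded_op_ext => y; rewrite bounded_op_sum {1}(bE y) linear_sum.
  by apply: eq_bigr => i _; rewrite linearZ bounded_opZ; exact: mulrC.
by rewrite {1}gE linear_sum; apply: eq_bigr => i _; rewrite linearZ.
Qed.

Lemma injective_square : finite_dim Y -> almost_square (injective_norm X Y) <->
  almost_square (@rnorm R k (bounded_op (dual_space Y) X)).
Proof.
move=> Yfin; split=> sq e e0; have [w1 [w2 []]] := sq e e0.
  have [s ->] := sum_tensor_surj w1; have [t ->] := sum_tensor_surj w2.
  rewrite sum_tensorB -sum_tensor_cat /= !injective_opnorm => *.
  by exists (tensor_op s), (tensor_op t); rewrite tensor_opB -tensor_op_cat.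
have [s ->] := tensor_op_surj Yfin w1; have [t ->] := tensor_op_surj Yfin w2.
rewrite tensor_opB -tensor_op_cat -!injective_opnorm => *.
by exists (sum_tensor s), (sum_tensor t); rewrite sum_tensorB -sum_tensor_cat.
Qed.

End InjectiveTensor.

(** * Projective tensor products *)

Section ProjectiveTensor.
Variables (R : realType) (k : scalar_kind).
Local Notation K := (scalars R k).
Local Notation of_real := (of_real k).
Local Notation ell2 := (ell2 R k).

(** Functionals spanning the dual space of [X] separate the points of [X], by
    the Hahn-Banach theorem, and thus embed [X] in a space of rows. *)
Lemma dual_infinite_dim (X : normedModType K) : ~ finite_dim X -> ~ finite_dim (dual_space X).
Proof.
move=> infX [n /dual_basis[b [b' [bE _]]]].
have [L injL] := infinite_dim_linear_inj infX n.+1.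
have [M ME] : exists M : {linear 'rV[K]_n.+1 -> 'rV[K]_n},
    M = (fun c => \row_i (b i (L c) : K)) :> (_ -> _).
  by apply: linear_bundle => a c d; apply/rowP => i; rewrite !mxE !linearP.
suff : injective M by move/linear_inj_leq; rewrite ltnn.
apply: raddf_inj => c Mc0; have {}Mc0 : M c = 0 by [].
have [f [_ fL]] := norming_functional (L c).
have : (f (L c) : K) = 0.
  rewrite (bE f) bounded_op_sum big1// => i _; rewrite bounded_opZ.
  have -> : b i (L c) = M c ord0 i by rewrite ME mxE.
  by rewrite Mc0 mxE scaler0.
rewrite fL -(of_real0 R k) => /of_real_inj/rnorm0_eq0 Lc0.
by apply: injL; rewrite linear0.
Qed.

Section Elementary.
Variables X Y : normedModType K.
Implicit Types (x : X) (y : Y).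

Lemma tensorD (w w' : tensor X Y) B : (w + w') B = w B + w' B.
Proof. by []. Qed.

Lemma tensorZ a (w : tensor X Y) B : (a *: w) B = a *: w B.
Proof. by []. Qed.

Lemma elementaryE x y B : sum_tensor [:: (x, y)] B = B x y.
Proof. by rewrite /= /sum_eval big_seq1. Qed.

Definition elementary x y : tensor X Y := sum_tensor [:: (x, y)].

Lemma elementary_linear_l y : linear (elementary^~ y).
Proof.
move=> a x x'; apply/val_inj/funext => B; rewrite /= /sum_eval !fctE big_seq1 /=.
by rewrite !big_seq1 /= linearPl.
Qed.

Lemma elementary_linear_r x : linear (elementary x).
Proof.
move=> a y y'; apply/val_inj/funext => B; rewrite /= /sum_eval !fctE big_seq1 /=.
by rewrite !big_seq1 /= linearPr.
Qed.

Lemma elementary_norm x y : projective_norm X Y (elementary x y) <= rnorm x * rnorm y.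
Proof. by rewrite (le_trans (projective_le _))// big_seq1. Qed.

Lemma sum_tensorE (s : seq (X * Y)) : sum_tensor s = \sum_(xy <- s) elementary xy.1 xy.2.
Proof.
elim: s => [|xy s IH].
  by rewrite big_nil; apply/val_inj/funext => B; rewrite /= /sum_eval big_nil.
by rewrite big_cons -IH -sum_tensor_cat; case: xy.
Qed.

(** The projective norm is the largest norm that is at most [|x| |y|] on
    elementary tensors. *)
Lemma projective_bound (Phi : tensor X Y -> K^o) (c : R) : 0 < c -> linear Phi ->
  (forall x y, absK (Phi (elementary x y)) <= c * (rnorm x * rnorm y)) ->
  forall w, absK (Phi w) <= c * projective_norm X Y w.
Proof.
move=> c0 Phil Phic w; rewrite -ler_pdivrMl//.
apply: lb_le_inf; first by case: (projective_has_inf w).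
move=> _ [s -> <-]; rewrite ler_pdivrMl// sum_tensorE.
have [L LE] := linear_bundle Phil.
rewrite -LE linear_sum (le_trans (ler_rnorm_sum _ _ _))// mulr_sumr.
by apply: ler_sum => xy _; rewrite LE.
Qed.

Lemma projective_bound_unit (Phi : tensor X Y -> K^o) (c : R) : 0 < c -> linear Phi ->
  (forall x y, rnorm x <= 1 -> rnorm y <= 1 -> absK (Phi (elementary x y)) <= c) ->
  forall w, absK (Phi w) <= c * projective_norm X Y w.
Proof.
move=> c0 Phil Phic; have [L LE] := linear_bundle Phil.
have Phi0 : Phi 0 = 0 by rewrite -LE linear0.
have PhiZ a w : Phi (a *: w) = a *: Phi w by rewrite -LE linearZ.
apply: projective_bound => // x y.
have [ex exE] := linear_bundle (@elementary_linear_r x).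
have [->|y0] := eqVneq y 0.
  by rewrite -exE linear0 Phi0 !rnorm0 !mulr0.
have [ey eyE] := linear_bundle (@elementary_linear_l y).
have [->|x0] := eqVneq x 0.
  by rewrite -[elementary 0 y]/((elementary^~ y) 0) -eyE linear0 Phi0 !rnorm0 mul0r mulr0.
have := Phic (of_real (rnorm x)^-1 *: x) (of_real (rnorm y)^-1 *: y).
rewrite !normalize// => /(_ (lexx 1) (lexx 1)).
have [eu euE] := linear_bundle (@elementary_linear_r (of_real (rnorm x)^-1 *: x)).
rewrite -euE linearZ euE /= -[elementary (_ *: x) y]/((elementary^~ y) (_ *: x)).
rewrite -eyE linearZ eyE /= !PhiZ !rnormZ_real ?invr_ge0 ?rnorm_ge0//.
by rewrite !ler_pdivrMl ?rnorm_gt0// mulrA mulrC.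
Qed.

End Elementary.

(** An almost Euclidean pair of functionals on [X] yields two bilinear forms
    [alpha f + beta g] and [alpha f - beta g] of norm almost 1, which norm
    the sum and the difference of [x (x) u] and [x' (x) v]. *)
Lemma projective_square (X Y : normedModType K) : ~ finite_dim X -> contact Y ->
  almost_square (projective_norm X Y).
Proof.
move=> infX [f [g [u [v [fg u1 v1]]]]]; rewrite subr0 => fu gv.
have gf : plane_contraction g f by move=> x; rewrite addrC; exact: fg.
have [_ fu1 gu] := contact_point fg u1 fu.
have [_ gv1 fv] := contact_point gf v1 gv.
move=> e e0; have [d d0 de] : exists2 d : R, 0 < d & e = 4%:R * d.
  by exists (e / 4%:R); rewrite ?divr_gt0// [RHS]mulrC divfK// pnatr_eq0.
have q1 : 1 < 1 + d by rewrite ltrDl.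
have q0 : 0 < 1 + d by exact: lt_trans q1.
have [al [be [al1 be1 ab]]] := almost_euclidean_pair (dual_infinite_dim infX) q1.
have large (c : dual_space X) (t : K) : 1 <= rnorm c -> absK t = 1 ->
    exists x, [/\ rnorm x <= 1, 1 - d <= absK (c x) & (c x : K) * t = of_real (absK (c x))].
  move=> c1 t1; have [|x x1 cx] := @opnorm_approx _ _ _ _ c (1 - d).
    by apply: lt_le_trans c1; rewrite gtrDl oppr_lt0.
  have [a [a1 acx]] := phase ((c x : K) * t).
  have cax : (c (a *: x) : K) = a * c x by rewrite linearZ.
  exists (a *: x); rewrite rnormZ cax absKM a1 !mul1r; split; [exact: x1|exact: ltW|].
  by rewrite -[LHS](mulrA a) acx absKM t1 mulr1.
have [x [x1 alx alxf]] := large al (f u) al1 fu1.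
have [x' [x'1 bex bexg]] := large be (g v) be1 gv1.
pose w1 := elementary x u; pose w2 := elementary x' v.
have w_le1 z y : rnorm z <= 1 -> rnorm y <= 1 -> projective_norm X Y (elementary z y) <= 1.
  move=> z1 y1; apply: le_trans (elementary_norm z y) _.
  by rewrite -[leRHS]mulr1 ler_pM ?rnorm_ge0.
have bnd (s : K) : absK s = 1 -> forall w : tensor X Y,
    absK (w (tensor_form al f) + s * w (tensor_form be g)) <= (1 + d) * projective_norm X Y w.
  move=> s1; apply: projective_bound => //.
    move=> a w w'.
    have distr (c1 c2 d1 d2 : K) :
      a * c1 + c2 + s * (a * d1 + d2) = a * (c1 + s * d1) + (c2 + s * d2) by ring.
    rewrite !tensorD !tensorZ; exact: distr.
  move=> z y; rewrite /elementary !elementaryE /= /tensor_form.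
  have -> : (al z * f y + s * (be z * g y) : K) = ((f y : K) *: al + (s * g y) *: be) z.
    by rewrite bounded_opD !bounded_opZ mulrC (mulrC (be z)) mulrA.
  apply: le_trans (le_opnorm _ _) _.
  rewrite mulrCA mulrC ler_wpM2l ?rnorm_ge0// -rnorm_bounded_op.
  rewrite -ler_sqr ?nnegrE ?mulr_ge0 ?rnorm_ge0 ?(ltW q0)// exprMn.
  apply: le_trans (ab _ _) _; rewrite ler_wpM2l ?sqr_ge0//.
  by rewrite absKM s1 mul1r.
have val (s : K) : absK s = 1 -> s * s = 1 -> 2%:R - e <= projective_norm X Y (w1 + s *: w2).
  move=> s1 ss; have := bnd s s1 (w1 + s *: w2).
  have -> : ((w1 + s *: w2) (tensor_form al f) + s * (w1 + s *: w2) (tensor_form be g) : K)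
      = of_real (absK (al x) + absK (be x')).
    rewrite !tensorD !tensorZ /w1 /w2 /elementary !elementaryE /= /tensor_form gu fv.
    rewrite !mulr0 scaler0 addr0 add0r alxf.
    by rewrite [s * _]mulrA ss mul1r bexg of_realD.
  rewrite rnorm_of_real ger0_norm ?addr_ge0 ?rnorm_ge0//.
  set P := projective_norm X Y _ => hP.
  have : 2%:R - 2%:R * d <= (1 + d) * P by move: alx bex hP; lra.
  by move: d0; rewrite de; nra.
exists w1, w2; split; [exact: w_le1|exact: w_le1| |].
  by have := val 1; rewrite scale1r mulr1; apply=> //; exact: absK1.
have := val (-1); rewrite scaleN1r; apply; last by rewrite mulrNN mulr1.
by rewrite rnormN absK1.
Qed.

(** The dual form of the parallelogram law. When [t] and [t'] are the phases that
    turn [a h + b h] and [a h' - b h'] into their moduli [p] and [r], the sum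
    [p ^+ 2 + r ^+ 2] is the value [a (z + z') + b (z - z')] for [z = p t h] and
    [z' = r t' h'], and the law in [H] bounds this value. *)
Lemma dual_parallelogram (H : normedModType K) (a b : H -> K^o) (A : R) (h h' : H) :
  parallelogram H -> linear a -> linear b ->
  (forall z, absK (a z) <= A * rnorm z) -> (forall z, absK (b z) <= A * rnorm z) ->
  rnorm h <= 1 -> rnorm h' <= 1 ->
  absK (a h + b h) ^+ 2 + absK (a h' - b h') ^+ 2 <= 4%:R * A ^+ 2.
Proof.
move=> par la lb aA bA h1 h'1.
have [La LaE] := linear_bundle la; have [Lb LbE] := linear_bundle lb.
have [t [t1 tp]] := phase (a h + b h : K).
have [t' [t'1 tr]] := phase (a h' - b h' : K).
set p := absK (a h + b h) in tp *; set r := absK (a h' - b h') in tr *.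
have p0 : 0 <= p by exact: rnorm_ge0.
have r0 : 0 <= r by exact: rnorm_ge0.
pose z := (of_real p * t) *: h; pose z' := (of_real r * t') *: h'.
have : absK (a (z + z') + b (z - z')) = p ^+ 2 + r ^+ 2.
  rewrite -LaE -LbE linearD linearB /= !linearZ /=.
  rewrite [X in absK X](_ : _ = of_real (p ^+ 2 + r ^+ 2)).
    by rewrite rnorm_of_real ger0_norm// addr_ge0 ?sqr_ge0.
  transitivity (of_real p * (t * (a h + b h)) + of_real r * (t' * (a h' - b h')) : K).
    by rewrite LaE LbE /GRing.scale/=; ring.
  by rewrite tp tr of_realD !expr2 !of_realM.
move=> E; have : p ^+ 2 + r ^+ 2 <= A * (rnorm (z + z') + rnorm (z - z')).
  by rewrite -E mulrDr (le_trans (ler_rnormD _ _))// lerD.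
have zp : rnorm z <= p by rewrite rnormZ absKM t1 mulr1 rnorm_of_real ger0_norm// ler_piMr.
have z'r : rnorm z' <= r by rewrite rnormZ absKM t'1 mulr1 rnorm_of_real ger0_norm// ler_piMr.
have := par z z'; set P := rnorm (z + z'); set M := rnorm (z - z') => PM le.
have z2 : rnorm z ^+ 2 <= p ^+ 2 by rewrite lerXn2r ?nnegrE ?rnorm_ge0.
have z'2 : rnorm z' ^+ 2 <= r ^+ 2 by rewrite lerXn2r ?nnegrE ?rnorm_ge0.
set N := p ^+ 2 + r ^+ 2 in le *.
have N0 : 0 <= N by rewrite addr_ge0 ?sqr_ge0.
have PMN : (P + M) ^+ 2 <= 4%:R * N.
  by have := sqr_ge0 (P - M); rewrite /N sqrrB sqrrD; lra.
have N2 : N ^+ 2 <= A ^+ 2 * (4%:R * N).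
  apply: (@le_trans _ _ ((A * (P + M)) ^+ 2)).
    by rewrite lerXn2r ?nnegrE// (le_trans N0).
  by rewrite exprMn ler_wpM2l ?sqr_ge0.
have [->|Nn0] := eqVneq N 0; first by rewrite mulr_ge0 ?sqr_ge0.
have Np : 0 < N by rewrite lt_def Nn0.
by rewrite -(ler_pM2r Np) -expr2 (le_trans N2)// mulrCA mulrA.
Qed.

End ProjectiveTensor.

Section ProjectiveHilbert.
Variables (R : realType) (k : scalar_kind).
Local Notation K := (scalars R k).
Local Notation of_real := (of_real k).
Variables H Y : normedModType K.

(** The elementary tensors of unit vectors norm every functional on the
    projective tensor product. *)
Lemma large_elementary (Phi : tensor H Y -> K^o) (w : tensor H Y) (r c : R) : linear Phi ->
  projective_norm H Y w <= 1 -> c < r -> r <= absK (Phi w) ->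
  exists h y, [/\ rnorm h <= 1, rnorm y <= 1 & c <= absK (Phi (elementary h y))].
Proof.
move=> Phil w1 cr rw; have [c0|c0] := lerP c 0.
  by exists 0, 0; rewrite !rnorm0 ler01; split=> //; rewrite (le_trans c0) ?rnorm_ge0.
apply: contrapT => noxy.
have bnd x y : rnorm x <= 1 -> rnorm y <= 1 -> absK (Phi (elementary x y)) <= c.
  by move=> x1 y1; rewrite leNgt; apply/negP => /ltW cxy; apply: noxy; exists x, y.
have := projective_bound_unit c0 Phil bnd w; apply/negP; rewrite -ltNge.
by rewrite (lt_le_trans _ rw)// (le_lt_trans _ cr)// ler_piMr// ltW.
Qed.

(** Functionals [F] and [G] on the tensor product that norm [w1 + w2] and
    [w1 - w2] have large sum on [w1] and large difference on [w2], hence also on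
    elementary tensors [h (x) u] and [h' (x) v]; freezing [h] and [h'] leaves
    the coordinates of a contraction from [Y] to the plane. *)
Lemma contact_of_projective : parallelogram H ->
  almost_square (projective_norm H Y) -> forall e, 0 < e -> contact_up_to Y e.
Proof.
move=> par sq e0 e00; have [e e_gt0 e0E] : exists2 e : R, 0 < e & e0 = 2%:R * e.
  by exists (e0 / 2%:R); rewrite ?divr_gt0// [RHS]mulrC divfK// pnatr_eq0.
have [w1 [w2 [w11 w21 wp wm]]] := sq e e_gt0.
have [F [Fl Fp Fw]] := hahn_banach (projective_norm H Y) (w1 + w2).
have [G [Gl Gp Gw]] := hahn_banach (projective_norm H Y) (w1 - w2).
have [LF LFE] := linear_bundle Fl; have [LG LGE] := linear_bundle Gl.
have F1 : real_part (F w1 : K) + real_part (F w2 : K) = projective_norm H Y (w1 + w2).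
  by rewrite -real_partD -[RHS](real_part_of_real k) -Fw -LFE linearD.
have G1 : real_part (G w1 : K) - real_part (G w2 : K) = projective_norm H Y (w1 - w2).
  by rewrite -real_partN -real_partD -[RHS](real_part_of_real k) -Gw -LGE linearB.
have re_le (T : tensor H Y -> K^o) w : (forall w, absK (T w) <= projective_norm H Y w) ->
    projective_norm H Y w <= 1 -> real_part (T w : K) <= 1 /\ - real_part (T w : K) <= 1.
  move=> Tp w_1; split; first exact: le_trans (real_part_le _) (le_trans (Tp _) w_1).
  rewrite -real_partN (le_trans (real_part_le _))// rnormN.
  exact: le_trans (Tp _) w_1.
have [Fw1 _] := re_le _ _ Fp w11; have [Fw2 _] := re_le _ _ Fp w21.
have [Gw1 _] := re_le _ _ Gp w11; have [_ Gw2] := re_le _ _ Gp w21.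
pose Phi w : K^o := F w + G w; pose Psi w : K^o := F w - G w.
have Phil : linear Phi.
  move=> a w w'; rewrite /Phi -LFE -LGE !linearP /=.
  by rewrite /GRing.scale /=; ring.
have Psil : linear Psi.
  move=> a w w'; rewrite /Psi -LFE -LGE !linearP /=.
  by rewrite /GRing.scale /=; ring.
have Phi1 : 2%:R - 2%:R * e <= absK (Phi w1).
  by apply: le_trans (real_part_le _); rewrite real_partD; move: wp wm; rewrite -F1 -G1; lra.
have Psi2 : 2%:R - 2%:R * e <= absK (Psi w2).
  apply: le_trans (real_part_le _); rewrite real_partD real_partN.
  by move: wp wm; rewrite -F1 -G1; lra.
have lt4 : 2%:R - 4%:R * e < 2%:R - 2%:R * e by lra.
have [h [u [h1 u1 Phiu]]] := large_elementary Phil w11 lt4 Phi1.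
have [h' [v [h'1 v1 Psiv]]] := large_elementary Psil w21 lt4 Psi2.
pose c : R := 2%:R^-1.
have elin (T : tensor H Y -> K^o) x : linear T -> linear (fun y => of_real c * T (elementary x y) : K^o).
  move=> Tl a y y'; rewrite elementary_linear_r Tl mulrDr; congr (_ + _).
  exact: mulrCA.
have [|||f [g [fg fE gE]]] := @plane_functionals _ _ Y
  (fun y => of_real c * Phi (elementary h y)) (fun y => of_real c * Psi (elementary h' y)).
- exact: elin.
- exact: elin.
- move=> y; rewrite -!half_sqr -mulrDr.
  have ely (T : tensor H Y -> K^o) : linear T -> linear (fun x => T (elementary x y) : K^o).
    by move=> Tl a x x'; rewrite [elementary _ _]elementary_linear_l Tl.
  have bd (T : tensor H Y -> K^o) : (forall w, absK (T w) <= projective_norm H Y w) ->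
      forall x, absK (T (elementary x y)) <= rnorm y * rnorm x.
    by move=> Tp x; rewrite (le_trans (Tp _))// mulrC elementary_norm.
  have := dual_parallelogram par (ely _ Fl) (ely _ Gl) (bd _ Fp) (bd _ Gp) h1 h'1.
  by rewrite /Phi /Psi /c; lra.
have cn (z : K) : 2%:R - 4%:R * e <= absK z -> 1 - e0 <= absK (of_real c * z).
  by rewrite absKM rnorm_of_real ger0_norm ?invr_ge0// /c e0E; lra.
by exists f, g, u, v; split; rewrite ?fE ?gE//; exact: cn.
Qed.

End ProjectiveHilbert.

(** * An infinite-dimensional Hilbert space *)

Section HilbertSpace.
Variables (R : realType) (k : scalar_kind).
Local Notation K := (scalars R k).
Local Notation of_real := (of_real k).
Local Notation iK := (imaginary_unit R k).
Local Notation ell2 := (ell2 R k).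

(** Any [n] that is at least the size of [p] captures all the coefficients; the
    freedom in [n] allows to compare several polynomials in one Euclidean
    space. *)
Definition coefs n (p : {poly K}) : ell2 n := \row_(i < n) p`_i.

Lemma coefs_linear n : linear (coefs n).
Proof. by move=> a p q; apply/rowP => i; rewrite !mxE coefD coefZ. Qed.

Definition poly_norm (p : {poly K}) : R := ell2_norm (coefs (size p) p).

Lemma poly_normE n (p : {poly K}) : (size p <= n)%N -> poly_norm p = ell2_norm (coefs n p).
Proof.
move=> pn; rewrite /poly_norm /ell2_norm; congr Num.sqrt.
under eq_bigr do rewrite mxE; under [RHS]eq_bigr do rewrite mxE.
rewrite -(big_mkord xpredT (fun i => absK (p`_i) ^+ 2)).
rewrite -(big_mkord xpredT (fun i => absK (p`_i) ^+ 2)).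
rewrite (big_cat_nat (n := size p) _ pn)//= [X in _ = _ + X](_ : _ = 0) ?addr0//.
rewrite big_nat_cond big1//; move=> i /andP[/andP[pi _] _]; rewrite nth_default//.
by rewrite (@rnorm0 R k K^o) expr0n.
Qed.

Lemma poly_normD (p q : {poly K}) : poly_norm (p + q) <= poly_norm p + poly_norm q.
Proof.
pose n := maxn (size p) (size q).
rewrite (@poly_normE n (p + q)) ?size_polyD// (@poly_normE n p) ?leq_maxl//.
rewrite (@poly_normE n q) ?leq_maxr//.
have [L LE] := linear_bundle (@coefs_linear n).
by rewrite -LE linearD; exact: ler_ell2_normD.
Qed.

Lemma poly_normZ (a : K) (p : {poly K}) : poly_norm (a *: p) = absK a * poly_norm p.
Proof.
rewrite (@poly_normE (size p) (a *: p)) ?size_scale_leq//.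
have [L LE] := linear_bundle (@coefs_linear (size p)).
by rewrite -LE linearZ /= LE; exact: ell2_normZ.
Qed.

Definition poly_seminorm : seminorm {poly K} := Seminorm poly_normD poly_normZ.

(** The space of square-summable sequences, as the completion of the space of
    finitely supported ones. *)
Definition hilbert_space : completeNormedModType K := completion poly_seminorm.

Local Notation H := hilbert_space.

Let N (x : H) : R := rnorm x ^+ 2.

(** The inner product comes from the norm by polarization, so that its
    properties pass from the dense subspace to the completion by continuity. *)
Definition polarization (x y : H) : K :=
  of_real ((N (x + y) - N (x - y)) / 4%:R) +
  iK * of_real ((N (x + iK *: y) - N (x - iK *: y)) / 4%:R).

Lemma of_real_nat n : of_real n%:R = n%:R :> K.
Proof.
elim: n => [|n IH]; first exact: of_real0.
by rewrite -natr1 of_realD IH of_real1 natr1.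
Qed.

(** For real scalars the second term vanishes and the first one is already the
    inner product, which is then symmetric. *)
Lemma ell2_polarization n (a b : ell2 n) :
  of_real ((rnorm (a + b) ^+ 2 - rnorm (a - b) ^+ 2) / 4%:R) +
  iK * of_real ((rnorm (a + iK *: b) ^+ 2 - rnorm (a - iK *: b) ^+ 2) / 4%:R) = ell2_dot a b.
Proof.
have four (r : R) : of_real (r / 4%:R) = of_real r / 4%:R.
  by rewrite of_realM of_realV of_real_nat.
have sq (c : ell2 n) : of_real (rnorm (a + c) ^+ 2 - rnorm (a - c) ^+ 2) =
    2%:R * ell2_dot a c + 2%:R * ell2_dot c a.
  rewrite of_realD of_realN -(scaleN1r c) -!ell2_dotxx !ell2_dotDl !ell2_dotDr.
  by rewrite !ell2_dotZl !ell2_dotZr scalar_conjN scalar_conj1; ring.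
rewrite !four !sq ell2_dotZl ell2_dotZr.
have [i0|[ii ic]] : (k = RealScalars) \/ (iK * iK = -1 /\ scalar_conj iK = - iK).
- rewrite /imaginary_unit /scalar_conj; case: (k); [by left|right].
  split; first by rewrite -expr2 sqr_i.
  by apply/eqP; rewrite eq_complex /= oppr0 !eqxx.
- rewrite (_ : iK = 0) ?mul0r ?addr0.
    have -> : ell2_dot b a = ell2_dot a b.
      by rewrite ell2_dotC; move: (ell2_dot a b); rewrite /scalar_conj; case: (k) i0.
    have n4 : 4%:R != 0 :> K by rewrite pnatr_eq0.
    by field.
  by rewrite /imaginary_unit; case: (k) i0.
have n4 : 4%:R != 0 :> K by rewrite pnatr_eq0.
rewrite ic.
transitivity ((2%:R * ell2_dot a b + 2%:R * ell2_dot b a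
  - 2%:R * (iK * iK) * ell2_dot a b + 2%:R * (iK * iK) * ell2_dot b a) / 4%:R).
  by field.
by rewrite ii; field.
Qed.

Lemma polarization_dense n (p q : {poly K}) : (size p <= n)%N -> (size q <= n)%N ->
  polarization (to_completion poly_seminorm p) (to_completion poly_seminorm q) =
  ell2_dot (coefs n p) (coefs n q).
Proof.
move=> pn qn; rewrite -ell2_polarization /polarization.
have [L LE] := linear_bundle (@coefs_linear n).
have NE (r : {poly K}) : (size r <= n)%N ->
    N (to_completion poly_seminorm r) = rnorm (coefs n r) ^+ 2.
  by move=> rn; rewrite /N rnorm_to_completion /= (poly_normE rn) rnorm_ell2.
have sD (r s : {poly K}) : (size r <= n)%N -> (size s <= n)%N -> (size (r + s)%R <= n)%N.
  by move=> rn sn; rewrite (leq_trans (size_polyD _ _))// geq_max rn.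
have sZ a (r : {poly K}) : (size r <= n)%N -> (size (a *: r) <= n)%N.
  by move=> rn; rewrite (leq_trans (size_scale_leq _ _)).
have sN (r : {poly K}) : (size r <= n)%N -> (size (- r)%R <= n)%N by rewrite size_polyN.
by rewrite -!linearZ -!linearB -!linearD !NE ?sD ?sN ?sZ// -LE !(linearB, linearD, linearZ).
Qed.

Lemma dense_sequence (x : H) :
  exists u : nat -> {poly K}, (to_completion poly_seminorm (u n) : H) @[n --> \oo] --> x.
Proof.
have [u ->] := pi_completion_surj x; exists u.
apply/cvgrPdist_le => e e0.
have eE : of_real (real_part e) = e by apply: ge0_of_realE; exact: ltW.
have {}e0 : 0 < real_part e by rewrite -(of_real_gt0 k) eE.
have [M uM] := rnorm_sub_to_completion u e0.
exists M => // n /= Mn; rewrite -eE -of_real_rnorm ler_of_real.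
exact: uM.
Qed.

Lemma polarization_cvg (a b : nat -> H) x y : a n @[n --> \oo] --> x -> b n @[n --> \oo] --> y ->
  (polarization (a n) (b n) : K^o) @[n --> \oo] --> (polarization x y : K^o).
Proof.
move=> ax by_.
have Nc (c : nat -> H) z : c n @[n --> \oo] --> z -> N (c n) @[n --> \oo] --> N z.
  move=> cz; rewrite /N; apply: (@cvg_comp _ _ _ c (fun x => rnorm x ^+ 2)); first exact: cz.
  apply: (@continuous_comp _ _ _ (fun x : H => rnorm x) (fun r : R => r ^+ 2)).
    exact: rnorm_continuous.
  exact: sqr_continuous.
have half (c d : nat -> H) z t : c n @[n --> \oo] --> z -> d n @[n --> \oo] --> t ->
    (of_real ((N (c n) - N (d n)) / 4%:R) : K^o) @[n --> \oo] --> (of_real ((N z - N t) / 4%:R) : K^o).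
  move=> cz dt.
  apply: (@cvg_comp _ _ _ (fun n => (N (c n) - N (d n)) / 4%:R) (of_real : R -> K^o)); last first.
    exact: of_real_continuous.
  by apply: cvgMr_tmp; apply: cvgB; exact: Nc.
apply: (@cvgD _ K^o).
  by apply: half; [exact: cvgD|exact: cvgB].
apply: (@cvgMl_tmp K); apply: half.
  by apply: cvgD => //; apply: cvgZl_tmp.
by apply: cvgB => //; apply: cvgZl_tmp.
Qed.

Lemma scalar_conj_continuous : continuous (fun z : K^o => scalar_conj z : K^o).
Proof.
move=> z; apply/(@cvgrPdist_lt _ K^o _ (nbhs (z : K^o)) (nbhs_filter (z : K^o))) => e e0.
have eE : of_real (real_part e) = e by apply: ge0_of_realE; exact: ltW.
have {}e0 : 0 < real_part e by rewrite -(of_real_gt0 k) eE.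
apply: nbhs_rnorm; exists (real_part e) => // y zy.
rewrite -eE -(@of_real_rnorm R k K^o) ltr_of_real.
by rewrite -scalar_conjN -scalar_conjD absK_conj.
Qed.

Lemma hilbert_space_is_hilbert : is_hilbert H.
Proof.
pose emb : {poly K} -> H := to_completion poly_seminorm.
have limits_agree (c d : nat -> K^o) (s t : K^o) :
    c n @[n --> \oo] --> s -> d n @[n --> \oo] --> t -> (forall n, c n = d n) -> s = t.
  move=> cs dt /funext cd; rewrite cd in cs.
  exact: (@cvg_unique _ (@norm_hausdorff K K^o) _ _ _ _ cs dt).
exists polarization; split.
- move=> y a x x'; have [u ux] := dense_sequence x; have [u' ux'] := dense_sequence x'.
  have [v vy] := dense_sequence y.
  have l1 : (polarization (a *: emb (u n) + emb (u' n)) (emb (v n)) : K^o) @[n --> \oo] -->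
      (polarization (a *: x + x') y : K^o).
    apply: polarization_cvg vy; apply: cvgD ux'; exact: cvgZl_tmp.
  have l2 : (a *: (polarization (emb (u n)) (emb (v n)) : K^o) + polarization (emb (u' n)) (emb (v n)))
      @[n --> \oo] --> (a *: (polarization x y : K^o) + polarization x' y).
    apply: (@cvgD _ K^o); last exact: polarization_cvg.
    by apply: (@cvgZl_tmp _ K^o); exact: polarization_cvg.
  change (polarization (a *: x + x') y = a * polarization x y + polarization x' y).
  apply: (limits_agree _ _ _ _ l1 l2) => n; pose m := (size (u n) + size (u' n) + size (v n))%N.
  have um : (size (u n) <= m)%N by rewrite /m -addnA leq_addr.
  have u'm : (size (u' n) <= m)%N by rewrite /m addnAC leq_addl.
  have vm : (size (v n) <= m)%N by rewrite /m leq_addl.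
  rewrite /emb -linearZ -linearD !(@polarization_dense m)//.
    by rewrite coefs_linear ell2_dotDl ell2_dotZl.
  rewrite (leq_trans (size_polyD _ _))// geq_max u'm andbT.
  by rewrite (leq_trans (size_scale_leq _ _)).
- move=> x y; have [u ux] := dense_sequence x; have [v vy] := dense_sequence y.
  have l1 := polarization_cvg vy ux.
  have l2 : (scalar_conj (polarization (emb (u n)) (emb (v n))) : K^o)
      @[n --> \oo] --> (scalar_conj (polarization x y) : K^o).
    apply: (@cvg_comp _ _ _ (fun n => polarization (emb (u n)) (emb (v n)) : K^o)
      (fun z : K^o => scalar_conj z : K^o)); last exact: scalar_conj_continuous.
    exact: polarization_cvg.
  apply: (limits_agree _ _ _ _ l1 l2) => n; pose m := (size (u n) + size (v n))%N.
  by rewrite !(@polarization_dense m) ?leq_addr ?leq_addl// -ell2_dotC.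
- move=> x; have [u ux] := dense_sequence x.
  have l1 := polarization_cvg ux ux.
  have l2 : (of_real (N (emb (u n))) : K^o)
      @[n --> \oo] --> (of_real (N x) : K^o).
    apply: (@cvg_comp _ _ _ (fun n => N (emb (u n))) (of_real : R -> K^o)); last first.
      exact: of_real_continuous.
    apply: (@cvg_comp _ _ _ _ (fun x => rnorm x ^+ 2) _ _ _ ux).
    apply: (@continuous_comp _ _ _ (fun x : H => rnorm x) (fun r : R => r ^+ 2)).
      exact: rnorm_continuous.
    exact: sqr_continuous.
  rewrite -of_real_rnorm expr2 -of_realM -expr2.
  apply: (limits_agree _ _ _ _ l1 l2) => n; rewrite (@polarization_dense (size (u n)))// ell2_dotxx.
  by rewrite /N rnorm_to_completion rnorm_ell2.
Qed.

Lemma hilbert_space_infinite_dim : ~ finite_dim H.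
Proof.
apply: linear_inj_infinite_dim => n.
have [L LE] : exists L : {linear ell2 n -> H},
    L = (fun c => to_completion poly_seminorm (rVpoly c)) :> (_ -> _).
  by apply: linear_bundle => a c d; rewrite !linearP.
exists L; apply: raddf_inj => c Lc; have {}Lc : L c = 0 by [].
have : rnorm (L c) = 0 by rewrite Lc rnorm0.
rewrite LE rnorm_to_completion /= (@poly_normE n) ?size_poly// => /ell2_norm0_eq0 c0.
apply/rowP => i; have := congr1 (fun d : ell2 n => d ord0 i) c0.
by rewrite !mxE coef_rVpoly_ord.
Qed.

End HilbertSpace.

(** * The equivalences *)

Section Equivalences.
Variables (R : realType) (k : scalar_kind).
Local Notation K := (scalars R k).

Lemma finite_dim_has_dim (V : lmodType K) : finite_dim V -> has_dim V (dimension V).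
Proof. by move=> [n Vn]; rewrite (dimensionE Vn). Qed.

Lemma dimension_dual (E : normedModType K) : finite_dim E ->
  finite_dim (dual_space E) /\ dimension (dual_space E) = dimension E.
Proof.
move=> /finite_dim_has_dim/dual_has_dim En; split; last exact: dimensionE.
by exists (dimension E).
Qed.

Lemma positive_dim_neq0 (V : lmodType K) : (0 < dimension V)%N -> exists v : V, v != 0.
Proof.
move=> V0; apply: contrapT => noV.
have V_0 (v : V) : v = 0.
  by apply/eqP; apply: contrapT => /negP v0; apply: noV; exists v.
suff /dimensionE d0 : has_dim V 0 by rewrite d0 in V0.
have [f fE] : exists f : {linear V -> 'rV[K]_0}, f = (fun=> 0) :> (_ -> _).
  by apply: linear_bundle => a x y; rewrite scaler0 addr0.
by exists f; exists (fun=> 0) => x; [rewrite [RHS]V_0|apply/rowP => -[]].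
Qed.

Lemma infinite_dim_neq0 (V : lmodType K) : ~ finite_dim V -> exists v : V, v != 0.
Proof.
move=> infV; have [L injL] := infinite_dim_linear_inj infV 1.
exists (L (delta_mx ord0 ord0)); apply/eqP => L0.
have /rowP/(_ ord0) : (delta_mx ord0 ord0 : 'rV[K]_1) = 0 by apply: injL; rewrite L0 linear0.
by rewrite !mxE !eqxx => /eqP; rewrite oner_eq0.
Qed.

Lemma dual_neq0 (E : normedModType K) (v : E) : v != 0 ->
  exists phi : dual_space E, phi != 0.
Proof.
move=> v0; have [phi [_ phiv]] := norming_functional v.
exists phi; apply/eqP => phi0; move: phiv; rewrite phi0 -[LHS]/(0 : K) => /esym.
by rewrite -(of_real0 R k) => /of_real_inj/rnorm0_eq0/eqP; rewrite (negbTE v0).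
Qed.

Lemma hilbert_operators_contact (E H : normedModType K) : finite_dim E -> is_hilbert H ->
  CNJ (bounded_op E H) = 2%:R -> contact E.
Proof.
move=> Efin /hilbert_parallelogram par /CNJ_almost_square sq.
exact: contact_limit Efin (contact_of_operators par sq).
Qed.

Lemma hilbert_injective_contact (H Y : normedModType K) : finite_dim Y -> is_hilbert H ->
  CNJ (injective_tensor H Y) = 2%:R -> contact (dual_space Y).
Proof.
move=> Yfin /hilbert_parallelogram par /CNJ_almost_square/almost_square_completion.
move=> /(injective_square H Yfin) sq.
by apply: contact_limit (contact_of_operators par sq); case: (dimension_dual Yfin).
Qed.

Lemma contact_injective (X Y : normedModType K) : finite_dim Y -> ~ finite_dim X ->
  contact (dual_space Y) -> CNJ (injective_tensor X Y) = 2%:R.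
Proof.
move=> Yfin infX c; apply/almost_square_CNJ/almost_square_completion.
apply/(injective_square X Yfin)/CNJ_almost_square.
exact: operators_contact.
Qed.

Lemma hilbert_projective_contact (H Y : normedModType K) : finite_dim Y -> is_hilbert H ->
  CNJ (projective_tensor H Y) = 2%:R -> contact Y.
Proof.
move=> Yfin /hilbert_parallelogram par /CNJ_almost_square/almost_square_completion sq.
exact: contact_limit Yfin (contact_of_projective par sq).
Qed.

Lemma contact_projective (X Y : normedModType K) : ~ finite_dim X ->
  contact Y -> CNJ (projective_tensor X Y) = 2%:R.
Proof.
move=> infX c; apply/almost_square_CNJ/almost_square_completion.
exact: projective_square.
Qed.

End Equivalences.

Theorem theorem3p11 (R : realType) (k : scalar_kind) :
  (forall E Z : completeNormedModType (scalars R k),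
     finite_dim E -> (2 <= dimension E)%N -> ~ finite_dim Z ->
     Num.max (Num.max (CNJ Z) (CNJ (dual_space E))) (2%:R * omega_perp E ^+ 2)
       <= CNJ (bounded_op E Z))
  /\
  (forall E : completeNormedModType (scalars R k),
     finite_dim E -> (2 <= dimension E)%N ->
     [<-> OCP E;
          exists H : completeNormedModType (scalars R k),
            [/\ is_hilbert H, ~ finite_dim H & CNJ (bounded_op E H) = 2%:R];
          forall Z : completeNormedModType (scalars R k),
            ~ finite_dim Z -> CNJ (bounded_op E Z) = 2%:R])
  /\
  (forall Y : completeNormedModType (scalars R k),
     finite_dim Y -> (2 <= dimension Y)%N ->
     ((forall X : completeNormedModType (scalars R k),
         ~ finite_dim X -> CNJ (injective_tensor X Y) = 2%:R)
      <-> omega_perp (dual_space Y) = 1)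
     /\
     ((forall X : completeNormedModType (scalars R k),
         ~ finite_dim X -> CNJ (projective_tensor X Y) = 2%:R)
      <-> omega_perp Y = 1))
  /\
  (forall H Y : completeNormedModType (scalars R k),
     is_hilbert H -> ~ finite_dim H ->
     finite_dim Y -> (2 <= dimension Y)%N ->
     (CNJ (injective_tensor H Y) = 2%:R <-> omega_perp (dual_space Y) = 1)
     /\
     (CNJ (projective_tensor H Y) = 2%:R <-> omega_perp Y = 1)).
Proof.
have hilb := hilbert_space_is_hilbert R k; have infhilb := @hilbert_space_infinite_dim R k.
have OCPE (E : normedModType (scalars R k)) : (2 <= dimension E)%N -> OCP E <-> contact E.
  by move=> E2; split; [exact: OCP_contact|exact: contact_OCP].
have OCP_dual (Y : normedModType (scalars R k)) : finite_dim Y -> (2 <= dimension Y)%N ->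
    omega_perp (dual_space Y) = 1 <-> contact (dual_space Y).
  by move=> /dimension_dual[_ Yd] Y2; apply: OCPE; rewrite Yd.
split; [|split; [|split]].
- move=> E Z Efin E2 infZ; rewrite !ge_max; apply/andP; split; first (apply/andP; split).
  + have [v /dual_neq0[phi]] := positive_dim_neq0 (ltnW E2).
    exact: CNJ_range_le.
  + by have [z] := infinite_dim_neq0 infZ; exact: CNJ_dual_le.
  + have [->|[f [g [u [v [fg u1 v1 w0 [wu wv]]]]]]] := omega_perpP E.
      by rewrite expr0n mulr0 CNJ_ge0.
    exact: CNJ_operators_ge infZ fg u1 v1 w0 wu wv.
- move=> E Efin E2; tfae.
  + move=> /(OCPE _ E2) c; exists (hilbert_space R k); split=> //.
    exact: operators_contact.
  + move=> [H [Hh _ /(hilbert_operators_contact Efin Hh) c]] Z infZ.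
    exact: operators_contact.
  + move=> /(_ _ infhilb) C2; apply/(OCPE _ E2).
    exact: hilbert_operators_contact Efin hilb C2.
- move=> Y Yfin Y2; split; split.
  + move=> /(_ _ infhilb) C2; apply/(OCP_dual _ Yfin Y2).
    exact: hilbert_injective_contact Yfin hilb C2.
  + by move=> /(OCP_dual _ Yfin Y2) c X infX; exact: contact_injective.
  + move=> /(_ _ infhilb) C2; apply/(OCPE _ Y2).
    exact: hilbert_projective_contact Yfin hilb C2.
  + by move=> /(OCPE _ Y2) c X infX; exact: contact_projective.
- move=> H Y Hh infH Yfin Y2; split; split.
  + move=> C2; apply/(OCP_dual _ Yfin Y2).
    exact: hilbert_injective_contact Yfin Hh C2.
  + by move=> /(OCP_dual _ Yfin Y2) c; exact: contact_injective.
  + move=> C2; apply/(OCPE _ Y2).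
    exact: hilbert_projective_contact Yfin Hh C2.
  + by move=> /(OCPE _ Y2) c; exact: contact_projective.
Qed.
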